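(* Let $n,k\ge 1$ be integers and $s\in(0,1)$. Let $\omega^n\subset\mathbb{R}^n$ be a bounded Lipschitz domain and let $B^k_1\subset\mathbb{R}^k$ be a bounded, open and convex neighbourhood of the origin. For $\ell\in(0,\infty)$ put $B^k_\ell=\ell B^k_1$ and $\Omega^{n+k}_\ell=\omega^n\times B^k_\ell\subset\mathbb{R}^{n+k}$, with points written $(x,t)$, $x\in\mathbb{R}^n$, $t\in\mathbb{R}^k$. For each $\ell>0$ let $f_\ell\in L^2(\Omega^{n+k}_\ell)$ and let $u_\ell\in\widetilde H^s(\Omega^{n+k}_\ell)$ be the (unique) weak solution of $$(-\Delta_{\mathbb{R}^{n+k}})^su_\ell=f_\ell\ \text{ in }\Omega^{n+k}_\ell,\qquad u_\ell\equiv0\ \text{ in }\mathbb{R}^{n+k}\setminus\overline{\Omega^{n+k}_\ell}.$$ Let $f_\infty\in L^2(\omega^n)$ and assume that the functions $(x,t)\mapsto f_\ell(x,\ell t)$ converge to $f_\infty$ strongly in $L^2(\Omega^{n+k}_1)$ as $\ell\to\infty$, where $f_\infty=f_\infty(x)$ is regarded as a function in $L^2(\Omega^{n+k}_1)$ which is constant in the $t$-variable. Let $\rho_\ell:\widetilde H^s(\Omega^{n+k}_\ell)\to\widetilde H^s(\omega^n)$ be the averaging operator $\rho_\ell(v)(x)=\dfrac{1}{|B^k_\ell|}\displaystyle\int_{B^k_\ell}v(x,t)\,dt$. Then, as $\ell\to\infty$, $$\rho_\ell(u_\ell)\to u_\infty\quad\text{strongly in }\widetilde H^s(\omega^n),$$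 where $u_\infty\in\widetilde H^s(\omega^n)$ is the weak solution of $(-\Delta_{\mathbb{R}^n})^su_\infty=f_\infty$ in $\omega^n$, $u_\infty\equiv0$ in $\mathbb{R}^n\setminus\overline{\omega^n}$.
   Context: All functions are real-valued. For an integer $d\ge1$ and $s\in(0,1)$, define for $u\in L^2(\mathbb{R}^d)$ $$\mathcal{E}^s_d(u)=\frac{C_{d,s}}{2}\iint_{\mathbb{R}^d\times\mathbb{R}^d}\frac{(u(z)-u(\eta))^2}{|z-\eta|^{d+2s}}\,dz\,d\eta,\qquad C_{d,s}=\frac{s2^{2s}}{\Gamma(1-s)}\frac{\Gamma\left(\frac{d+2s}{2}\right)}{\pi^{d/2}};$$ equivalently $\mathcal{E}^s_d(u)=\int_{\mathbb{R}^d}|\xi|^{2s}|\mathcal{F}_d[u](\xi)|^2\,d\xi$, where $\mathcal{F}_d$ is the unitary Fourier transform on $\mathbb{R}^d$. $H^s(\mathbb{R}^d)=\{u\in L^2(\mathbb{R}^d): \mathcal{E}^s_d(u)<\infty\}$. For a Lipschitz domain $U\subset\mathbb{R}^d$, $\widetilde H^s(U)=\{u\in H^s(\mathbb{R}^d): u\equiv 0 \text{ on } \mathbb{R}^d\setminus\overline U\}$. If $U$ is bounded, $\widetilde H^s(U)$ is a Hilbert space with norm $\|u\|_{\widetilde H^s(U)}=\mathcal{E}^s_d(u)^{1/2}$. For $f\in L^2(U)$, $u$ is a weak solution of $(-\Delta_{\mathbb{R}^d})^su=f$ in $U$, $u=0$ in $\mathbb{R}^d\setminus\overline U$, if $u\in\widetilde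 H^s(U)$ and $\int_{\mathbb{R}^d}|\xi|^{2s}\mathcal{F}_d[u]\overline{\mathcal{F}_d[\varphi]}\,d\xi=\int_Uf\varphi\,dz$ for every $\varphi\in\widetilde H^s(U)$. *)

(* Defs.v *)
From HB Require Import structures.
From mathcomp Require Import all_boot all_order all_algebra.
From mathcomp Require Import all_classical all_reals all_analysis.
From mathcomp Require Import complex.

Set Implicit Arguments.
Unset Strict Implicit.
Unset Printing Implicit Defensive.

Import Order.TTheory GRing.Theory Num.Theory.
Import numFieldNormedType.Exports.

Local Open Scope classical_set_scope.
Local Open Scope ring_scope.

(* The Euclidean space R^d is 'rV[R]_d with the sigma-algebra generated by the
   coordinates, exactly as the library does for d.-tuple R; it is the Borel
   sigma-algebra of R^d. *)
Section measurable_rV.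
Variables (R : realType) (d : nat).

Let coord (i : 'I_d) (x : 'rV[R]_d) : measurableTypeR R := x ord0 i.

Let rV_set0 : g_sigma_preimage coord set0.
Proof. exact: sigma_algebra0. Qed.

Let rV_setC A : g_sigma_preimage coord A -> g_sigma_preimage coord (~` A).
Proof. exact: sigma_algebraC. Qed.

Let rV_bigcup (F : (set 'rV[R]_d)^nat) :
  (forall i, g_sigma_preimage coord (F i)) ->
  g_sigma_preimage coord (\bigcup_i (F i)).
Proof. exact: sigma_algebra_bigcup. Qed.

HB.instance Definition _ := @isMeasurable.Build
  (measure_tuple_display default_measure_display)
  'rV[R]_d (g_sigma_preimage coord) rV_set0 rV_setC rV_bigcup.

Lemma measurable_coord i :
  measurable_fun setT (fun x : 'rV[R]_d => x ord0 i : measurableTypeR R).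
Proof.
move=> _ Y mY; rewrite setTI; apply: sub_sigma_algebra => /=.
rewrite -bigcup_seq/=; exists i => /=; first by rewrite mem_index_enum.
by exists Y => //; rewrite setTI.
Qed.

Lemma measurable_fun_rV dT (T : measurableType dT) (f : T -> 'rV[R]_d) :
  (forall i, measurable_fun setT (fun t => f t ord0 i : measurableTypeR R)) ->
  measurable_fun setT f.
Proof.
move=> mf _ A mA; rewrite setTI.
have : preimage_set_system setT f (g_sigma_preimage coord) (f @^-1` A).
  by exists A => //; rewrite setTI.
rewrite /g_sigma_preimage -g_sigma_preimageE; apply; split.
  exact: sigma_algebra_measurable.
move=> _ [B + <-]; rewrite -bigcup_seq/= => -[i _ [C mC <-]].
by rewrite !setTI; have := mf i measurableT C mC; rewrite setTI.
Qed.

End measurable_rV.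

Section lebesgue_rV.
Variable R : realType.

Definition rV_cons d (p : measurableTypeR R * 'rV[R]_d) : 'rV[R]_d.+1 :=
  row_mx (p.1%:M : 'rV[R]_1) p.2.

Definition rV_uncons d (x : 'rV[R]_d.+1) : measurableTypeR R * 'rV[R]_d :=
  ((lsubmx (x : 'rV[R]_(1 + d))) ord0 ord0, rsubmx (x : 'rV[R]_(1 + d))).

Lemma rV_consK d : cancel (@rV_cons d) (@rV_uncons d).
Proof.
case=> a x; rewrite /rV_uncons /rV_cons row_mxKl row_mxKr.
by rewrite mxE eqxx mulr1n.
Qed.

Lemma measurable_rV_cons d : measurable_fun setT (@rV_cons d).
Proof.
apply: measurable_fun_rV => i.
have [j ->|j ->] := @split_ordP 1 d i.
  have E : (fun t => @rV_cons d t ord0 (lshift d j)) = fst.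
    by apply/funext => p; rewrite /rV_cons (@row_mxEl _ 1 1 d) mxE (ord1 j) mulr1n.
  rewrite E; exact: measurable_fst.
have E : (fun t => @rV_cons d t ord0 (rshift 1 j)) =
    (fun x : 'rV[R]_d => x ord0 j) \o snd.
  by apply/funext => p; rewrite /rV_cons (@row_mxEr _ 1 1 d).
rewrite E; exact: (measurableT_comp (@measurable_coord R d j) measurable_snd).
Qed.

Lemma measurable_rV_uncons d : measurable_fun setT (@rV_uncons d).
Proof.
apply: measurable_fun_pair => /=.
  under eq_fun do rewrite mxE.
  exact: measurable_coord.
apply: measurable_fun_rV => i; under eq_fun do rewrite mxE.
exact: measurable_coord.
Qed.

Section leb_step.
Variables (d : nat) (mu : {sigma_finite_measure set 'rV[R]_d -> \bar R}).

Definition leb_step : set 'rV[R]_d.+1 -> \bar R :=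
  pushforward (@lebesgue_measure R \x mu)%E (@rV_cons d).

Let leb_step0 : leb_step set0 = 0%E.
Proof. by rewrite /leb_step /pushforward preimage_set0 measure0. Qed.

Let leb_step_ge0 A : (0 <= leb_step A)%E.
Proof. by rewrite /leb_step /pushforward measure_ge0. Qed.

Let leb_step_sigma_additive : semi_sigma_additive leb_step.
Proof.
move=> F mF tF mUF; rewrite /leb_step /pushforward preimage_bigcup.
apply: measure_semi_sigma_additive.
- by move=> i; rewrite -[X in measurable X]setTI; exact: measurable_rV_cons.
- apply/trivIsetP => /= i j _ _ ij; rewrite -preimage_setI.
  by move/trivIsetP : tF => /(_ _ _ _ _ ij) ->//; rewrite preimage_set0.
- rewrite -preimage_bigcup -[X in measurable X]setTI.
  exact: measurable_rV_cons.
Qed.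

HB.instance Definition _ := isMeasure.Build _ _ _ leb_step
  leb_step0 leb_step_ge0 leb_step_sigma_additive.

Let leb_step_sigma_finite : sigma_finite setT leb_step.
Proof.
have /sigma_finiteP[F [TF ndF mF]] := sigma_finiteT (@lebesgue_measure R).
have /sigma_finiteP[G [TG ndG mG]] := sigma_finiteT mu.
exists (fun i => @rV_uncons d @^-1` (F i `*` G i)).
  rewrite -preimage_bigcup -(preimage_setT (@rV_uncons d)); congr preimage.
  rewrite -setXTT TF TG; apply/seteqP; split => -[x y] /=.
    move=> [[i _ Fix] [j _ Gjy]]; exists (maxn i j) => //; split.
      by move: x Fix; exact/subsetPset/ndF/leq_maxl.
    by move: y Gjy; exact/subsetPset/ndG/leq_maxr.
  by move=> [i _ []/= ? ?]; split; exists i.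
move=> i; have [? ?] := mF i; have [? ?] := mG i.
have mFG : measurable (F i `*` G i) by exact: measurableX.
split.
  by rewrite -[X in measurable X]setTI; exact: measurable_rV_uncons.
rewrite /leb_step /pushforward -comp_preimage.
have -> : @rV_uncons d \o @rV_cons d = id by apply/funext; exact: rV_consK.
by rewrite preimage_id product_measure1E// lte_mul_pinfty// ge0_fin_numE.
Qed.

HB.instance Definition _ := Measure_isSigmaFinite.Build _ _ _ leb_step
  leb_step_sigma_finite.

End leb_step.

(* Lebesgue measure on R^d: R^(d+1) carries the product of the Lebesgue measures
   of R and R^d, and R^0 is a point of mass 1. *)
Fixpoint leb d : {sigma_finite_measure set 'rV[R]_d -> \bar R} :=
  match d return {sigma_finite_measure set 'rV[R]_d -> \bar R} with
  | 0%N => @dirac _ _ (0 : 'rV[R]_0) R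
  | d'.+1 => leb_step (leb d')
  end.

End lebesgue_rV.

(* The norm of the library on 'rV[R]_d is the sup norm. It induces the usual
   topology, bounded sets and Lipschitz maps, but the kernels below need the
   Euclidean norm. *)
Section euclidean.
Variables (R : realType) (d : nat).
Implicit Types (x y : 'rV[R]_d) (U : set 'rV[R]_d).

Definition dotv x y : R := \sum_(i < d) x ord0 i * y ord0 i.

Definition enorm x : R := Num.sqrt (dotv x x).

(* In an orthonormal basis of R^d ending with the unit vector e, the last
   coordinate of x is dotv x e and the others are those of its projection on the
   orthogonal complement of e, a copy of R^(d-1). *)
Definition orth_proj (e x : 'rV[R]_d) : 'rV[R]_d := x - dotv x e *: e.

(* Near each boundary point, U is the strict subgraph of a Lipschitz function of
   d-1 variables in a suitable orthonormal basis; only the values of g on the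
   orthogonal complement of e matter. *)
Definition lipschitz_boundary U :=
  forall x0, (closure U `\` U°) x0 ->
  exists (e : 'rV[R]_d) (g : 'rV[R]_d -> R) (k : R),
    [/\ enorm e = 1, k.-lipschitz g &
        \forall x \near x0, U x <-> dotv x e < g (orth_proj e x)].

Definition lipschitz_domain U :=
  [/\ U !=set0, open U, connected U & lipschitz_boundary U].

End euclidean.

Section complex_integral.
Context d (T : measurableType d) (R : realType).

Definition cintegral (mu : {measure set T -> \bar R}) (D : set T)
    (f : T -> R[i]) : R[i] :=
  ((\int[mu]_(x in D) complex.Re (f x)) +i*
   (\int[mu]_(x in D) complex.Im (f x)))%C.

End complex_integral.

Section fractional.
Variable R : realType.

Definition Gamma (a : R) : R :=
  \int[lebesgue_measure]_(x in `]0, +oo[) (x `^ (a - 1) * expR (- x)).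

Section fixed_dimension.
Variable d : nat.
Implicit Types (u f phi : 'rV[R]_d -> R) (v : 'rV[R]_d -> R[i]).
Implicit Types (U : set 'rV[R]_d) (s r : R) (z xi : 'rV[R]_d).

(* The restriction of u to U is in L^2(U): its extension by zero is in L^2(R^d).
   Here and below, elements of L^2 are given by Borel representatives. *)
Definition L2 U u := u \_ U \in Lfun (leb R d) 2%:E.

Definition L2norm U u : \bar R := 'N[leb R d]_2%:E [EFin \o (u \_ U)]%E.

Definition frac_const s : R :=
  s * 2 `^ (2 * s) / Gamma (1 - s) *
  (Gamma ((d%:R + 2 * s) / 2) / pi `^ (d%:R / 2)).

Definition energy s u : \bar R :=
  ((frac_const s / 2)%:E *
   \int[leb R d \x leb R d]_p
     ((u p.1 - u p.2) ^+ 2 / enorm (p.1 - p.2) `^ (d%:R + 2 * s))%:E)%E.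

Definition Hs s u := L2 setT u /\ (energy s u < +oo)%E.

Definition Htilde s U u :=
  Hs s u /\ {ae leb R d, forall z, ~ closure U z -> u z = 0}.

Definition Htilde_norm s u : \bar R := (energy s u `^ 2^-1)%E.

Definition fourier_trunc r u xi : R[i] :=
  ((2 * pi) `^ (- (d%:R / 2)))%:C%C *
  cintegral (leb R d) [set z | enorm z < r]
    (fun z => (u z)%:C%C * (cos (dotv z xi) -i* sin (dotv z xi))%C).

(* The unitary Fourier transform on L^2: the truncations of u to balls are in
   L^1 and L^2, so v is the Fourier transform of u if and only if their Fourier
   integrals converge to v in L^2. *)
Definition is_fourier u v :=
  [/\ measurable_fun setT (fun xi => complex.Re (v xi)),
      measurable_fun setT (fun xi => complex.Im (v xi)) &
      (\int[leb R d]_xi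
         (complex.Re (v xi - fourier_trunc r u xi) ^+ 2 +
          complex.Im (v xi - fourier_trunc r u xi) ^+ 2)%:E)%E
      @[r --> +oo%R] --> 0%E].

(* Only determined up to a null set. *)
Definition fourier u : 'rV[R]_d -> R[i] := xget (fun=> 0) [set v | is_fourier u v].

Definition weak_solution s U f u :=
  Htilde s U u /\
  forall phi, Htilde s U phi ->
    cintegral (leb R d) setT
      (fun xi => (enorm xi `^ (2 * s))%:C%C * fourier u xi * (fourier phi xi)^*%C)
    = (\int[leb R d]_(z in U) (f z * phi z))%:C%C.

End fixed_dimension.

Section cylinder.
Variables n k : nat.
Implicit Types (omega : set 'rV[R]_n) (B : set 'rV[R]_k) (l : R).

Definition dilate l B : set 'rV[R]_k := [set l *: t | t in B].

(* The point (x, t) is row_mx x t. *)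
Definition cylinder omega B : set 'rV[R]_(n + k) :=
  [set z | omega (lsubmx z) /\ B (rsubmx z)].

Definition average B (v : 'rV[R]_(n + k) -> R) (x : 'rV[R]_n) : R :=
  (fine (leb R k B))^-1 * \int[leb R k]_(t in B) v (row_mx x t).

End cylinder.
End fractional.

(* Main.v *)
(** Up to a positive constant, the energy of u is the integral over t > 0 of
t^(-1-s) D_t(u), where D_t(u) is the double integral of (u x - u y)^2 against
the heat kernel at time t.  The heat kernel is positive definite and factorizes
over R^n x R^k.  Writing Q for this integral and Q^x, Q^t for the same
functional applied to the slices in x, respectively in t, and integrated over
the other variable, this gives Q^x(w) <= Q(w) <= Q^x(w) + Q^t(w).

Take U(x, t) = uinf(x) eta(t / l) with eta a Lipschitz cutoff supported in B,
and w = u_l - U.  Testing the equation of u_l with w and, on almost every slice,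
the equation of uinf with the slice of w, the comparison above leaves
Q^x(w) + Q(w) <= Q^t(U) + 4 kappa <f_l - finf eta(. / l), w>.  A Poincare
inequality on the slices absorbs w, Q^t(U) = O(l^(k - 2s)) by scaling, and
Jensen's inequality bounds the energy of the average minus uinf by the mean over
t of the slice energies of u_l - uinf.  First eta is chosen close to 1 on B in
L^2, then l tends to infinity. *)

Require Import Defs.
From HB Require Import structures.
From mathcomp Require Import all_boot all_order all_algebra.
From mathcomp Require Import all_classical all_reals all_analysis.
From mathcomp Require Import complex ring lra measurable_realfun.

Set Implicit Arguments.
Unset Strict Implicit.
Unset Printing Implicit Defensive.

Import Order.TTheory GRing.Theory Num.Theory.
Import numFieldNormedType.Exports.

Local Open Scope classical_set_scope.
Local Open Scope ring_scope.

(** * The Fourier transform of the Gaussian *)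

(** The kernel [|z|^(-d-2s)] does not split over R^n x R^k. For the heat kernel, D_t of a function
    on the product is an average, over pairs of slices, of double integrals of one slice against the
    other ([heatC]). Positive definiteness bounds these below by the energies of the two slices; the
    excess is controlled by the squared L2 distance of the slices, which recombines into energies in
    t.

    Both halves of the comparison serve one cancellation. With [h = eta(t / l)], Q^x(U) equals
    [|h|^2 Q(uinf)], of the order [l^k] of the volume of B_l, hence not small after averaging. It
    bounds Q(U) up to Q^t(U), and it reappears exactly when Q^x(u_l) is expanded around multiples of
    [uinf]; since Q^x(u_l) <= Q(u_l), it drops out.

    The cutoff makes [U] admissible on the bounded cylinder, which [uinf], constant in t, is not.
    Its shape is frozen while l grows, so [1 - eta] leaves an error that does not vanish with l:
    hence two successive limits. The Poincare inequality acts on slices, so its constant depends on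
    [omega] only and the absorption is uniform in l. *)

Section gauss1.
Variable R : realType.
Notation mu := (@lebesgue_measure R).
Implicit Types t z x th : R.

Definition gauss t x : R := expR (- (t * x ^+ 2)).

Lemma measurable_gauss t : measurable_fun setT (gauss t).
Proof.
apply: measurableT_comp => //; apply: measurableT_comp => //.
by apply: measurable_funM => //; apply: measurable_funX.
Qed.

(** [gauss t] is a multiple of the centred normal density of variance [(2 t)^-1], whose total mass
    is one. *)
Lemma integral_gauss t : 0 < t ->
  (\int[mu]_x (gauss t x)%:E = (Num.sqrt (pi / t))%:E)%E.
Proof.
move=> t0; pose s := Num.sqrt (t *+ 2)^-1.
have t20 : 0 < t *+ 2 by rewrite pmulrn_lgt0.
have s0 : s != 0 by rewrite sqrtr_eq0 -ltNge invr_gt0.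
have ss : s ^+ 2 = (t *+ 2)^-1 by rewrite sqr_sqrtr// invr_ge0 ltW.
have E x : (gauss t x)%:E = ((normal_peak s)^-1%:E * (normal_pdf 0 s x)%:E)%E.
  rewrite -EFinM normal_pdfE// mulrA mulVf ?gt_eqF ?normal_peak_gt0// mul1r.
  rewrite /normal_fun ss subr0; congr (expR _)%:E.
  by rewrite -[_^-1 *+ 2]mulr_natl -[t *+ 2]mulr_natl; field; apply: lt0r_neq0.
under eq_integral do rewrite E.
rewrite integralZl//=; last exact: integrable_normal_pdf.
rewrite integral_normal_pdf mule1 /normal_peak invrK ss; congr (Num.sqrt _)%:E.
by rewrite -[t *+ 2]mulr_natl -mulr_natl; field; apply: lt0r_neq0.
Qed.

Lemma integrable_gauss t : 0 < t -> mu.-integrable setT (EFin \o gauss t).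
Proof.
move=> t0; apply/integrableP; split.
  by apply/measurable_EFinP; apply: measurable_gauss.
under eq_integral do rewrite /= ger0_norm ?expR_ge0//.
by rewrite integral_gauss// ltry.
Qed.

(** Half of the Gaussian absorbs the factor [|x|]: [expR y >= 1 + y] bounds [gauss (t / 2) x] by
    [(1 + t x^2 / 2)^-1]. The right-hand side involves no frequency, so it is a majorant for
    differentiation under the integral sign. *)
Lemma norm_mul_gauss_le t x : 0 < t ->
  `|x| * gauss t x <= (t^-1 + 1) * gauss (t / 2) x.
Proof.
move=> t0.
have -> : gauss t x = gauss (t / 2) x * gauss (t / 2) x.
  by rewrite /gauss -expRD; congr expR; field.
rewrite mulrA ler_wpM2r ?expR_ge0//.
have p : 0 < 1 + t / 2 * x ^+ 2.
  by rewrite ltr_pwDl// mulr_ge0 ?sqr_ge0// divr_ge0 ?ltW.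
have h : gauss (t / 2) x <= (1 + t / 2 * x ^+ 2)^-1.
  by rewrite /gauss expRN lef_pV2 ?posrE ?expR_gt0 ?expR_ge1Dx.
apply: (le_trans (ler_wpM2l (normr_ge0 _) h)).
rewrite ler_pdivrMr// -(real_normK (num_real x)).
set y := `|x|.
have -> : (t^-1 + 1) * (1 + t / 2 * y ^+ 2) =
    t^-1 + 1 + y ^+ 2 / 2 + t * y ^+ 2 / 2.
  by field; apply: lt0r_neq0.
have h1 : 0 < t^-1 by rewrite invr_gt0.
have h2 : 0 <= t * y ^+ 2 by rewrite mulr_ge0 ?sqr_ge0 ?ltW.
have h3 := sqr_ge0 (y - 1).
by nra.
Qed.

Lemma integrable_gaussM t (g : R -> R) : 0 < t -> measurable_fun setT g ->
  (forall x, `|g x| <= 1) ->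
  mu.-integrable setT (EFin \o (fun x => gauss t x * g x)).
Proof.
move=> t0 mg g1; apply: le_integrable (integrable_gauss t0) => //.
  apply/measurable_EFinP; apply: measurable_funM => //.
  exact: measurable_gauss.
move=> x _ /=; rewrite lee_fin normrM.
by rewrite -[leRHS]mulr1 ler_wpM2l.
Qed.

Lemma integrable_mul_gaussM t (g : R -> R) : 0 < t -> measurable_fun setT g ->
  (forall x, `|g x| <= 1) ->
  mu.-integrable setT (EFin \o (fun x => x * gauss t x * g x)).
Proof.
move=> t0 mg g1.
have t20 : 0 < t / 2 by rewrite divr_gt0.
have := integrableZl measurableT (t^-1 + 1) (integrable_gauss t20).
apply: le_integrable => //.
  apply/measurable_EFinP; apply: measurable_funM => //.
  by apply: measurable_funM => //; exact: measurable_gauss.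
move=> x _ /=; rewrite lee_fin normrM.
rewrite [leRHS]ger0_norm; last first.
  by rewrite mulr_ge0 ?expR_ge0// addr_ge0 ?invr_ge0// ltW.
apply: le_trans (norm_mul_gauss_le x t0).
rewrite normrM (ger0_norm (expR_ge0 _)).
by rewrite -[leRHS]mulr1 ler_wpM2l// mulr_ge0 ?expR_ge0.
Qed.

(** Integration by parts without boundary terms: the fundamental theorem on [[-n-1, n+1]], then
    dominated convergence with majorant [|f|]. *)
Lemma Rintegral_derive_eq0 (F f : R -> R) :
  (forall x, is_derive x 1 F (f x)) -> continuous f ->
  mu.-integrable setT (EFin \o f) ->
  F n%:R @[n --> \oo] --> 0 -> F (- n%:R) @[n --> \oo] --> 0 ->
  \int[mu]_x f x = 0.
Proof.
move=> dF cf intf Fy FNy.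
have cF : continuous F.
  by move=> x; apply/differentiable_continuous/derivable1_diffP; apply: ex_derive.
pose f_ n : R -> \bar R := (EFin \o f) \_ `[- n.+1%:R, n.+1%:R]%classic.
have cvf : (\int[mu]_x f_ n x)%E @[n --> \oo] --> (\int[mu]_x (f x)%:E)%E.
  apply: (@dominated_cvg _ _ _ mu setT measurableT f_ (EFin \o f) (fun x => `|(f x)%:E|%E)) => //.
  - move=> n; apply: (measurable_restrictT _ _).1 => //.
    by apply: measurable_funTS; exact: (measurable_int mu).
  - move=> x _; apply: cvg_near_cst; near=> n.
    rewrite /f_ patchE mem_set//= in_itv/= -ler_norml.
    near: n; exists (Num.truncn `|x|) => // n /= xn.
    apply: ltW; apply: (lt_le_trans (truncnS_gt _)).
    by rewrite ler_nat.
  - by apply: integrable_abse.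
  - move=> n x _; rewrite /f_ patchE; case: ifPn => //= _.
    by rewrite lee_fin normr0.
have E n : (\int[mu]_x f_ n x)%E = (F n.+1%:R - F (- n.+1%:R))%:E.
  rewrite -integral_mkcond (@continuous_FTC2 _ f F)//.
  - by rewrite (@lt_trans _ _ 0)// oppr_lt0.
  - exact: continuous_subspaceT.
  - split => //.
    + apply: cvg_at_right_filter; exact: cF.
    + apply: cvg_at_left_filter; exact: cF.
  - by move=> x _; rewrite derive1E; apply: derive_val.
have cv0 : (\int[mu]_x f_ n x)%E @[n --> \oo] --> (0 : R)%:E.
  under eq_fun do rewrite E.
  apply: cvg_EFin; first by near=> n.
  rewrite -[X in _ --> X](subr0 0); apply: cvgB.
  - by rewrite (cvg_shiftS (fun n => F n%:R)).
  - by rewrite (cvg_shiftS (fun n => F (- n%:R))).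
rewrite /Rintegral.
by have -> : (\int[mu]_x (f x)%:E)%E = 0%:E by exact: cvg_unique cvf cv0.
Unshelve. all: by end_near. Qed.


Lemma is_derive_gauss t x : is_derive x 1 (gauss t) (- (2 * t * x) * gauss t x).
Proof.
rewrite /gauss; apply: is_derive_eq.
by rewrite /GRing.scale/=; ring.
Qed.

Lemma is_derive_gauss_sin t z th x :
  is_derive x 1 (fun x => gauss t x * sin (z * x + th))
    (z * (gauss t x * cos (z * x + th)) -
     2 * t * (x * gauss t x * sin (z * x + th))).
Proof.
have dg := is_derive_gauss t x.
apply: is_derive_eq.
by rewrite /GRing.scale/=; ring.
Qed.

Lemma is_derive_gauss_cos t th x z :
  is_derive z 1 (fun z => gauss t x * cos (z * x + th))
    (- (x * gauss t x * sin (z * x + th))).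
Proof.
apply: is_derive_eq.
by rewrite /GRing.scale/=; ring.
Qed.

(** The sequence [y] stands for both ends, [n] and [-n]. The comparison with [2 / (t (n + 1))] comes
    from [expR x >= 1 + x] and from [n^2 >= (n + 1) / 2] for [n >= 1]. *)
Lemma cvg_gauss t (y : nat -> R) : 0 < t -> (forall n, `|y n| = n%:R) ->
  gauss t (y n) @[n --> \oo] --> 0.
Proof.
move=> t0 yn.
apply: (@squeeze_cvgr _ _ _ _ (cst 0) (fun n => 2 / t * n.+1%:R^-1)); last 2 first.
- exact: cvg_cst.
- rewrite -[X in _ --> X](mulr0 (2 / t)); apply: cvgM; first exact: cvg_cst.
  by apply: cvg_harmonic.
- near=> n.
  rewrite expR_ge0/= /gauss -(real_normK (num_real (y n))) yn expRN -invf_div.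
  rewrite lef_pV2 ?posrE ?expR_gt0//; last first.
    by rewrite divr_gt0// divr_gt0.
  rewrite invf_div mulrA.
  apply: le_trans (expR_ge1Dx _).
  have n1 : 1 <= n%:R :> R by rewrite ler1n; near: n; exists 1%N.
  have n0 : 0 <= (n%:R - 1) * t :> R by rewrite mulr_ge0 ?subr_ge0// ltW.
  rewrite -natr1; set m : R := n%:R in n1 n0 *.
  nra.
Unshelve. all: by end_near. Qed.

(** The phase [th] is carried along for the induction on the dimension, where it collects the
    contribution of the other coordinates. *)
Let F t th z : R := \int[mu]_x (gauss t x * cos (z * x + th)).

Let measurable_affine (f : R -> R) z th : measurable_fun setT f ->
  measurable_fun setT (fun x => f (z * x + th)).
Proof.
move=> mf; apply: (measurableT_comp mf).
by apply: measurable_funD => //; exact: measurable_funM.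
Qed.

Let measurable_cos : measurable_fun setT (@cos R).
Proof. by apply: continuous_measurable_fun; exact: continuous_cos. Qed.

Let measurable_sin : measurable_fun setT (@sin R).
Proof. by apply: continuous_measurable_fun; exact: continuous_sin. Qed.

Let ler1_cos (x : R) : `|cos x| <= 1.
Proof. by rewrite ler_norml cos_geN1 cos_le1. Qed.

Let ler1_sin (x : R) : `|sin x| <= 1.
Proof. by rewrite ler_norml sin_geN1 sin_le1. Qed.

Lemma continuous_gauss t : continuous (gauss t).
Proof.
move=> x; have d := is_derive_gauss t x.
by apply/differentiable_continuous/derivable1_diffP; apply: ex_derive.
Qed.

(** The derivative of [gauss t x * sin (z * x + th)] integrates to zero over the line, which trades
    the factor [x] for [z / (2 t)]. *)
Lemma Rintegral_gauss_sin t z th : 0 < t ->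
  \int[mu]_x (x * gauss t x * sin (z * x + th)) = z / (2 * t) * F t th z.
Proof.
move=> t0.
have i1 : mu.-integrable setT (EFin \o (fun x => gauss t x * cos (z * x + th))).
  by apply: integrable_gaussM => //; exact: measurable_affine.
have i2 : mu.-integrable setT
    (EFin \o (fun x => x * gauss t x * sin (z * x + th))).
  by apply: integrable_mul_gaussM => //; exact: measurable_affine.
have i1' : mu.-integrable setT
    (EFin \o (fun x => z * (gauss t x * cos (z * x + th)))) 
  by exact: (integrableZl measurableT z i1).
have i2' : mu.-integrable setT
    (EFin \o (fun x => 2 * t * (x * gauss t x * sin (z * x + th)))).
  exact: (integrableZl measurableT (2 * t) i2).
have gs (y : nat -> R) : (forall n, `|y n| = n%:R) ->
    gauss t (y n) * sin (z * y n + th) @[n --> \oo] --> 0.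
  move=> yn; apply: norm_cvg0.
  apply: (@squeeze_cvgr _ _ _ _ (cst 0) (fun n => gauss t (y n))).
  - near=> n; rewrite /= normr_ge0/= normrM (ger0_norm (expR_ge0 _)).
    by rewrite ler_piMr ?expR_ge0.
  - exact: cvg_cst.
  - exact: cvg_gauss.
have := @Rintegral_derive_eq0 _ _ (is_derive_gauss_sin t z th).
rewrite RintegralB// RintegralZl// RintegralZl// -/(F t th z) => H.
have {}H : z * F t th z =
    2 * t * \int[mu]_x (x * gauss t x * sin (z * x + th)).
  apply/eqP; rewrite -subr_eq0; apply/eqP; apply: H.
  - have ca : continuous (fun x : R => z * x + th).
      by move=> x; apply: cvgD; [apply: cvgM; [exact: cvg_cst|exact: cvg_id]|exact: cvg_cst].
    move=> x; apply: cvgB; apply: cvgM; try exact: cvg_cst.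
    + apply: cvgM; first exact: continuous_gauss.
      by apply: (cvg_comp _ cos (ca x)); exact: continuous_cos.
    + apply: cvgM; first by apply: cvgM; [exact: cvg_id|exact: continuous_gauss].
      by apply: (cvg_comp _ sin (ca x)); exact: continuous_sin.
  - exact: (integrableB measurableT i1' i2').
  - by apply: gs => n; rewrite normr_nat.
  - by apply: gs => n; rewrite normrN normr_nat.
by rewrite mulrAC H; field; apply: lt0r_neq0.
Unshelve. all: by end_near. Qed.

(** Differentiation under the integral sign, then [Rintegral_gauss_sin], gives a linear differential
    equation in the frequency. The majorant of [norm_mul_gauss_le] is uniform in [z]; the interval
    []z - 1, z + 1[] only localizes. *)
Lemma is_derive_gauss_fourier t z th : 0 < t ->
  is_derive z 1 (F t th) (- (z / (2 * t) * F t th z)).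
Proof.
move=> t0.
have int1 (y : R) :
    mu.-integrable setT (EFin \o (fun x => gauss t x * cos (y * x + th))).
  by apply: integrable_gaussM => //; exact: measurable_affine.
have p1 (y x : R) : partial1of2 (fun y x => gauss t x * cos (y * x + th)) y x =
    - (x * gauss t x * sin (y * x + th)).
  rewrite /partial1of2 derive1E; apply: derive_val.
  exact: is_derive_gauss_cos.
have zI : z \in `]z - 1, z + 1[ by rewrite in_itv/= ltrBlDr ltrDl ltr01.
have t20 : 0 < t / 2 by rewrite divr_gt0.
have c0 : 0 <= t^-1 + 1 by rewrite addr_ge0 ?invr_ge0// ltW.
have G0 (y : R) : 0 <= (t^-1 + 1) * gauss (t / 2) y.
  by rewrite mulr_ge0 ?expR_ge0.
have iG : mu.-integrable setT (EFin \o (fun x => (t^-1 + 1) * gauss (t / 2) x)).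
  exact: (integrableZl measurableT _ (integrable_gauss t20)).
have ub (y x : R) : y \in `]z - 1, z + 1[ -> [set: R] x ->
    `|partial1of2 (fun y x => gauss t x * cos (y * x + th)) y x| <=
    (t^-1 + 1) * gauss (t / 2) x.
  move=> _ _; rewrite p1 normrN normrM normrM (ger0_norm (expR_ge0 _)).
  apply: le_trans (norm_mul_gauss_le x t0).
  by rewrite -[leRHS]mulr1 ler_wpM2l// mulr_ge0 ?expR_ge0.
have der (y x : R) : y \in `]z - 1, z + 1[ -> [set: R] x ->
    derivable (fun y : R => gauss t x * cos (y * x + th)) y 1.
  by move=> _ _; have d := is_derive_gauss_cos t th x y; apply: ex_derive.
have D := @derivable_under_integral R _ _ mu _ _ measurableT z _ _ zI
   (fun y _ => int1 y) der _ G0 iG ub.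
have V := @differentiation_under_integral R _ _ mu _ _ measurableT z _ _ zI
   (fun y _ => int1 y) der _ G0 iG ub.
apply: DeriveDef; first exact: D.
rewrite -derive1E V -Rintegral_gauss_sin//.
under eq_Rintegral do rewrite p1 -mulN1r.
rewrite RintegralZl ?mulN1r//.
by apply: integrable_mul_gaussM => //; exact: measurable_affine.
Qed.

Lemma Rintegral_gauss_cos t z th : 0 < t ->
  \int[mu]_x (gauss t x * cos (z * x + th)) =
  cos th * (Num.sqrt (pi / t) * expR (- (z ^+ 2 / (4 * t)))).
Proof.
move=> t0; rewrite -/(F t th z).
(* Integrating factor of the equation [F' = - z / (2 t) F]: the product is constant, hence equal to
   its value at [0]. *)
have d0 (y : R) : is_derive y 1 (fun y => F t th y * expR (y ^+ 2 / (4 * t))) 0.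
  have dF := is_derive_gauss_fourier y th t0.
  apply: is_derive_eq; rewrite /GRing.scale/=; field; exact: lt0r_neq0.
have := is_derive_0_is_cst z 0 d0.
rewrite expr0n/= mul0r expR0 mulr1 => H.
have -> : F t th z = F t th 0 * expR (- (z ^+ 2 / (4 * t))).
  by rewrite -H expRN mulfK// gt_eqF// expR_gt0.
rewrite mulrA; congr (_ * _).
rewrite /F; under eq_Rintegral do rewrite mul0r add0r mulrC.
rewrite RintegralZl//; last exact: integrable_gauss.
by rewrite /Rintegral integral_gauss.
Qed.

End gauss1.

(** * Weights on the half-line *)

Section line.
Variable R : realType.
Notation mu := (@lebesgue_measure R).

(** The image of [a] times Lebesgue measure under [x |-> a x] has the right value on half-open
    intervals, and these values determine the measure. *)
Lemma ge0_integral_lebesgue_scale (a : R) (f : R -> \bar R) : 0 < a ->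
  measurable_fun setT f -> (forall x, 0 <= f x)%E ->
  (\int[mu]_x f (a * x)%R = (a^-1)%:E * \int[mu]_x f x)%E.
Proof.
move=> a0 mf f0.
pose h (x : measurableTypeR R) : measurableTypeR R := a * x.
have mh : measurable_fun setT h by apply: measurable_funM.
pose m := mscale (NngNum (ltW a0)) mu.
have mE A : measurable A -> pushforward m h A = mu A.
  move=> mA; apply/esym/lebesgue_measure_unique => //= _ [[b c]] _ <-.
  rewrite /m /pushforward/= /mscale/=.
  have -> : h @^-1` `]b, c]%classic = `](b / a), (c / a)]%classic.
    apply/seteqP; split => x /=; rewrite !in_itv/= /h.
      by rewrite ltr_pdivrMr// ler_pdivlMr// (mulrC x).
    by rewrite ltr_pdivrMr// ler_pdivlMr// (mulrC x).
  rewrite !lebesgue_measure_itv/= !lte_fin ltr_pM2r ?invr_gt0//.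
  case: ifPn => bc; last by rewrite mule0.
  rewrite -!EFinB -EFinM; congr EFin; field; exact: lt0r_neq0.
transitivity ((a^-1)%:E * \int[pushforward m h]_x f x)%E; last first.
  by congr (_ * _)%E; apply: eq_measure_integral => A mA _; exact: mE.
rewrite ge0_integral_pushforward// preimage_setT ge0_integral_mscale//.
- by rewrite muleA -EFinM/= mulVf ?gt_eqF// mul1e.
- exact: measurableT_comp.
- by move=> x _; exact: f0.
Qed.

Lemma exp_dominates_powR (p : R) : 0 <= p ->
  exists C : R, 0 <= C /\ forall x : R, 0 < x -> x `^ p * expR (- x) <= C.
Proof.
move=> p0; pose m := (Num.truncn p).+1.
exists (1 + m`!%:R); split; first by rewrite addr_ge0.
move=> x x0.
have xp : x `^ p <= 1 + x ^+ m.
  have xm : 0 <= x ^+ m by rewrite exprn_ge0 ?ltW.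
  have [x1|x1] := leP x 1.
    rewrite (@le_trans _ _ 1)// ?lerDl// -(powRr0 x).
    by apply: ger_powR; rewrite ?x0.
  rewrite (@le_trans _ _ (x ^+ m))// ?lerDr//.
  rewrite -powR_mulrn ?(ltW x0)//; apply: ler_powR; first exact: ltW.
  by apply: ltW; rewrite /m truncnS_gt.
rewrite expRN ler_pdivrMr ?expR_gt0//; apply: (le_trans xp).
have e1 : 1 <= expR x by rewrite -expR0 ler_expR ltW.
have := expR_ge1Dxn (Num.truncn p) (ltW x0); rewrite -/m => e2.
rewrite mulrDl mul1r lerD//.
rewrite -ler_pdivrMl ?ltr0n ?fact_gt0// mulrC (le_trans _ e2)//.
by rewrite lerDr.
Qed.

Lemma powR_integral_itv01 (e : R) : -1 < e ->
  (\int[mu]_(x in `]0%R, 1%R]) (x `^ e)%:E < +oo)%E.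
Proof.
move=> e1; have e0 : 0 < e + 1 by rewrite -ltrBlDr sub0r.
(* Starting from [1 / 2] keeps every interval nondegenerate, as the fundamental theorem requires;
   the bound it yields does not depend on [n]. *)
pose F n : set R := `[n.+2%:R^-1, 1]%classic.
have UF : \bigcup_n F n = `]0, 1]%classic.
  apply/seteqP; split => [x [n _]|x]; rewrite /F/= !in_itv/=.
    by move=> /andP[h ->]; rewrite (lt_le_trans _ h)// invr_gt0.
  move=> /andP[x0 x1]; exists (Num.truncn x^-1) => //=.
  rewrite in_itv/= x1 andbT -[leRHS]invrK lef_pV2 ?posrE ?invr_gt0//.
  apply: ltW; apply: (lt_le_trans (truncnS_gt _)).
  by rewrite ler_nat.
have mpow D : measurable_fun D (fun x : R => (x `^ e)%:E).
  by apply/measurable_funTS/measurable_EFinP; exact: measurable_powR.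
have cv : (\int[mu]_(x in F n) (x `^ e)%:E @[n --> \oo] -->
    \int[mu]_(x in `]0%R, 1%R]) (x `^ e)%:E)%E.
  rewrite -UF; apply: ge0_nondecreasing_set_cvg_integral => //.
  - apply/nondecreasing_seqP => n; apply/subsetPset => x; rewrite /F/= !in_itv/=.
    move=> /andP[h ->]; rewrite andbT (le_trans _ h)// lef_pV2 ?posrE//.
    by rewrite ler_nat.
  - by move=> n; exact: measurable_itv.
  - by move=> n; exact: mpow.
  - by move=> n x _; rewrite lee_fin powR_ge0.
have le n : (\int[mu]_(x in F n) (x `^ e)%:E <= ((e + 1)^-1)%:E)%E.
  have cp (x : R) : 0 < x -> {for x, continuous (fun y : R => y `^ e)}.
    move=> x0; apply/differentiable_continuous/derivable1_diffP.
    by apply: ex_derive; exact: is_derive1_powR.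
  have dp (x : R) : 0 < x ->
      is_derive x 1 (fun x : R => (e + 1)^-1 * x `^ (e + 1)) (x `^ e).
    move=> x0; have d := is_derive1_powR (e + 1) x0.
    apply: is_derive_eq; rewrite /GRing.scale/= addrK.
    by field; exact: lt0r_neq0.
  have cp' (x : R) : 0 < x -> {for x, continuous (fun x : R => (e + 1)^-1 * x `^ (e + 1))}.
    move=> x0; apply/differentiable_continuous/derivable1_diffP.
    by apply: ex_derive; exact: dp.
  rewrite (@continuous_FTC2 _ _ (fun x : R => (e + 1)^-1 * x `^ (e + 1)))//.
  - rewrite -EFinB lee_fin powR1 mulr1 gerBl// mulr_ge0 ?powR_ge0//.
    by rewrite invr_ge0 ltW.
  - by rewrite invf_lt1// ltr1n.
  - apply: continuous_in_subspaceT => x; rewrite inE/= in_itv/= => /andP[h _].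
    by apply: cp; rewrite (lt_le_trans _ h)// invr_gt0.
  - split.
    + move=> x; rewrite in_itv/= => /andP[h _].
      apply: ex_derive; apply: dp.
      by rewrite (lt_trans _ h)// invr_gt0.
    + by apply: cvg_at_right_filter; apply: cp'; rewrite invr_gt0.
    + by apply: cvg_at_left_filter; apply: cp'.
  - move=> x; rewrite in_itv/= => /andP[h _].
    rewrite derive1E; have d := dp x (lt_trans _ h).
    by apply: derive_val; apply: dp; rewrite (lt_trans _ h)// invr_gt0.
apply: (@le_lt_trans _ _ ((e + 1)^-1)%:E); last exact: ltry.
rewrite -(cvg_lim _ cv)//; apply: lime_le; last exact: nearW.
by apply/cvg_ex; eexists; exact: cv.
Qed.

Lemma powR_integral_itv1y (e : R) : e < -1 ->
  (\int[mu]_(x in `[1%R, +oo[) (x `^ e)%:E < +oo)%E.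
Proof.
move=> e1; have e0 : e + 1 < 0 by rewrite -ltrBrDr sub0r.
have dp (x : R) : 0 < x ->
    is_derive x 1 (fun x : R => (e + 1)^-1 * x `^ (e + 1)) (x `^ e).
  move=> x0; have d := is_derive1_powR (e + 1) x0.
  apply: is_derive_eq; rewrite /GRing.scale/= addrK.
  by field; exact: ltr0_neq0.
have cp (x : R) : 0 < x -> {for x, continuous (fun y : R => y `^ e)}.
  move=> x0; apply/differentiable_continuous/derivable1_diffP.
  by apply: ex_derive; exact: is_derive1_powR.
rewrite (@ge0_continuous_FTC2y _ _ (fun x : R => (e + 1)^-1 * x `^ (e + 1)) _ 0)//.
- by rewrite -EFinB ltry.
- by move=> x _; exact: powR_ge0.
- apply: continuous_in_subspaceT => x; rewrite inE/= in_itv/= andbT => h.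
  by apply: cp; rewrite (lt_le_trans _ h).
- rewrite -[X in _ --> X](mulr0 (e + 1)^-1); apply: cvgM; first exact: cvg_cst.
  have -> : (fun x : R => x `^ (e + 1)) = (fun x => (x `^ (- (e + 1)))^-1).
    by apply/funext => x; rewrite powRN invrK.
  apply/gtr0_cvgV0; first by near=> x; rewrite powR_gt0.
  apply/cvgryPge => A; near=> x.
  have p0 : 0 < - (e + 1) by rewrite oppr_gt0.
  have A0 : 0 <= Num.max A 0 by rewrite le_max lexx orbT.
  rewrite (@le_trans _ _ (Num.max A 0))// ?le_max ?lexx//.
  have E : Num.max A 0 = (Num.max A 0 `^ (- (e + 1))^-1) `^ (- (e + 1)).
    by rewrite -powRrM mulVf ?gt_eqF// powRr1.
  rewrite [leLHS]E.
  apply: ge0_ler_powR; rewrite ?nnegrE ?powR_ge0 ?(ltW p0)//.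
- move=> x x1; apply: ex_derive; apply: dp; exact: lt_trans x1.
- have c : {for (1 : R), continuous (fun x : R => (e + 1)^-1 * x `^ (e + 1))}.
    apply/differentiable_continuous/derivable1_diffP.
    by apply: ex_derive; exact: dp.
  exact: cvg_at_right_filter c.
- move=> x; rewrite in_itv/= andbT => x1.
  by rewrite derive1E; apply: derive_val; apply: dp; exact: lt_trans x1.
Unshelve. all: by end_near. Qed.


Implicit Types (s t a : R).

(* The weight [t^(-1-s) dt] on the half-line; the indicator is needed because
   the library sets [t `^ e = 1] for [t < 0]. *)
Definition tw (s t : R) : R := \1_`]0%R, +oo[ t * t `^ (- (1 + s)).

Lemma tw_ge0 s t : 0 <= tw s t.
Proof. by rewrite mulr_ge0 ?powR_ge0. Qed.

Lemma tw_gt0E s t : 0 < t -> tw s t = t `^ (- (1 + s)).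
Proof. by move=> t0; rewrite /tw indicE mem_set ?mul1r//= in_itv/= t0. Qed.

Lemma tw_le0E s t : t <= 0 -> tw s t = 0.
Proof.
by move=> t0; rewrite /tw indicE memNset ?mul0r//= in_itv/= andbT; apply/negP; rewrite -leNgt.
Qed.

Lemma measurable_tw s : measurable_fun setT (tw s).
Proof. by apply: measurable_funM => //; exact: measurable_powR. Qed.

Lemma tw_scale s a t : 0 < a -> tw s t = a `^ (1 + s) * tw s (a * t).
Proof.
move=> a0; have [t0|t0] := ltP 0 t.
  rewrite !tw_gt0E ?mulr_gt0// powRM ?(ltW a0) ?(ltW t0)// mulrA -powRD.
    by rewrite subrr powRr0 mul1r.
  by rewrite (gt_eqF a0) implybT.
by rewrite !tw_le0E ?mulr0// pmulr_rle0.
Qed.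

(** Homogeneity of the weight, the source of every power [2 * s] below: [a = |xi|^2] gives the
    symbol, [a = |z|^-2] the singular kernel, and [a = c^2] the behaviour of the energy under
    dilations. *)
Lemma integral_tw_scale s a (g : R -> \bar R) : 0 < a ->
  measurable_fun setT g -> (forall t, 0 <= g t)%E ->
  (\int[mu]_t ((tw s t)%:E * g (a * t)%R) =
   (a `^ s)%:E * \int[mu]_t ((tw s t)%:E * g t))%E.
Proof.
move=> a0 mg g0.
have mf : measurable_fun setT (fun t => (tw s t)%:E * g t)%E.
  by apply: emeasurable_funM => //; apply/measurable_EFinP; exact: measurable_tw.
have f0 t : (0 <= (tw s t)%:E * g t)%E by rewrite mule_ge0// lee_fin tw_ge0.
under eq_integral do rewrite (tw_scale s _ a0) EFinM -muleA.
have mfa : measurable_fun setT (fun t => (tw s (a * t))%:E * g (a * t)%R)%E.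
  by apply: (measurableT_comp mf); exact: measurable_funM.
rewrite (ge0_integralZl_EFin mu measurableT (fun x _ => f0 (a * x)) mfa (powR_ge0 _ _)).
rewrite (ge0_integral_lebesgue_scale a0 mf)// muleA -EFinM.
by rewrite powRD ?(gt_eqF a0) ?implybT// powRr1 ?ltW// mulrAC mulfV ?gt_eqF// mul1r.
Qed.

(** Comparison with [t^(p-s-1)] near [0] and with [t^(q-s-1)] at infinity, both integrable because
    [q < s < p]. *)
Lemma integral_tw_lty s (g : R -> R) C p q : s < p -> q < s ->
  measurable_fun setT g -> (forall t, 0 < t -> 0 <= g t) ->
  (forall t, 0 < t <= 1 -> g t <= C * t `^ p) ->
  (forall t, 1 <= t -> g t <= C * t `^ q) ->
  (\int[mu]_t (tw s t * g t)%:E < +oo)%E.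
Proof.
move=> sp qs mg g0 gp gq.
have mpow e D : measurable_fun D (fun x : R => (x `^ e)%:E).
  by apply/measurable_funTS/measurable_EFinP; exact: measurable_powR.
have C0 : 0 <= C.
  have := gp 1; rewrite powR1 mulr1 lexx ltr01 => /(_ isT).
  exact: le_trans (g0 _ ltr01).
pose F0 (x : R) := (\1_`]0%R, 1%R] x * (C * x `^ (p - s - 1)))%:E.
pose F1 (x : R) := (\1_`[1%R, +oo[ x * (C * x `^ (q - s - 1)))%:E.
have Ffin (D : set R) (e : R) : measurable D ->
    (\int[mu]_(x in D) (x `^ e)%:E < +oo ->
     \int[mu]_x (\1_D x * (C * x `^ e))%:E < +oo)%E.
  move=> mD h.
  have -> : (\int[mu]_x (\1_D x * (C * x `^ e))%:E =
      \int[mu]_(x in D) (C%:E * (x `^ e)%:E))%E.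
    rewrite [RHS]integral_mkcond; apply: eq_integral => x _.
    by rewrite patchE indicE; case: ifPn; rewrite ?mul1r ?mul0r ?EFinM.
  rewrite ge0_integralZl_EFin//; first exact: lte_mul_pinfty.
    by move=> x _; rewrite lee_fin powR_ge0.
  exact: mpow.
have mF (D : set R) (e : R) : measurable D ->
    measurable_fun setT (fun x : R => (\1_D x * (C * x `^ e))%:E).
  move=> mD; apply/measurable_EFinP; apply: measurable_funM => //.
  by apply: measurable_funM => //; exact: measurable_powR.
have F00 x : (0 <= F0 x)%E by rewrite lee_fin !mulr_ge0 ?powR_ge0.
have F10 x : (0 <= F1 x)%E by rewrite lee_fin !mulr_ge0 ?powR_ge0.
apply: (@le_lt_trans _ _ (\int[mu]_x (F0 x + F1 x))%E).
  apply: ge0_le_integral => //.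
  - move=> t _; have [t0|t0] := ltP 0 t; last by rewrite tw_le0E ?mul0r.
    by rewrite lee_fin mulr_ge0 ?tw_ge0 ?g0.
  - by apply/measurable_EFinP; apply: measurable_funM => //; exact: measurable_tw.
  - by apply: emeasurable_funD; exact: mF.
  - move=> t _; have [t0|t0] := ltP 0 t; last first.
      by rewrite tw_le0E// mul0r adde_ge0.
    rewrite tw_gt0E//.
    have pw e : t `^ (- (1 + s)) * (C * t `^ e) = C * t `^ (e - s - 1).
      rewrite mulrCA -powRD ?(gt_eqF t0) ?implybT//; congr (_ * _ `^ _); ring.
    have [t1|t1] := leP t 1.
      rewrite -[leLHS]adde0 leeD//.
      rewrite /F0 indicE mem_set ?mul1r/= ?in_itv/= ?t0 ?t1// lee_fin -pw.
      by rewrite ler_wpM2l ?powR_ge0// gp ?t0 ?t1.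
    rewrite -[leLHS]add0e leeD//.
    rewrite /F1 indicE mem_set ?mul1r/= ?in_itv/= ?(ltW t1)// lee_fin -pw.
    by rewrite ler_wpM2l ?powR_ge0// gq ?(ltW t1).
rewrite ge0_integralD//; [|exact: mF|exact: mF].
apply: lte_add_pinfty; apply: Ffin => //.
  by apply: powR_integral_itv01; lra.
by apply: powR_integral_itv1y; lra.
Qed.

(** If the integral vanished, the integrand would vanish almost everywhere, whereas it is positive
    on a half-line of infinite measure. *)
Lemma integral_tw_gt0 s (g : R -> R) : measurable_fun setT g ->
  (forall t, 0 < t -> 0 < g t) -> (0 < \int[mu]_t (tw s t * g t)%:E)%E.
Proof.
move=> mg g0.
have h0 t : 0 <= tw s t * g t.
  have [t0|t0] := ltP 0 t; last by rewrite tw_le0E ?mul0r.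
  by rewrite mulr_ge0 ?tw_ge0 ?(ltW (g0 _ t0)).
have mh : measurable_fun setT (fun t => (tw s t * g t)%:E).
  by apply/measurable_EFinP; apply: measurable_funM => //; exact: measurable_tw.
rewrite lt0e integral_ge0 ?andbT; last by move=> t _; rewrite lee_fin.
apply/negP => /eqP I0.
have [H _] := ae_eq_integral_abs mu measurableT mh.
have [|N [mN N0 sN]] := H.
  by under eq_integral do rewrite gee0_abs ?lee_fin//.
have : (mu `]0%R, +oo[ <= mu N)%E.
  apply: le_measure; rewrite ?inE//.
  move=> t /=; rewrite in_itv/= andbT => t0; apply: sN => /= /(_ I).
  move=> [] /eqP; rewrite mulf_eq0 !gt_eqF ?g0// tw_gt0E//.
  exact: powR_gt0.
by rewrite N0 lebesgue_measure_itv/= ltry.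
Qed.


(** With the negative parameter [- a], [tw] is the weight [t^(a-1)] of the Gamma integral, so the
    criteria for [tw] apply. Finiteness is part of the matter, since [fine] sends an infinite
    integral to [0]. *)
Lemma Gamma_gt0 a : 0 < a -> 0 < Gamma a.
Proof.
move=> a0.
have mE : measurable_fun setT (fun x : R => expR (- x)) by exact: measurableT_comp.
have -> : Gamma a = fine (\int[mu]_x (tw (- a) x * expR (- x))%:E).
  rewrite /Gamma /Rintegral integral_mkcond; congr fine; apply: eq_integral => x _.
  rewrite patchE /tw indicE; case: ifPn => _; last by rewrite !mul0r.
  by rewrite mul1r opprB.
rewrite fine_gt0// integral_tw_gt0//=; last by move=> t _; exact: expR_gt0.
have [C [C0 HC]] := @exp_dominates_powR (a + 1) (addr_ge0 (ltW a0) ler01).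
apply: (@integral_tw_lty _ _ (1 + C) 0 (- (a + 1))) => //.
- by rewrite oppr_lt0.
- by rewrite opprD gtrDl oppr_lt0.
- move=> t /andP[t0 _]; rewrite powRr0 mulr1 (@le_trans _ _ 1)// ?lerDl//.
  by rewrite expR_le1 oppr_le0 ltW.
- move=> t t1; have t0 : 0 < t by exact: lt_le_trans t1.
  rewrite powRN ler_pdivlMr ?powR_gt0// mulrC (le_trans (HC _ t0))//.
  by rewrite lerDr.
Qed.

Lemma frac_const_gt0 d s : 0 < s < 1 -> 0 < frac_const d s.
Proof.
move=> /andP[s0 s1]; rewrite /frac_const.
apply: mulr_gt0; first apply: divr_gt0.
- by rewrite mulr_gt0// powR_gt0.
- by rewrite Gamma_gt0// subr_gt0.
- rewrite divr_gt0 ?powR_gt0 ?pi_gt0// Gamma_gt0// divr_gt0//.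
  by rewrite ltr_wpDl// mulr_gt0.
Qed.

End line.

(** * Lebesgue measure on row vectors *)

Section rV.
Variable R : realType.
Notation mu := (@lebesgue_measure R).
Notation leb := (leb R).

Section measurability.
Context dT (T : measurableType dT).
Implicit Types f g : forall d, T -> 'rV[R]_d.

Lemma measurable_fun_coord d (f : T -> 'rV[R]_d) i :
  measurable_fun setT f -> measurable_fun setT (fun x => f x ord0 i : R).
Proof. by move=> mf; apply: (measurableT_comp (@measurable_coord R d i) mf). Qed.

Lemma measurable_rVB d (f g : T -> 'rV[R]_d) : measurable_fun setT f ->
  measurable_fun setT g -> measurable_fun setT (fun x => f x - g x).
Proof.
move=> mf mg; apply: measurable_fun_rV => i; under eq_fun do rewrite !mxE.
by apply: measurable_funB; exact: measurable_fun_coord.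
Qed.

Lemma measurable_rVZ d (c : T -> R) (f : T -> 'rV[R]_d) : measurable_fun setT c ->
  measurable_fun setT f -> measurable_fun setT (fun x => c x *: f x).
Proof.
move=> mc mf; apply: measurable_fun_rV => i; under eq_fun do rewrite mxE.
by apply: measurable_funM => //; exact: measurable_fun_coord.
Qed.

Lemma measurable_row_mx n k (f : T -> 'rV[R]_n) (g : T -> 'rV[R]_k) :
  measurable_fun setT f -> measurable_fun setT g ->
  measurable_fun setT (fun x => row_mx (f x) (g x)).
Proof.
move=> mf mg; apply: measurable_fun_rV => i.
have [j ->|j ->] := split_ordP i.
  by under eq_fun do rewrite row_mxEl; exact: measurable_fun_coord.
by under eq_fun do rewrite row_mxEr; exact: measurable_fun_coord.
Qed.

Lemma measurable_lsubmx n k (f : T -> 'rV[R]_(n + k)) :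
  measurable_fun setT f -> measurable_fun setT (fun x => lsubmx (f x)).
Proof.
move=> mf; apply: measurable_fun_rV => i; under eq_fun do rewrite mxE.
exact: measurable_fun_coord.
Qed.

Lemma measurable_rsubmx n k (f : T -> 'rV[R]_(n + k)) :
  measurable_fun setT f -> measurable_fun setT (fun x => rsubmx (f x)).
Proof.
move=> mf; apply: measurable_fun_rV => i; under eq_fun do rewrite mxE.
exact: measurable_fun_coord.
Qed.

Lemma measurable_dotv d (f g : T -> 'rV[R]_d) : measurable_fun setT f ->
  measurable_fun setT g -> measurable_fun setT (fun x => dotv (f x) (g x)).
Proof.
move=> mf mg; apply: measurable_sum => i.
by apply: measurable_funM; exact: measurable_fun_coord.
Qed.

Lemma measurable_enorm d (f : T -> 'rV[R]_d) : measurable_fun setT f ->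
  measurable_fun setT (fun x => enorm (f x)).
Proof.
move=> mf.
have mS : measurable_fun setT (@Num.sqrt R).
  by apply: continuous_measurable_fun; exact: sqrt_continuous.
by apply: (measurableT_comp mS); exact: measurable_dotv.
Qed.

End measurability.

Lemma ge0_integral_leb0 (F : 'rV[R]_0 -> \bar R) :
  measurable_fun setT F -> (forall x, 0 <= F x)%E ->
  (\int[leb 0]_x F x = F 0%R)%E.
Proof. by move=> mF F0; rewrite /= integral_dirac// diracT mul1e. Qed.

Lemma ge0_integral_lebS d (F : 'rV[R]_d.+1 -> \bar R) :
  measurable_fun setT F -> (forall x, 0 <= F x)%E ->
  (\int[leb d.+1]_x F x = \int[mu]_a \int[leb d]_x F (rV_cons (a, x)))%E.
Proof.
move=> mF F0.
have mc := @measurable_rV_cons R d.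
transitivity (\int[pushforward (mu \x leb d)%E (@rV_cons R d)]_x F x)%E.
  by apply: eq_measure_integral.
rewrite ge0_integral_pushforward// preimage_setT fubini_tonelli1//.
  exact: measurableT_comp.
by move=> x; exact: F0.
Qed.


(** Both sides have the same type because [n.+1 + k] and [(n + k).+1] are convertible; only the
    injections of ordinals have to be matched. *)
Lemma row_mx_consl n k (a : R) (x : 'rV[R]_n) (t : 'rV[R]_k) :
  (row_mx (rV_cons (a, x)) t : 'rV_(n.+1 + k)) = rV_cons (a, row_mx x t).
Proof.
apply/rowP => i; rewrite /rV_cons /=.
have [j ->|j ->] := @split_ordP n.+1 k i.
  rewrite (@row_mxEl _ 1 n.+1 k).
  have [m ->|m ->] := @split_ordP 1 n j.
    have -> : @lshift n.+1 k (@lshift 1 n m) = @lshift 1 (n + k) m by exact: val_inj.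
    by rewrite !(@row_mxEl _ 1 1).
  have -> : @lshift n.+1 k (@rshift 1 n m) = @rshift 1 (n + k) (lshift k m).
    exact: val_inj.
  by rewrite !(@row_mxEr _ 1 1) row_mxEl.
rewrite (@row_mxEr _ 1 n.+1 k).
have -> : @rshift n.+1 k j = @rshift 1 (n + k) (rshift n j) by exact: val_inj.
by rewrite (@row_mxEr _ 1 1) row_mxEr.
Qed.

Lemma measurable_leb_integral2 dT (T : measurableType dT) d (F : T -> 'rV[R]_d -> \bar R) :
  measurable_fun setT (fun p : T * 'rV[R]_d => F p.1 p.2) ->
  (forall x y, 0 <= F x y)%E ->
  measurable_fun setT (fun x => \int[leb d]_y F x y)%E.
Proof.
move=> mF F0.
by apply: (@measurable_fun_fubini_tonelli_F _ _ _ _ _ (leb d)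
  (fun p => F p.1 p.2)) => // -[].
Qed.

(** [leb] is built one coordinate at a time, so the product structure over [n + k] is obtained by
    induction on [n], peeling off the first coordinate. *)
Lemma ge0_integral_leb_row n k (F : 'rV[R]_(n + k) -> \bar R) :
  measurable_fun setT F -> (forall x, 0 <= F x)%E ->
  (\int[leb (n + k)]_z F z = \int[leb n]_x \int[leb k]_t F (row_mx x t))%E.
Proof.
elim: n F => [|n IH] F mF F0.
  rewrite ge0_integral_leb0; last 2 first.
  - apply: measurable_leb_integral2 => //; apply: (measurableT_comp mF).
    exact: measurable_row_mx.
  - by move=> x; exact: integral_ge0.
  apply: eq_integral => x _; congr F; apply/rowP => i.
  have [[]//|j ->] := @split_ordP 0 k i.
  by rewrite row_mxEr; congr (x _ _); apply: val_inj.
have mc := @measurable_rV_cons R.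
rewrite (@ge0_integral_lebS (n + k) F mF F0).
rewrite [RHS]ge0_integral_lebS; last 2 first.
- apply: measurable_leb_integral2 => //; apply: (measurableT_comp mF).
  exact: measurable_row_mx.
- by move=> x; exact: integral_ge0.
apply: eq_integral => a _.
have mFa : measurable_fun setT (fun z => F (rV_cons (a, z))).
  by apply: (measurableT_comp mF); apply: (measurableT_comp (mc _)).
rewrite (IH _ mFa (fun z => F0 _)).
apply: eq_integral => x _; apply: eq_integral => t _.
by rewrite -row_mx_consl.
Qed.

Lemma rV_consZ d c (a : R) (x : 'rV[R]_d) :
  c *: rV_cons (a, x) = rV_cons (c * a, c *: x).
Proof.
apply/rowP => i; rewrite !mxE /rV_cons/=.
by case: fintype.split => j; rewrite !mxE ?mulrnAr.
Qed.

Lemma ge0_integral_leb_scale d (c : R) (F : 'rV[R]_d -> \bar R) : 0 < c ->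
  measurable_fun setT F -> (forall x, 0 <= F x)%E ->
  (\int[leb d]_x F (c *: x) = ((c^-1) ^+ d)%:E * \int[leb d]_x F x)%E.
Proof.
move=> c0; elim: d F => [|d IH] F mF F0.
  by rewrite !ge0_integral_leb0// ?scaler0 ?mul1e//; apply: (measurableT_comp mF);
    exact: measurable_rVZ.
have mc := @measurable_rV_cons R d.
have mFc : measurable_fun setT (fun p : measurableTypeR R * 'rV[R]_d => F (rV_cons p)).
  exact: measurableT_comp.
rewrite ge0_integral_lebS//; last first.
  by apply: (measurableT_comp mF); exact: measurable_rVZ.
under eq_integral => a _.
  under eq_integral do rewrite rV_consZ.
  rewrite (IH (fun x => F (rV_cons (c * a, x))))//; last first.
    apply: (measurableT_comp mF); apply: (measurableT_comp mc).
    exact: measurable_fun_pair.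
  over.
have mG : measurable_fun setT (fun a => \int[leb d]_x F (rV_cons (a, x)))%E.
  exact: measurable_leb_integral2.
have G0 a : (0 <= \int[leb d]_x F (rV_cons (a, x)))%E by exact: integral_ge0.
have cd0 : 0 <= c^-1 ^+ d by rewrite exprn_ge0// invr_ge0 ltW.
rewrite (ge0_integralZl_EFin mu measurableT (fun a _ => G0 (c * a)) _ cd0); last first.
  by apply: (measurableT_comp mG); exact: measurable_funM.
rewrite (ge0_integral_lebesgue_scale c0 mG G0) ge0_integral_lebS//.
by rewrite muleA -EFinM exprSr.
Qed.


Definition box d (a b : R) : set 'rV[R]_d := [set x | forall i, x ord0 i \in `]a, b]].

Lemma measurable_box d a b : measurable (@box d a b).
Proof.
have -> : @box d a b = \bigcap_(i in [set: 'I_d])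
    ((fun x : 'rV[R]_d => x ord0 i : measurableTypeR R) @^-1` `]a, b]%classic).
  by apply/seteqP; split => x /= h i; [move=> _|]; exact: h.
apply: fin_bigcap_measurable => // i _; rewrite -[X in measurable X]setTI.
exact: measurable_coord.
Qed.

Lemma leb_box d (a b : R) : a <= b -> leb d (box a b) = ((b - a) ^+ d)%:E.
Proof.
move=> ab; elim: d => [|d IH].
  by rewrite /= diracE mem_set// => -[].
rewrite exprS EFinM -IH /= /leb_step /pushforward.
have -> : @rV_cons R d @^-1` box a b = `]a, b]%classic `*` box a b.
  apply/seteqP; split => [[p x] h|[p x] [/= pab h] i].
    split => [|i] /=; [have := h (@lshift 1 d ord0)|have := h (@rshift 1 d i)].
      by rewrite /rV_cons (@row_mxEl _ 1 1 d) mxE mulr1n.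
    by rewrite /rV_cons (@row_mxEr _ 1 1 d).
  rewrite /rV_cons/=; have [j ->|j ->] := @split_ordP 1 d i.
    by rewrite (@row_mxEl _ 1 1 d) mxE (ord1 j) mulr1n.
  by rewrite (@row_mxEr _ 1 1 d).
rewrite product_measure1E//; last exact: measurable_box.
congr (_ * _)%E; rewrite [LHS](@lebesgue_measure_itv R `]a, b])/= lte_fin.
by case: ltgtP ab => // ->; rewrite subrr.
Qed.

(** The sigma-algebra is generated by the coordinates, so a countable description is required: an
    open set is the union of the cubes of rational centre and half-width [1 / (m + 1)] that it
    contains. *)
Lemma open_measurable_rV d (A : set 'rV[R]_d) : open A -> measurable A.
Proof.
move=> oA.
pose Q := ('rV[rat]_d * nat)%type.
pose U (q : Q) : set 'rV[R]_d :=
  [set x | forall i, `|x ord0 i - ratr (q.1 ord0 i)| < q.2.+1%:R^-1].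
have mU q : measurable (U q).
  have -> : U q = \bigcap_(i in [set: 'I_d])
      ((fun x : 'rV[R]_d => x ord0 i : measurableTypeR R) @^-1`
       [set y | `|y - ratr (q.1 ord0 i)| < q.2.+1%:R^-1]).
    by apply/seteqP; split => x /= h i; [move=> _|]; exact: h.
  apply: fin_bigcap_measurable => // i _; rewrite -[X in measurable X]setTI.
  apply: measurable_coord => //.
  have -> : [set y : R | `|y - ratr (q.1 ord0 i)| < q.2.+1%:R^-1] =
      ball (ratr (q.1 ord0 i) : R) q.2.+1%:R^-1.
    by apply/seteqP; split => y; rewrite /ball/= distrC.
  exact: measurable_ball.
have -> : A = \bigcup_(q in [set q | U q `<=` A]) U q.
  apply/seteqP; split => [x Ax|x [q qA]]; last exact: qA.
  have : nbhs x A by exact: open_nbhs_nbhs.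
  rewrite nbhs_ballP => -[e /= e0 eA].
  (* Twice the half-width stays below [e], because a point of the cube is reached from [x] through
     the rational centre. *)
  pose m := Num.truncn (2 / e).
  have me : 2 * m.+1%:R^-1 < e.
    by rewrite ltr_pdivrMr// mulrC -ltr_pdivrMr// truncnS_gt.
  have m0 : (0 : R) < m.+1%:R^-1 by rewrite invr_gt0.
  have near_rat (y : R) : exists r : rat, `|y - ratr r| < m.+1%:R^-1.
    have yy : y - m.+1%:R^-1 < y + m.+1%:R^-1 by rewrite ltrD2l gt0_cp.
    have [r] := rat_in_itvoo yy.
    rewrite in_itv/= => /andP[h1 h2]; exists r.
    by rewrite distrC ltr_distl h1 h2.
  have [r hr] := choice near_rat.
  exists ((\row_i r (x ord0 i)), m); last by move=> i /=; rewrite mxE.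
  move=> y hy; apply: eA.
  split => // i j; rewrite ord1 -ball_normE/=.
  have := hr (x ord0 j); have := hy j; rewrite /= mxE distrC => h1 h2.
  rewrite -(subrKA (ratr (r (x ord0 j)))) (le_lt_trans (ler_normD _ _))//.
  by rewrite (lt_trans _ me)// mulr_natl mulr2n ltrD.
have -> : \bigcup_(q in [set q | U q `<=` A]) U q =
    \bigcup_(q in [set: Q]) (if q \in [set q | U q `<=` A] then U q else set0).
  apply/seteqP; split => x [q qA xq]; exists q => //.
    by rewrite mem_set.
  - by case: ifPn xq => //; rewrite inE.
  - by case: ifPn xq.
by apply: countable_bigcupT_measurable => [|q]; [exact: countableP|case: ifPn].
Qed.

End rV.

(** * The heat kernel *)

Section heat.
Variable R : realType.
Notation mu := (@lebesgue_measure R).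
Notation leb := (leb R).
Implicit Types t c th : R.

Lemma dotv_rV_cons d (a b : R) (x y : 'rV[R]_d) :
  dotv (rV_cons (a, x)) (rV_cons (b, y)) = a * b + dotv x y.
Proof.
rewrite /dotv big_ord_recl; congr (_ + _).
  have -> : ord0 = @lshift 1 d ord0 by exact: val_inj.
  by rewrite !(@row_mxEl _ 1 1 d) !mxE !mulr1n.
apply: eq_bigr => i _.
have -> : lift ord0 i = @rshift 1 d i by exact: val_inj.
by rewrite !(@row_mxEr _ 1 1 d).
Qed.

Lemma dotv_row_mx n k (x x' : 'rV[R]_n) (y y' : 'rV[R]_k) :
  dotv (row_mx x y) (row_mx x' y') = dotv x x' + dotv y y'.
Proof.
rewrite /dotv big_split_ord/=.
by congr (_ + _); apply: eq_bigr => i _; rewrite ?row_mxEl ?row_mxEr.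
Qed.

Lemma dotv_ge0 d (x : 'rV[R]_d) : 0 <= dotv x x.
Proof. by apply: sumr_ge0 => i _; rewrite -expr2 sqr_ge0. Qed.

Lemma dotvNN d (x : 'rV[R]_d) : dotv (- x) (- x) = dotv x x.
Proof. by apply: eq_bigr => i _; rewrite !mxE mulrNN. Qed.

Lemma dotvBl d (x y z : 'rV[R]_d) : dotv (x - y) z = dotv x z - dotv y z.
Proof. by rewrite /dotv -sumrB; apply: eq_bigr => i _; rewrite !mxE mulrBl. Qed.

Lemma dotv_eq0 d (x : 'rV[R]_d) : (dotv x x == 0) = (x == 0).
Proof.
apply/eqP/eqP => [|->]; last by apply: big1 => i _; rewrite mxE mul0r.
move/eqP; rewrite psumr_eq0; last by move=> i _; rewrite -expr2 sqr_ge0.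
move=> /allP h; apply/rowP => i; have := h i (mem_index_enum _).
by rewrite mulf_eq0 orbb mxE => /eqP.
Qed.

Lemma rV_consD d (a b : R) (x y : 'rV[R]_d) :
  rV_cons (a + b, x + y) = rV_cons (a, x) + rV_cons (b, y).
Proof.
apply/rowP => i; rewrite !mxE /rV_cons/=.
by case: fintype.split => j; rewrite !mxE ?mulrnDl.
Qed.

Lemma rV_consE d (z : 'rV[R]_d.+1) : exists a x, z = rV_cons (a, x).
Proof.
exists (z ord0 ord0), (rsubmx (z : 'rV_(1 + d))).
apply/rowP => i; rewrite /rV_cons/=.
have [j ->|j ->] := @split_ordP 1 d i.
  rewrite (@row_mxEl _ 1 1 d) (ord1 j) mxE mulr1n; congr (z _ _); exact: val_inj.
by rewrite (@row_mxEr _ 1 1 d) mxE.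
Qed.

Definition gaussd d t (x : 'rV[R]_d) : R := expR (- (t * dotv x x)).

Lemma measurable_gaussd d dT (T : measurableType dT) (t : T -> R) (f : T -> 'rV[R]_d) :
  measurable_fun setT t -> measurable_fun setT f ->
  measurable_fun setT (fun x => gaussd (t x) (f x)).
Proof.
move=> mt mf; apply: measurableT_comp => //; apply: measurableT_comp => //.
by apply: measurable_funM => //; exact: measurable_dotv.
Qed.

Let mcos : measurable_fun setT (@cos R).
Proof. by apply: continuous_measurable_fun; exact: continuous_cos. Qed.

(* Adding the constant [1] keeps the integrand nonnegative, so that the induction
   on the dimension only needs Tonelli's theorem. *)
Lemma integral_gaussd_cos d t c (z : 'rV[R]_d) th : 0 < t -> `|c| <= 1 ->
  (\int[leb d]_x (gaussd t x * (1 + c * cos (dotv z x + th)))%:E =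
   (Num.sqrt (pi / t) ^+ d *
     (1 + c * (cos th * expR (- (dotv z z / (4 * t))))))%:E)%E.
Proof.
move=> t0; have pos e y : `|e| <= 1 -> 0 <= 1 + e * cos y.
  move=> e1; rewrite -lerBlDl sub0r lerNl.
  rewrite (le_trans (ler_norm _))// normrN normrM mulr_ile1//.
  by rewrite ler_norml cos_geN1 cos_le1.
have ms n (w : 'rV[R]_n) e ph :
    measurable_fun setT (fun x => (gaussd t x * (1 + e * cos (dotv w x + ph)))%:E).
  apply/measurable_EFinP; apply: measurable_funM; first exact: measurable_gaussd.
  apply: measurable_funD => //; apply: measurable_funM => //.
  apply: (measurableT_comp mcos); apply: measurable_funD => //.
  exact: measurable_dotv.
elim: d c z th => [|d IH] c z th c1.
  rewrite ge0_integral_leb0//; last first.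
    by move=> x; rewrite lee_fin mulr_ge0 ?expR_ge0 ?pos.
  rewrite /gaussd /dotv !big_ord0 expr0 mulr0 mul0r oppr0 expR0 !mul1r add0r.
  by rewrite mulr1.
have [b [w ->]] := rV_consE z.
rewrite ge0_integral_lebS//; last first.
  by move=> x; rewrite lee_fin mulr_ge0 ?expR_ge0 ?pos.
have e1 : `|c * expR (- (dotv w w / (4 * t)))| <= 1.
  rewrite normrM (ger0_norm (expR_ge0 _)) mulr_ile1 ?expR_ge0//.
  by rewrite expR_le1 oppr_le0 divr_ge0 ?dotv_ge0// mulr_ge0// ltW.
under eq_integral => a _.
  have E (x : 'rV[R]_d) : (gaussd t (rV_cons (a, x)) *
      (1 + c * cos (dotv (rV_cons (b, w)) (rV_cons (a, x)) + th)))%:E =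
      ((gauss t a)%:E *
       (gaussd t x * (1 + c * cos (dotv w x + (b * a + th))))%:E)%E.
    rewrite -EFinM mulrA; congr (_ * (1 + c * cos _))%:E.
      by rewrite /gaussd /gauss dotv_rV_cons mulrDr opprD expRD expr2.
    by rewrite dotv_rV_cons addrA (addrC (b * a)).
  under eq_integral do rewrite E.
  rewrite ge0_integralZl_EFin ?expR_ge0//; last 2 first.
  - by move=> x _; rewrite lee_fin mulr_ge0 ?expR_ge0 ?pos.
  - exact: ms.
  rewrite IH// -EFinM.
  over.
have K0 : 0 <= Num.sqrt (pi / t) ^+ d by rewrite exprn_ge0.
(* Integrating out the other coordinates leaves a one-dimensional integral of the same shape, with
   amplitude [e] in place of [c]. *)
set e := c * expR (- (dotv w w / (4 * t))) in e1 *.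
under eq_integral => a _.
  rewrite (_ : _%:E = ((Num.sqrt (pi / t) ^+ d)%:E *
    (gauss t a * (1 + e * cos (b * a + th)))%:E)%E); last first.
    rewrite -EFinM; congr EFin; rewrite /e; ring.
  over.
have me : measurable_fun setT (fun a => (gauss t a * (1 + e * cos (b * a + th)))%:E).
  apply/measurable_EFinP; apply: measurable_funM; first exact: measurable_gauss.
  apply: measurable_funD => //; apply: measurable_funM => //.
  by apply: (measurableT_comp mcos); apply: measurable_funD => //; exact: measurable_funM.
rewrite (ge0_integralZl_EFin mu measurableT _ me K0); last first.
  by move=> a _; rewrite lee_fin mulr_ge0 ?expR_ge0 ?pos.
have ic : mu.-integrable setT (EFin \o (fun a => gauss t a * cos (b * a + th))).
  apply: integrable_gaussM => //.
    by apply: (measurableT_comp mcos); apply: measurable_funD => //; exact: measurable_funM.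
  by move=> x; rewrite ler_norml cos_geN1 cos_le1.
have -> : (\int[mu]_a (gauss t a * (1 + e * cos (b * a + th)))%:E =
    (Num.sqrt (pi / t) *
     (1 + e * (cos th * expR (- (b ^+ 2 / (4 * t))))))%:E)%E.
  under eq_integral do rewrite mulrDr mulr1 EFinD mulrCA EFinM.
  rewrite integralD//; last 2 first.
  - exact: integrable_gauss.
  - exact: integrableZl.
  rewrite integralZl// integral_gauss//.
  have -> : (\int[mu]_x (gauss t x * cos (b * x + th))%:E =
     (\int[mu]_x (gauss t x * cos (b * x + th)))%R%:E)%E.
    by rewrite fineK// integrable_fin_num.
  rewrite Rintegral_gauss_cos// -EFinM -EFinD; congr EFin; ring.
rewrite -EFinM dotv_rV_cons [in RHS]exprSr; congr EFin.
by rewrite /e (mulrDl (b * b)) opprD expRD expr2; ring.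
Qed.

Lemma integral_gaussd d t : 0 < t ->
  (\int[leb d]_x (gaussd t x)%:E = (Num.sqrt (pi / t) ^+ d)%:E)%E.
Proof.
move=> t0; have := @integral_gaussd_cos d t 0 0 0 t0.
rewrite normr0 ler01 => /(_ isT); rewrite mul0r addr0 mulr1 => <-.
by apply: eq_integral => x _; rewrite mul0r addr0 mulr1.
Qed.

Lemma integrable_gaussd d t : 0 < t ->
  (leb d).-integrable setT (EFin \o @gaussd d t).
Proof.
move=> t0; apply/integrableP; split.
  by apply/measurable_EFinP; exact: measurable_gaussd.
under eq_integral do rewrite /= ger0_norm ?expR_ge0//.
by rewrite integral_gaussd// ltry.
Qed.

Lemma measurable_cos_dotv d dT (T : measurableType dT) (f g : T -> 'rV[R]_d) th :
  measurable_fun setT f -> measurable_fun setT g ->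
  measurable_fun setT (fun x => cos (dotv (f x) (g x) + th)).
Proof.
move=> mf mg; apply: (measurableT_comp mcos); apply: measurable_funD => //.
exact: measurable_dotv.
Qed.

Lemma integrable_gaussd_cos d t (z : 'rV[R]_d) th : 0 < t ->
  (leb d).-integrable setT (EFin \o (fun x => gaussd t x * cos (dotv z x + th))).
Proof.
move=> t0; apply: le_integrable (integrable_gaussd d t0) => //.
  apply/measurable_EFinP; apply: measurable_funM; first exact: measurable_gaussd.
  exact: measurable_cos_dotv.
move=> x _ /=; rewrite lee_fin normrM ler_piMr// ler_norml.
by rewrite cos_geN1 cos_le1.
Qed.

(** The Gauss-Weierstrass kernel. For [t <= 0] the formula still gives nonnegative values, which the
    weight [tw] then annihilates. *)
Definition heat d t (z : 'rV[R]_d) : R :=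
  (Num.sqrt (4 * pi * t))^-1 ^+ d * expR (- (dotv z z / (4 * t))).

Lemma heat_ge0 d t (z : 'rV[R]_d) : 0 <= heat t z.
Proof. by rewrite mulr_ge0 ?expR_ge0// exprn_ge0// invr_ge0. Qed.

Lemma heatN d t (z : 'rV[R]_d) : heat t (- z) = heat t z.
Proof. by rewrite /heat dotvNN. Qed.

Lemma heat_row_mx n k t (x : 'rV[R]_n) (y : 'rV[R]_k) :
  heat t (row_mx x y) = heat t x * heat t y.
Proof.
by rewrite /heat dotv_row_mx (mulrDl (dotv x x)) opprD expRD exprD; ring.
Qed.

(** [x^-1] is [x] times the power [-1] of [x^2], also at [0] because the inverse of [0] is [0]; this
    reduces the claim to measurability of powers. *)
Lemma measurable_invr : measurable_fun setT (@GRing.inv R).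
Proof.
have -> : @GRing.inv R = (fun x => x * (x ^+ 2) `^ (-1)).
  apply/funext => x; rewrite powR_inv1 ?sqr_ge0//.
  have [->|x0] := eqVneq x 0; first by rewrite invr0 mul0r.
  by field.
apply: measurable_funM => //.
by apply: (measurableT_comp (measurable_powR (-1))).
Qed.

Lemma measurable_heat d dT (T : measurableType dT) (t : T -> R) (f : T -> 'rV[R]_d) :
  measurable_fun setT t -> measurable_fun setT f ->
  measurable_fun setT (fun x => heat (t x) (f x)).
Proof.
move=> mt mf.
have mS : measurable_fun setT (@Num.sqrt R).
  by apply: continuous_measurable_fun; exact: sqrt_continuous.
have mI := measurable_invr.
apply: measurable_funM.
  apply: measurable_funX; apply: (measurableT_comp mI); apply: (measurableT_comp mS).
  exact: measurable_funM.
apply: measurableT_comp => //; apply: measurableT_comp => //.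
apply: measurable_funM; first exact: measurable_dotv.
by apply: (measurableT_comp mI); exact: measurable_funM.
Qed.

(** Removing the constant part from [integral_gaussd_cos] exhibits the heat kernel as the Fourier
    transform of a Gaussian; its positive definiteness comes from there. *)
Lemma Rintegral_gaussd_cos d t (z : 'rV[R]_d) : 0 < t ->
  \int[leb d]_x (gaussd t x * cos (dotv z x)) = (2 * pi) ^+ d * heat t z.
Proof.
move=> t0; have := @integral_gaussd_cos d t 1 z 0 t0.
rewrite normr1 lexx => /(_ isT); rewrite cos0 !mul1r => H.
have ic := integrable_gaussd_cos z 0 t0.
have : \int[leb d]_x (gaussd t x * (1 + 1 * cos (dotv z x + 0))) =
    Num.sqrt (pi / t) ^+ d + \int[leb d]_x (gaussd t x * cos (dotv z x)).
  under eq_Rintegral do rewrite mul1r mulrDr mulr1.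
  rewrite RintegralD//; last exact: integrable_gaussd.
  rewrite /Rintegral integral_gaussd//; congr (_ + _).
  by under eq_integral do rewrite addr0.
rewrite /Rintegral H /= mulrDr mulr1 => /addrI <-.
rewrite /heat mulrA -exprMn; congr (_ ^+ _ * _).
have p0 : 0 < pi :> R := pi_gt0 R.
have s4 : 0 < Num.sqrt (4 * pi * t) by rewrite sqrtr_gt0 !mulr_gt0.
apply/eqP; rewrite eq_sym -(eqrXn2 (n := 2))// ?exprMn ?exprVn ?sqr_sqrtr//.
- by apply/eqP; move: (pi : R) p0 => q q0; field; rewrite (lt0r_neq0 t0) (lt0r_neq0 q0).
- by rewrite divr_ge0// ltW.
- by rewrite !mulr_ge0// ltW.
- by rewrite !mulr_ge0 ?invr_ge0// ltW.
Qed.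


(** The integrand is the normal density of mean [a] and variance [2 t]. *)
Lemma integral_heat1 t (a : R) : 0 < t ->
  (\int[mu]_b ((Num.sqrt (4 * pi * t))^-1 *
     expR (- ((a - b) * (a - b) / (4 * t))))%:E = 1)%E.
Proof.
move=> t0; pose sg := Num.sqrt (2 * t).
have sg0 : sg != 0 by rewrite sqrtr_eq0 -ltNge mulr_gt0.
rewrite -(integral_normal_pdf a sg); apply: eq_integral => b _.
rewrite normal_pdfE// /normal_peak /normal_fun sqr_sqrtr ?mulr_ge0 ?(ltW t0)//.
congr ((_^-1 * expR _)%:E).
  by congr Num.sqrt; rewrite -mulr_natl; ring.
have tn := lt0r_neq0 t0.
by rewrite -mulr_natl; field.
Qed.

Lemma integral_heat d t (x : 'rV[R]_d) : 0 < t ->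
  (\int[leb d]_y (heat t (x - y))%:E = 1)%E.
Proof.
move=> t0.
have mh n (z : 'rV[R]_n) : measurable_fun setT (fun y : 'rV[R]_n => (heat t (z - y))%:E).
  by apply/measurable_EFinP; apply: measurable_heat => //; exact: measurable_rVB.
have h0 n (z : 'rV[R]_n) : (0 <= (heat t z)%:E)%E by rewrite lee_fin heat_ge0.
elim: d x => [|d IH] x.
  by rewrite ge0_integral_leb0// /heat /dotv big_ord0 mul0r oppr0 expR0 mul1r.
have [a [w ->]] := rV_consE x.
rewrite ge0_integral_lebS//.
rewrite -[RHS](integral_heat1 a t0); apply: eq_integral => b _.
have E (y : 'rV[R]_d) : (heat t (rV_cons (a, w) - rV_cons (b, y)))%:E =
    (((Num.sqrt (4 * pi * t))^-1 * expR (- ((a - b) * (a - b) / (4 * t))))%:E *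
     (heat t (w - y))%:E)%E.
  have -> : rV_cons (a, w) - rV_cons (b, y) = rV_cons (a - b, w - y).
    by rewrite -scaleN1r rV_consZ -!rV_consD scaleN1r mulN1r.
  rewrite /heat dotv_rV_cons (mulrDl ((a - b) * (a - b))) opprD expRD exprS -EFinM.
  by congr EFin; ring.
under eq_integral do rewrite E.
have c0 : 0 <= (Num.sqrt (4 * pi * t))^-1 * expR (- ((a - b) * (a - b) / (4 * t))).
  by rewrite mulr_ge0 ?expR_ge0// invr_ge0.
rewrite (ge0_integralZl_EFin (leb d) measurableT (fun y _ => h0 _ _) (mh _ w) c0).
by rewrite IH mule1.
Qed.

End heat.

(** * Fubini's theorem for real-valued integrals *)

Section fubini.
Context d1 d2 (T1 : measurableType d1) (T2 : measurableType d2) (R : realType).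
Variable m1 : {sigma_finite_measure set T1 -> \bar R}.
Variable m2 : {sigma_finite_measure set T2 -> \bar R}.

Lemma Rintegral_Fubini (f : T1 -> T2 -> R) :
  measurable_fun setT (fun p : T1 * T2 => f p.1 p.2) ->
  (\int[m1]_x \int[m2]_y `|f x y|%:E < +oo)%E ->
  (forall x, m2.-integrable setT (fun y => (f x y)%:E)) ->
  (forall y, m1.-integrable setT (fun x => (f x y)%:E)) ->
  \int[m1]_x \int[m2]_y f x y = \int[m2]_y \int[m1]_x f x y.
Proof.
move=> mf fy f1 f2; rewrite /Rintegral; congr fine.
under eq_integral do rewrite fineK ?integrable_fin_num//.
under [RHS]eq_integral do rewrite fineK ?integrable_fin_num//.
apply: (@Fubini _ _ _ _ _ m1 m2 (fun p => (f p.1 p.2)%:E)).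
by apply/integrable12ltyP => //; exact/measurable_EFinP.
Qed.

Lemma integrable_Rintegral (f : T1 -> T2 -> R) :
  measurable_fun setT (fun p : T1 * T2 => f p.1 p.2) ->
  (\int[m1]_x \int[m2]_y `|f x y|%:E < +oo)%E ->
  (forall x, m2.-integrable setT (fun y => (f x y)%:E)) ->
  m1.-integrable setT (fun x => (\int[m2]_y f x y)%:E).
Proof.
move=> mf fy f1.
have := @integrable_fubini_F _ _ _ _ _ m1 m2 (fun p => (f p.1 p.2)%:E).
have -> : fubini_F m2 (fun p : T1 * T2 => (f p.1 p.2)%:E) =
    (fun x => (\int[m2]_y f x y)%:E).
  by apply/funext => x; rewrite /fubini_F /= /Rintegral fineK ?integrable_fin_num.
by apply; apply/integrable12ltyP => //; exact/measurable_EFinP.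
Qed.

End fubini.

Section fubini_dom.
Context d1 d2 (T1 : measurableType d1) (T2 : measurableType d2) (R : realType).
Variable m1 : {sigma_finite_measure set T1 -> \bar R}.
Variable m2 : {sigma_finite_measure set T2 -> \bar R}.

(** The inner integral is by definition the integral of the positive part minus that of the negative
    part; each is measurable by Tonelli's theorem, and so is [fine]. *)
Lemma measurable_Rintegral (f : T1 -> T2 -> R) :
  measurable_fun setT (fun p : T1 * T2 => f p.1 p.2) ->
  measurable_fun setT (fun x => \int[m2]_y f x y).
Proof.
move=> mf; apply: (measurableT_comp (fine_measurable measurableT)).
under eq_fun do rewrite integralE.
have mEf : measurable_fun setT (fun p : T1 * T2 => (f p.1 p.2)%:E).
  exact/measurable_EFinP.
apply: emeasurable_funB.
  have -> : (fun x => \int[m2]_y (fun y => (f x y)%:E)^\+ y)%E =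
      fubini_F m2 (fun p => (f p.1 p.2)%:E)^\+%E.
    by apply/funext => x; apply: eq_integral => y _; rewrite !funeposE.
  apply: measurable_fun_fubini_tonelli_F => [|p]; last exact: funepos_ge0.
  exact: measurable_funepos.
have -> : (fun x => \int[m2]_y (fun y => (f x y)%:E)^\- y)%E =
    fubini_F m2 (fun p => (f p.1 p.2)%:E)^\-%E.
  by apply/funext => x; apply: eq_integral => y _; rewrite !funenegE.
apply: measurable_fun_fubini_tonelli_F => [|p]; last exact: funeneg_ge0.
exact: measurable_funeneg.
Qed.

Variables (f : T1 -> T2 -> R) (A : T1 -> R) (B : T2 -> R).
Hypothesis mf : measurable_fun setT (fun p : T1 * T2 => f p.1 p.2).
Hypothesis iA : m1.-integrable setT (EFin \o A).
Hypothesis iB : m2.-integrable setT (EFin \o B).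
Hypothesis fAB : forall x y, `|f x y| <= A x * B y.

Let f1 x : m2.-integrable setT (fun y => (f x y)%:E).
Proof.
apply: (@le_integrable _ _ _ _ _ _ _ (fun y => ((A x)%:E * (EFin \o B) y)%E)) => //.
- apply/measurable_EFinP; exact: (measurableT_comp mf (measurable_pair1 x)).
- by move=> y _ /=; rewrite lee_fin (le_trans (fAB x y)) ?ler_norm.
- exact: integrableZl.
Qed.

Let f2 y : m1.-integrable setT (fun x => (f x y)%:E).
Proof.
apply: (@le_integrable _ _ _ _ _ _ _ (fun x => ((B y)%:E * (EFin \o A) x)%E)) => //.
- apply/measurable_EFinP; exact: (measurableT_comp mf (measurable_pair2 y)).
- by move=> x _ /=; rewrite lee_fin (le_trans (fAB x y))// mulrC ler_norm.
- exact: integrableZl.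
Qed.

Let f12 : (\int[m1]_x \int[m2]_y `|f x y|%:E < +oo)%E.
Proof.
have mA : measurable_fun setT A by exact/measurable_EFinP/(measurable_int m1).
have mB : measurable_fun setT B by exact/measurable_EFinP/(measurable_int m2).
have mnB : measurable_fun setT (fun y => `|B y|%:E).
  by apply/measurable_EFinP; exact: measurableT_comp.
apply: (@le_lt_trans _ _ (\int[m1]_x (`|A x|%:E * \int[m2]_y `|B y|%:E))%E).
  apply: ge0_le_integral => //.
  - by move=> x _; apply: integral_ge0.
  - apply: (@measurable_fun_fubini_tonelli_F _ _ _ _ _ m2
      (fun p => `|f p.1 p.2|%:E)) => //.
    by apply/measurable_EFinP; exact: measurableT_comp.
  - apply: emeasurable_funM => //.
    by apply/measurable_EFinP; exact: measurableT_comp.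
  - move=> x _; rewrite -ge0_integralZl_EFin//.
    apply: ge0_le_integral => //.
    + apply/measurable_EFinP; apply: measurableT_comp => //.
      exact: (measurableT_comp mf (measurable_pair1 x)).
    + by apply: emeasurable_funM => //; exact: measurable_cst.
    + move=> y _; rewrite -EFinM lee_fin -normrM (le_trans (fAB x y))//.
      exact: ler_norm.
rewrite ge0_integralZr//; last 2 first.
- by apply/measurable_EFinP; exact: measurableT_comp.
- exact: integral_ge0.
have /integrableP[_ A1] := iA; have /integrableP[_ B1] := iB.
by apply: lte_mul_pinfty; rewrite ?integral_ge0// ge0_fin_numE ?integral_ge0.
Qed.

(** A majorant of product form makes every slice integrable, and not merely almost every slice, so
    the inner real integrals can be manipulated pointwise. *)
Lemma Rintegral_Fubini_dom :
  \int[m1]_x \int[m2]_y f x y = \int[m2]_y \int[m1]_x f x y.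
Proof. exact: Rintegral_Fubini. Qed.

Lemma integrable_Rintegral_dom : m1.-integrable setT (fun x => (\int[m2]_y f x y)%:E).
Proof. exact: integrable_Rintegral. Qed.

End fubini_dom.

(** * Positive definiteness of the heat kernel *)

Section fourier_gauss.
Variable R : realType.
Variable d : nat.
Notation leb := (leb R d).
Variable v : 'rV[R]_d -> R.
Hypothesis iv : leb.-integrable setT (EFin \o v).
Implicit Types (x y xi : 'rV[R]_d).

(** Up to sign and normalization, [fcos] and [fsin] are the real and imaginary parts of the Fourier
    integral, and [fsq] is its squared modulus. *)
Definition fcos xi : R := \int[leb]_x (v x * cos (dotv x xi)).
Definition fsin xi : R := \int[leb]_x (v x * sin (dotv x xi)).
Definition fsq xi : R := fcos xi ^+ 2 + fsin xi ^+ 2.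

Let mv : measurable_fun setT v.
Proof. by apply/measurable_EFinP; exact: measurable_int iv. Qed.

Let mcos : measurable_fun setT (@cos R).
Proof. by apply: continuous_measurable_fun; exact: continuous_cos. Qed.

Let msin : measurable_fun setT (@sin R).
Proof. by apply: continuous_measurable_fun; exact: continuous_sin. Qed.

Let mdot (w : R -> R) :
  measurable_fun setT w ->
  measurable_fun setT (fun p : 'rV[R]_d * 'rV[R]_d => v p.2 * w (dotv p.2 p.1)).
Proof.
move=> mw; apply: measurable_funM; first exact: measurableT_comp.
by apply: (measurableT_comp mw); exact: measurable_dotv.
Qed.

Lemma measurable_fcos : measurable_fun setT fcos.
Proof. by apply: measurable_Rintegral; exact: mdot. Qed.

Lemma measurable_fsin : measurable_fun setT fsin.
Proof. by apply: measurable_Rintegral; exact: mdot. Qed.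

Lemma integrable_bounded_mul (w : 'rV[R]_d -> R) : measurable_fun setT w ->
  (forall x, `|w x| <= 1) -> leb.-integrable setT (EFin \o (fun x => v x * w x)).
Proof.
move=> mw w1; apply: le_integrable iv => //.
  by apply/measurable_EFinP; exact: measurable_funM.
by move=> x _ /=; rewrite lee_fin normrM ler_piMr.
Qed.

Let M := \int[leb]_x `|v x|.

Let le_M (w : 'rV[R]_d -> R) : measurable_fun setT w ->
  (forall x, `|w x| <= 1) -> `|\int[leb]_x (v x * w x)| <= M.
Proof.
move=> mw w1; have i := integrable_bounded_mul mw w1.
apply: (le_trans (le_normr_Rintegral _ i)) => //.
apply: le_Rintegral => //.
- exact: integrable_norm i.
- exact: integrable_norm iv.
- by move=> x _; rewrite normrM ler_piMr.
Qed.

Let cos1 (y : R) : `|cos y| <= 1. Proof. by rewrite ler_norml cos_geN1 cos_le1. Qed.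
Let sin1 (y : R) : `|sin y| <= 1. Proof. by rewrite ler_norml sin_geN1 sin_le1. Qed.

Let mcosd xi : measurable_fun setT (fun x : 'rV[R]_d => cos (dotv x xi)).
Proof. by apply: (measurableT_comp mcos); exact: measurable_dotv. Qed.

Let msind xi : measurable_fun setT (fun x : 'rV[R]_d => sin (dotv x xi)).
Proof. by apply: (measurableT_comp msin); exact: measurable_dotv. Qed.

Lemma fcos_le xi : `|fcos xi| <= M.
Proof. exact: le_M. Qed.

Lemma fsin_le xi : `|fsin xi| <= M.
Proof. exact: le_M. Qed.

Let M0 : 0 <= M. Proof. by apply: Rintegral_ge0. Qed.

Lemma fcos_cos_fsin_sin x xi : fcos xi * cos (dotv x xi) + fsin xi * sin (dotv x xi) =
  \int[leb]_y (v y * cos (dotv (x - y) xi)).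
Proof.
have ic := integrable_bounded_mul (mcosd xi) (fun y => cos1 _).
have isn := integrable_bounded_mul (msind xi) (fun y => sin1 _).
rewrite /fcos /fsin -RintegralZr// -RintegralZr// -RintegralD//; last 2 first.
- exact: (integrableZr measurableT (cos (dotv x xi)) ic).
- exact: (integrableZr measurableT (sin (dotv x xi)) isn).
by apply: eq_Rintegral => y _; rewrite dotvBl cosB; ring.
Qed.


Section gauss_kernel.
Variables (t : R) (t0 : 0 < t).

Let mg : measurable_fun setT (fun xi : 'rV[R]_d => gaussd t xi).
Proof. exact: measurable_gaussd. Qed.

(** [f1] is [gaussd t xi * fsq xi] with one of the two transforms written out as an integral over
    [x]; [f2] is the same with the second transform written out over [y], after the addition formula
    for the cosine. *)
Let f1 xi x := gaussd t xi * (fcos xi * cos (dotv x xi) + fsin xi * sin (dotv x xi)) * v x.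
Let f2 x xi y := gaussd t xi * (v y * cos (dotv (x - y) xi)).

Let mf1 : measurable_fun setT (fun p : 'rV[R]_d * 'rV[R]_d => f1 p.1 p.2).
Proof.
have mp1 (h : 'rV[R]_d -> R) : measurable_fun setT h ->
    measurable_fun setT (fun p : 'rV[R]_d * 'rV[R]_d => h p.1).
  by move=> mh; exact: measurableT_comp.
apply: measurable_funM; last by apply: measurableT_comp.
apply: measurable_funM; first exact: mp1.
apply: measurable_funD; apply: measurable_funM.
- by apply: mp1; exact: measurable_fcos.
- by apply: (measurableT_comp mcos); exact: measurable_dotv.
- by apply: mp1; exact: measurable_fsin.
- by apply: (measurableT_comp msin); exact: measurable_dotv.
Qed.

Let f1_le xi x : `|f1 xi x| <= (2 * M * gaussd t xi) * `|v x|.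
Proof.
rewrite /f1 normrM ler_wpM2r// normrM (ger0_norm (expR_ge0 _)) mulrC.
rewrite ler_wpM2r ?expR_ge0// (le_trans (ler_normD _ _))// mulr_natl mulr2n.
by rewrite lerD// normrM -[leRHS]mulr1 ler_pM// ?fcos_le ?fsin_le.
Qed.

Let iA c : leb.-integrable setT (EFin \o (fun xi => c * gaussd t xi)).
Proof.
exact: (integrableZl measurableT c (integrable_gaussd d t0)).
Qed.

Let f1_int xi : \int[leb]_x f1 xi x = gaussd t xi * fsq xi.
Proof.
have ic := integrable_bounded_mul (mcosd xi) (fun y => cos1 _).
have isn := integrable_bounded_mul (msind xi) (fun y => sin1 _).
have icZ := integrableZl measurableT (fcos xi) ic.
have isZ := integrableZl measurableT (fsin xi) isn.
have E x : f1 xi x = gaussd t xi *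
    (fcos xi * (v x * cos (dotv x xi)) + fsin xi * (v x * sin (dotv x xi))).
  by rewrite /f1; ring.
under eq_Rintegral do rewrite E.
rewrite RintegralZl//; last exact: (integrableD measurableT icZ isZ).
by rewrite RintegralD// RintegralZl// RintegralZl.
Qed.

Lemma integrable_gaussd_fsq :
  leb.-integrable setT (EFin \o (fun xi => gaussd t xi * fsq xi)).
Proof.
have := integrable_Rintegral_dom mf1 (iA _) (integrable_norm iv) f1_le.
by apply: eq_integrable => // xi _; rewrite /= f1_int.
Qed.

(** Plancherel's identity with a Gaussian weight. The weight makes the integrals over [xi] and the
    two copies of [v] absolutely convergent, so [xi] can be integrated first; by
    [Rintegral_gaussd_cos] this produces the heat kernel. *)
Lemma Rintegral_gaussd_fsq : \int[leb]_xi (gaussd t xi * fsq xi) =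
  (2 * pi) ^+ d * \int[leb]_x (v x * \int[leb]_y (v y * heat t (x - y))).
Proof.
under eq_Rintegral do rewrite -f1_int.
rewrite (Rintegral_Fubini_dom mf1 (iA _) (integrable_norm iv) f1_le).
have mh x : measurable_fun setT (fun y : 'rV[R]_d => heat t (x - y)).
  by apply: measurable_heat => //; exact: measurable_rVB.
have mf2 x : measurable_fun setT (fun p : 'rV[R]_d * 'rV[R]_d => f2 x p.1 p.2).
  apply: measurable_funM; first exact: measurableT_comp.
  apply: measurable_funM; first exact: measurableT_comp.
  by apply: (measurableT_comp mcos); apply: measurable_dotv => //; exact: measurable_rVB.
have f2_le x xi y : `|f2 x xi y| <= (1 * gaussd t xi) * `|v y|.
  rewrite /f2 mul1r normrM (ger0_norm (expR_ge0 _)) ler_wpM2l ?expR_ge0//.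
  by rewrite normrM ler_piMr.
have hb (z : 'rV[R]_d) : heat t z <= (Num.sqrt (4 * pi * t))^-1 ^+ d.
  rewrite /heat ler_piMr// ?exprn_ge0 ?invr_ge0//.
  by rewrite expR_le1 oppr_le0 divr_ge0 ?dotv_ge0// mulr_ge0// ltW.
have ivh x : leb.-integrable setT (EFin \o (fun y => v y * heat t (x - y))).
  apply: (@le_integrable _ _ _ _ _ _ _ (fun y =>
    (((Num.sqrt (4 * pi * t))^-1 ^+ d)%:E * (EFin \o v) y)%E)) => //.
  - by apply/measurable_EFinP; exact: measurable_funM.
  - move=> y _ /=; rewrite lee_fin normrM [leRHS]normrM mulrC ler_wpM2r//.
    rewrite (ger0_norm (heat_ge0 _ _)) (le_trans (hb _))//; exact: ler_norm.
  - exact: integrableZl.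
have f2_int x y : \int[leb]_xi f2 x xi y = (2 * pi) ^+ d * (v y * heat t (x - y)).
  rewrite mulrCA -Rintegral_gaussd_cos//.
  have igc : leb.-integrable setT
      (EFin \o (fun xi => gaussd t xi * cos (dotv (x - y) xi))).
    have := integrable_gaussd_cos (x - y) 0 t0.
    by apply: eq_integrable => // xi _; rewrite /= addr0.
  by rewrite -RintegralZl//; apply: eq_Rintegral => xi _; rewrite /f2; ring.
have inner x : \int[leb]_xi f1 xi x =
    (2 * pi) ^+ d * (v x * \int[leb]_y (v y * heat t (x - y))).
  have E xi : f1 xi x = v x * \int[leb]_y f2 x xi y.
    rewrite /f1 fcos_cos_fsin_sin mulrC; congr (_ * _).
    rewrite -RintegralZl//.
    apply: (@integrable_bounded_mul (fun y => cos (dotv (x - y) xi))) => //.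
    by apply: (measurableT_comp mcos); apply: measurable_dotv => //; exact: measurable_rVB.
  under eq_Rintegral do rewrite E.
  rewrite RintegralZl//; last first.
    exact: (integrable_Rintegral_dom (mf2 x) (iA 1) (integrable_norm iv) (f2_le x)).
  rewrite (Rintegral_Fubini_dom (mf2 x) (iA 1) (integrable_norm iv) (f2_le x)).
  under eq_Rintegral do rewrite f2_int.
  by rewrite RintegralZl// mulrCA.
under eq_Rintegral do rewrite inner.
rewrite RintegralZl//.
(* What remains is the integrability of the outer integrand, left over from pulling the constant
   out. *)
pose f3 x y := v x * (v y * heat t (x - y)).
have mf3 : measurable_fun setT (fun p : 'rV[R]_d * 'rV[R]_d => f3 p.1 p.2).
  apply: measurable_funM; first exact: measurableT_comp.
  apply: measurable_funM; first exact: measurableT_comp.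
  by apply: measurable_heat => //; exact: measurable_rVB.
pose c := (Num.sqrt (4 * pi * t))^-1 ^+ d.
have f3_le x y : `|f3 x y| <= (c * `|v x|) * `|v y|.
  rewrite /f3 normrM (normrM (v y)) (ger0_norm (heat_ge0 _ _)).
  rewrite (_ : c * `|v x| * `|v y| = `|v x| * (`|v y| * c)); last by ring.
  by rewrite ler_wpM2l// ler_wpM2l.
have icv : leb.-integrable setT (EFin \o (fun x => c * `|v x|)).
  exact: (integrableZl measurableT c (integrable_norm iv)).
have := integrable_Rintegral_dom mf3 icv (integrable_norm iv) f3_le.
by apply: eq_integrable => // x _ /=; rewrite /f3 RintegralZl.
Qed.

(** Positive definiteness: on the frequency side the quadratic form is the integral of a square
    against a Gaussian. The lower bound on pairs of slices in [heatC_quad_ge] rests on it. *)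
Lemma Rintegral_heat_conv_ge0 :
  0 <= \int[leb]_x (v x * \int[leb]_y (v y * heat t (x - y))).
Proof.
rewrite -(@pmulr_rge0 _ ((2 * pi) ^+ d)) ?exprn_gt0 ?mulr_gt0 ?pi_gt0//.
rewrite -Rintegral_gaussd_fsq; apply: Rintegral_ge0 => xi _.
by rewrite mulr_ge0 ?expR_ge0// addr_ge0 ?sqr_ge0.
Qed.

End gauss_kernel.
End fourier_gauss.

(** * The heat-kernel energy and its spectral form *)

Section iterated.
Context d1 d2 (T1 : measurableType d1) (T2 : measurableType d2) (R : realType).
Variables (m1 : {sigma_finite_measure set T1 -> \bar R})
  (m2 : {sigma_finite_measure set T2 -> \bar R}).
Implicit Types f g : T1 -> T2 -> \bar R.

Let mJ f := measurable_fun setT (fun p : T1 * T2 => f p.1 p.2).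

Lemma tonelli_swap f :
  measurable_fun setT (fun p : T1 * T2 => f p.1 p.2) ->
  (forall x y, 0 <= f x y)%E ->
  (\int[m1]_x \int[m2]_y f x y = \int[m2]_y \int[m1]_x f x y)%E.
Proof. by move=> mf f0; exact: (fubini_tonelli (fun p => f p.1 p.2)). Qed.

Lemma measurable_iterated f : mJ f -> (forall x y, 0 <= f x y)%E ->
  measurable_fun setT (fun x => \int[m2]_y f x y)%E.
Proof.
move=> mf f0.
by apply: (@measurable_fun_fubini_tonelli_F _ _ _ _ _ m2 (fun p => f p.1 p.2)) => // -[].
Qed.

Lemma iterated_measurable1 f x : mJ f -> measurable_fun setT (f x).
Proof. by move=> mf; exact: (measurableT_comp mf (@pair1_measurable _ _ _ _ x)). Qed.

Lemma iteratedD f g : mJ f -> mJ g ->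
  (forall x y, 0 <= f x y)%E -> (forall x y, 0 <= g x y)%E ->
  (\int[m1]_x \int[m2]_y (f x y + g x y) =
   \int[m1]_x \int[m2]_y f x y + \int[m1]_x \int[m2]_y g x y)%E.
Proof.
move=> mf mg f0 g0; rewrite -ge0_integralD//; first last.
- exact: measurable_iterated.
- by move=> x _; exact: integral_ge0.
- exact: measurable_iterated.
- by move=> x _; exact: integral_ge0.
apply: eq_integral => x _; rewrite ge0_integralD//; exact: iterated_measurable1.
Qed.

Lemma iteratedZ f (c : R) : mJ f -> (forall x y, 0 <= f x y)%E -> 0 <= c ->
  (\int[m1]_x \int[m2]_y (c%:E * f x y) = c%:E * \int[m1]_x \int[m2]_y f x y)%E.
Proof.
move=> mf f0 c0; rewrite -ge0_integralZl_EFin//; last 2 first.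
- by move=> x _; exact: integral_ge0.
- exact: measurable_iterated.
by apply: eq_integral => x _; rewrite ge0_integralZl_EFin//; exact: iterated_measurable1.
Qed.

Lemma ae_le_iterated f g : mJ f -> mJ g ->
  (forall x y, 0 <= f x y)%E -> (forall x y, 0 <= g x y)%E ->
  {ae m1, forall x, {ae m2, forall y, (f x y <= g x y)%E}} ->
  (\int[m1]_x \int[m2]_y f x y <= \int[m1]_x \int[m2]_y g x y)%E.
Proof.
move=> mf mg f0 g0 aefg; apply: ae_ge0_le_integral => //.
- by move=> x _; exact: integral_ge0.
- exact: measurable_iterated.
- by move=> x _; exact: integral_ge0.
- exact: measurable_iterated.
apply: filterS aefg => x aex _.
apply: ae_ge0_le_integral => //; [exact: iterated_measurable1..|].
by apply: filterS aex => y fg _.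
Qed.

Lemma le_iterated f g : mJ f -> mJ g ->
  (forall x y, 0 <= f x y)%E -> (forall x y, f x y <= g x y)%E ->
  (\int[m1]_x \int[m2]_y f x y <= \int[m1]_x \int[m2]_y g x y)%E.
Proof.
move=> mf mg f0 fg; apply: ae_le_iterated => //.
  by move=> x y; exact: le_trans (fg x y).
by apply: aeW => x; apply: aeW => y.
Qed.

Lemma ae_iterated_lty f : mJ f -> (forall x y, 0 <= f x y)%E ->
  (\int[m1]_x \int[m2]_y f x y < +oo)%E ->
  {ae m1, forall x, (\int[m2]_y f x y < +oo)%E}.
Proof.
move=> mf f0 foo.
have I0 x : (0 <= \int[m2]_y f x y)%E by exact: integral_ge0.
have iG : m1.-integrable setT (fun x => \int[m2]_y f x y)%E.
  apply/integrableP; split; first exact: measurable_iterated.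
  by under eq_integral do rewrite gee0_abs//.
apply: filterS (integrable_ae measurableT iG) => x fin.
by rewrite -ge0_fin_numE//; exact: fin.
Qed.

Lemma ae_iterated (N : set (T1 * T2)) : measurable N ->
  (\int[m1]_x \int[m2]_y (\1_N (x, y) : R)%:E = 0)%E ->
  {ae m1, forall x, {ae m2, forall y, ~ N (x, y)}}.
Proof.
move=> mN I0; pose f x y := ((\1_N (x, y) : R)%:E)%E.
have m1N : measurable_fun setT (\1_N : T1 * T2 -> R) by exact: measurable_indic.
have mf : mJ f.
  by apply/measurable_EFinP; apply: eq_measurable_fun m1N => -[].
have f0 x y : (0 <= f x y)%E by rewrite lee_fin.
have [H _] := ae_eq_integral_abs m1 measurableT (measurable_iterated mf f0).
have {}H := H _; have {}/H : (\int[m1]_x `|\int[m2]_y f x y| = 0)%E.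
  by rewrite -I0; apply: eq_integral => x _; rewrite gee0_abs ?integral_ge0.
apply: filterS => x /(_ I) fx0.
have mNx : measurable [set y | N (x, y)].
  have mp : measurable_fun setT (pair x : T2 -> T1 * T2) by exact: pair1_measurable.
  by rewrite -[X in measurable X]setTI; exact: mp.
exists [set y | N (x, y)]; split => //; last by move=> y /=; exact: contrapT.
rewrite -[RHS]fx0 -[X in m2 X]setIT -(integral_indic _ measurableT mNx).
by apply: eq_integral => y _; rewrite /f !indicE; congr ((_ : bool)%:R%:E);
  apply/idP/idP; rewrite !inE.
Qed.

End iterated.
Arguments tonelli_swap {d1 d2 T1 T2 R m1 m2} f _ _.

Section heat_pair.
Variables (R : realType) (d : nat).
Implicit Types f g : 'rV[R]_d -> R.

Lemma measurable_heat_pair t f g : measurable_fun setT f -> measurable_fun setT g ->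
  measurable_fun setT (fun p : 'rV[R]_d * 'rV[R]_d =>
     ((f p.1 - g p.2) ^+ 2 * heat t (p.1 - p.2))%:E).
Proof.
move=> mf mg; apply/measurable_EFinP; apply: measurable_funM.
  by apply: measurable_funX; apply: measurable_funB; exact: measurableT_comp.
by apply: measurable_heat => //; exact: measurable_rVB.
Qed.

Lemma heat_pair_ge0 t f g x y : (0 <= ((f x - g y) ^+ 2 * heat t (x - y))%:E)%E.
Proof. by rewrite lee_fin mulr_ge0 ?sqr_ge0 ?heat_ge0. Qed.

End heat_pair.

(** Twice the pairing of [u] with [u] minus its heat flow at time [t]. This definition and the next
    two are locked, which keeps the nested integrals from being unfolded by conversion. *)
HB.lock Definition heatD (R : realType) (d : nat) (t : R) (u : 'rV[R]_d -> R) : \bar R :=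
  (\int[leb R d]_x \int[leb R d]_y ((u x - u y) ^+ 2 * heat t (x - y))%:E)%E.

(** A positive multiple of [energy s u], see [energyE]. *)
HB.lock Definition heatQ (R : realType) (d : nat) (s : R) (u : 'rV[R]_d -> R) : \bar R :=
  (\int[@lebesgue_measure R]_t ((tw s t)%:E * heatD t u))%E.

(** The pairing of [u] with its heat flow, that is, the cross term in the expansion of [heatD]. *)
HB.lock Definition heatA (R : realType) (d : nat) (u : 'rV[R]_d -> R) (t : R) : R :=
  \int[leb R d]_x (u x * \int[leb R d]_y (u y * heat t (x - y))).

Section heat_energy.
Variable R : realType.
Notation mu := (@lebesgue_measure R).
Notation leb := (leb R).

Implicit Types s t : R.

Lemma heatD_ge0 d t (u : 'rV[R]_d -> R) : (0 <= heatD t u)%E.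
Proof.
by rewrite heatD.unlock; apply: integral_ge0 => x _; apply: integral_ge0 => y _;
  rewrite lee_fin mulr_ge0 ?sqr_ge0 ?heat_ge0.
Qed.

Lemma heatQ_ge0 d s (u : 'rV[R]_d -> R) : (0 <= heatQ s u)%E.
Proof.
by rewrite heatQ.unlock; apply: integral_ge0 => t _; rewrite mule_ge0 ?heatD_ge0// lee_fin tw_ge0.
Qed.

Lemma measurable_heatD_param d dT (T : measurableType dT) (t : T -> R)
    (u : T -> 'rV[R]_d -> R) : measurable_fun setT t ->
  measurable_fun setT (fun p : T * 'rV[R]_d => u p.1 p.2) ->
  measurable_fun setT (fun w => heatD (t w) (u w)).
Proof.
move=> mt mu'; under eq_fun do rewrite heatD.unlock.
have mp (f : T * 'rV[R]_d * 'rV[R]_d -> T * 'rV[R]_d) : measurable_fun setT f ->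
    measurable_fun setT (fun q => u (f q).1 (f q).2).
  by move=> mf; exact: (measurableT_comp mu' mf).
apply: (@measurable_leb_integral2 _ _ _ d
   (fun w x => \int[leb d]_y ((u w x - u w y) ^+ 2 * heat (t w) (x - y))%:E)%E).
  apply: (@measurable_leb_integral2 _ _ _ d
    (fun (p : T * 'rV[R]_d) y =>
       ((u p.1 p.2 - u p.1 y) ^+ 2 * heat (t p.1) (p.2 - y))%:E)%E).
    apply/measurable_EFinP; apply: measurable_funM.
      apply: measurable_funX; apply: measurable_funB; first exact: (mp fst).
      by apply: (mp (fun q => (q.1.1, q.2))); apply: measurable_fun_pair => //;
        exact: measurableT_comp.
    apply: measurable_heat.
      by apply: (measurableT_comp mt); exact: measurableT_comp.
    by apply: measurable_rVB => //; exact: measurableT_comp.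
  by move=> p y; rewrite lee_fin mulr_ge0 ?sqr_ge0 ?heat_ge0.
by move=> w x; apply: integral_ge0 => y _; rewrite lee_fin mulr_ge0 ?sqr_ge0 ?heat_ge0.
Qed.

Lemma measurable_heatD d (u : 'rV[R]_d -> R) : measurable_fun setT u ->
  measurable_fun setT (fun t => heatD t u).
Proof.
move=> mu'; apply: (@measurable_heatD_param d _ (measurableTypeR R) id (fun=> u)) => //.
exact: measurableT_comp.
Qed.

Section one_function.
Variables (d : nat) (u : 'rV[R]_d -> R).
Hypothesis iu : (leb d).-integrable setT (EFin \o u).
Hypothesis iu2 : (leb d).-integrable setT (EFin \o (fun x => u x ^+ 2)).

Let mu' : measurable_fun setT u.
Proof. by apply/measurable_EFinP; exact: measurable_int iu. Qed.

Let N := \int[leb d]_x (u x ^+ 2).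

Let mh t x : measurable_fun setT (fun y : 'rV[R]_d => heat t (x - y)).
Proof. by apply: measurable_heat => //; exact: measurable_rVB. Qed.

Lemma heat_le t (z : 'rV[R]_d) : 0 < t -> heat t z <= (Num.sqrt (4 * pi * t))^-1 ^+ d.
Proof.
move=> t0; rewrite /heat ler_piMr// ?exprn_ge0 ?invr_ge0//.
by rewrite expR_le1 oppr_le0 divr_ge0 ?dotv_ge0// mulr_ge0// ltW.
Qed.

Lemma integrable_mul_heat (w : 'rV[R]_d -> R) t x : 0 < t ->
  (leb d).-integrable setT (EFin \o w) ->
  (leb d).-integrable setT (EFin \o (fun y => w y * heat t (x - y))).
Proof.
move=> t0 iw.
have mw : measurable_fun setT w by apply/measurable_EFinP; exact: measurable_int iw.
apply: (@le_integrable _ _ _ _ _ _ _ (fun y =>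
  (((Num.sqrt (4 * pi * t))^-1 ^+ d)%:E * (EFin \o w) y)%E)) => //.
- by apply/measurable_EFinP; exact: measurable_funM.
- move=> y _ /=; rewrite lee_fin normrM [leRHS]normrM mulrC ler_wpM2r//.
  by rewrite (ger0_norm (heat_ge0 _ _)) (le_trans (heat_le _ t0))// ler_norm.
- exact: integrableZl.
Qed.

Lemma integrable_heatA t : 0 < t ->
  (leb d).-integrable setT
    (EFin \o (fun x => u x * \int[leb d]_y (u y * heat t (x - y)))).
Proof.
move=> t0; pose f3 (x y : 'rV[R]_d) := u x * (u y * heat t (x - y)).
have mf3 : measurable_fun setT (fun p : 'rV[R]_d * 'rV[R]_d => f3 p.1 p.2).
  apply: measurable_funM; first exact: measurableT_comp.
  apply: measurable_funM; first exact: measurableT_comp.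
  by apply: measurable_heat => //; exact: measurable_rVB.
pose c := (Num.sqrt (4 * pi * t))^-1 ^+ d.
have f3_le x y : `|f3 x y| <= (c * `|u x|) * `|u y|.
  rewrite /f3 normrM (normrM (u y)) (ger0_norm (heat_ge0 _ _)).
  rewrite (_ : c * `|u x| * `|u y| = `|u x| * (`|u y| * c)); last by ring.
  by rewrite ler_wpM2l// ler_wpM2l// heat_le.
have icv : (leb d).-integrable setT (EFin \o (fun x => c * `|u x|)).
  exact: (integrableZl measurableT c (integrable_norm iu)).
have := integrable_Rintegral_dom mf3 icv (integrable_norm iu) f3_le.
apply: eq_integrable => // x _ /=; rewrite /f3 RintegralZl//.
exact: integrable_mul_heat.
Qed.

(** Expansion of the square: the kernel has mass one in each variable, so each pure term contributes
    [N]. *)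
Lemma heatDE t : 0 < t -> heatD t u = (2 * N - 2 * heatA u t)%:E.
Proof.
move=> t0.
pose g (x : 'rV[R]_d) := \int[leb d]_y (u y ^+ 2 * heat t (x - y)).
have gE x : (g x)%:E = (\int[leb d]_y (u y ^+ 2 * heat t (x - y))%:E)%E.
  by rewrite fineK// integrable_fin_num//; exact: integrable_mul_heat.
have mg2 : measurable_fun setT (fun p : 'rV[R]_d * 'rV[R]_d =>
    (u p.2 ^+ 2 * heat t (p.1 - p.2))%:E).
  apply/measurable_EFinP; apply: measurable_funM.
    by apply: measurable_funX; exact: measurableT_comp.
  by apply: measurable_heat => //; exact: measurable_rVB.
have g0 (x y : 'rV[R]_d) : (0 <= (u y ^+ 2 * heat t (x - y))%:E)%E.
  by rewrite lee_fin mulr_ge0 ?sqr_ge0 ?heat_ge0.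
have int_g : (\int[leb d]_x (g x)%:E = N%:E)%E.
  under eq_integral do rewrite gE.
  rewrite (tonelli_swap (fun x y : 'rV[R]_d => (u y ^+ 2 * heat t (x - y))%:E))//.
  rewrite /N /Rintegral fineK ?integrable_fin_num//; apply: eq_integral => y _.
  under eq_integral do rewrite EFinM -opprB heatN.
  rewrite ge0_integralZl_EFin ?sqr_ge0//.
  - by rewrite integral_heat// mule1.
  - by move=> x _; rewrite lee_fin heat_ge0.
  - by apply/measurable_EFinP; exact: mh.
have ig : (leb d).-integrable setT (EFin \o g).
  apply/integrableP; split.
    have mg := @measurable_Rintegral _ _ _ _ _ (leb d)
      (fun x y : 'rV[R]_d => u y ^+ 2 * heat t (x - y)).
    by apply/measurable_EFinP; apply: mg; exact/measurable_EFinP.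
  have g_ge0 x : 0 <= g x.
    by apply: Rintegral_ge0 => y _; rewrite mulr_ge0 ?sqr_ge0 ?heat_ge0.
  under eq_integral do rewrite /= ger0_norm//.
  by rewrite int_g ltry.
have int_h x : \int[leb d]_y (heat t (x - y)) = 1.
  by rewrite /Rintegral integral_heat.
have ih x : (leb d).-integrable setT (EFin \o (fun y => heat t (x - y))).
  apply/integrableP; split; first by apply/measurable_EFinP; exact: mh.
  under eq_integral do rewrite /= ger0_norm ?heat_ge0//.
  by rewrite integral_heat// ltry.
have inner x : (\int[leb d]_y ((u x - u y) ^+ 2 * heat t (x - y))%:E =
    (u x ^+ 2 + g x - 2 * (u x * \int[leb d]_y (u y * heat t (x - y))))%:E)%E.
  have i1 := integrableZl measurableT (u x ^+ 2) (ih x).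
  have i2 := integrable_mul_heat x t0 iu2.
  have i3 := integrable_mul_heat x t0 iu.
  have i3' := integrableZl measurableT (2 * u x) i3.
  have E y : (u x - u y) ^+ 2 * heat t (x - y) = u x ^+ 2 * heat t (x - y) +
     u y ^+ 2 * heat t (x - y) - 2 * u x * (u y * heat t (x - y)) by ring.
  have i12 := integrableD measurableT i1 i2.
  have i123 := integrableB measurableT i12 i3'.
  under eq_integral do rewrite E.
  rewrite -[LHS]fineK; last exact: integrable_fin_num i123.
  congr EFin; rewrite -/(Rintegral _ _ _) RintegralB//.
  by rewrite RintegralD// RintegralZl// int_h mulr1 RintegralZl// mulrA.
rewrite heatD.unlock; under eq_integral do rewrite inner.
have iA := integrable_heatA t0.
have iA' := integrableZl measurableT 2 iA.
have i12 := integrableD measurableT iu2 ig.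
have i123 := integrableB measurableT i12 iA'.
rewrite -[LHS]fineK; last exact: integrable_fin_num i123.
congr EFin; rewrite -/(Rintegral _ _ _) RintegralB//.
rewrite RintegralD// RintegralZl// -/N.
have -> : \int[leb d]_x g x = N by rewrite /Rintegral int_g.
by rewrite heatA.unlock; ring.
Qed.


Lemma heatA_gaussd t : 0 < t ->
  \int[leb d]_xi (gaussd t xi * fsq u xi) = (2 * pi) ^+ d * heatA u t.
Proof. by rewrite heatA.unlock; exact: Rintegral_gaussd_fsq. Qed.

Lemma heatA_ge0 t : 0 < t -> 0 <= heatA u t.
Proof. by move=> t0; rewrite heatA.unlock; exact: Rintegral_heat_conv_ge0. Qed.

Lemma fsq_ge0 xi : 0 <= fsq u xi.
Proof. by rewrite addr_ge0// sqr_ge0. Qed.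

Lemma measurable_fsq : measurable_fun setT (fsq u).
Proof.
by apply: measurable_funD; apply: measurable_funX;
  [exact: measurable_fcos|exact: measurable_fsin].
Qed.

Let pid0 : 0 < (2 * pi) ^+ d :> R.
Proof. by rewrite exprn_gt0// mulr_gt0// pi_gt0. Qed.

(** On the frequency side [heatA] is the integral of [fsq] against a Gaussian that decreases with
    time. *)
Lemma le_heatA t1 t2 : 0 < t1 -> t1 <= t2 -> heatA u t2 <= heatA u t1.
Proof.
move=> t10 t12; have t20 : 0 < t2 by exact: lt_le_trans t12.
have E1 := heatA_gaussd t10; have E2 := heatA_gaussd t20.
move: (2 * pi) E1 E2 pid0 => c E1 E2 c0.
suff : c ^+ d * heatA u t2 <= c ^+ d * heatA u t1 by rewrite ler_pM2l.
have i1 := integrable_gaussd_fsq iu t10.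
have i2 := integrable_gaussd_fsq iu t20.
rewrite -[leLHS]E2 -[leRHS]E1; apply: (le_Rintegral measurableT i2 i1) => xi _.
 rewrite ler_wpM2r ?fsq_ge0// ler_expR lerN2.
by rewrite ler_wpM2r// dotv_ge0.
Qed.

Lemma le_heatD t1 t2 : 0 < t1 -> t1 <= t2 -> (heatD t1 u <= heatD t2 u)%E.
Proof.
move=> t10 t12; rewrite (heatDE t10) (heatDE (lt_le_trans t10 t12)).
rewrite lee_fin lerD2l lerN2; apply: ler_wpM2l; first exact: ler0n.
exact: le_heatA.
Qed.

(* [heatD] is nondecreasing in time, so its value at [T] is controlled by the part
   of the energy integral over [T, 2T]. *)
Lemma heatD_le_heatQ s (T : R) : 0 < s -> 0 < T ->
  (heatD T u <= (2 `^ (1 + s) * T `^ s)%:E * heatQ s u)%E.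
Proof.
move=> s0 T0; set I : set R := `[T, 2 * T]%classic.
have mI : measurable I by exact: measurable_itv.
have T2 : T <= 2 * T by rewrite mulr_natl mulr2n lerDl ltW.
have mD := measurable_heatD mu'.
have mtw : measurable_fun setT (fun t => (tw s t)%:E).
  by apply/measurable_EFinP; exact: measurable_tw.
have : (((2 * T) `^ (- (1 + s)) * T)%:E * heatD T u <= heatQ s u)%E.
  apply: (@le_trans _ _ (\int[mu]_(t in I) ((tw s t)%:E * heatD t u))%E); last first.
    have mQ : measurable_fun setT (fun t => (tw s t)%:E * heatD t u)%E.
      exact: emeasurable_funM.
    rewrite heatQ.unlock; apply: ge0_subset_integral => //.
    by move=> t _; rewrite mule_ge0 ?heatD_ge0// lee_fin tw_ge0.
  apply: (@le_trans _ _ (\int[mu]_(t in I) cst (((2 * T) `^ (- (1 + s)))%:E * heatD T u) t)%E).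
    have muI : mu I = T%:E.
      rewrite lebesgue_measure_itv/= lte_fin.
      by rewrite mulr_natl mulr2n ltrDl T0 -EFinB addrK.
    have -> : (\int[mu]_(t in I) cst (((2 * T) `^ (- (1 + s)))%:E * heatD T u) t =
        ((2 * T) `^ (- (1 + s)))%:E * heatD T u * T%:E)%E.
      by rewrite integral_cst//; congr (_ * _)%E; exact: muI.
    by rewrite EFinM -!muleA (muleC (heatD T u)).
  apply: ge0_le_integral => //.
  - by move=> t _; rewrite mule_ge0 ?heatD_ge0// lee_fin powR_ge0.
  - by apply: measurable_funTS; apply: emeasurable_funM.
  - move=> t; rewrite /I/= in_itv/= => /andP[Tt t2T].
    have t0 : 0 < t by exact: lt_le_trans Tt.
    apply: lee_pmul; rewrite ?heatD_ge0 ?lee_fin ?powR_ge0//; last exact: le_heatD.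
    rewrite tw_gt0E// !powRN lef_pV2 ?posrE ?powR_gt0// ?mulr_gt0//.
    by apply: ge0_ler_powR => //; rewrite ?nnegrE ltW// ?mulr_gt0// ltr_wpDl.
rewrite (heatDE T0) -EFinM => H.
have [Qoo|Qfin] := eqVneq (heatQ s u) +oo%E.
  by rewrite Qoo gt0_muley ?leey// lte_fin mulr_gt0 ?powR_gt0.
have Qf : heatQ s u \is a fin_num by rewrite ge0_fin_numE ?heatQ_ge0// ltey.
move: H; rewrite -(fineK Qf) -EFinM !lee_fin.
set q := fine _; set D := _ - _.
have e : (2 * T) `^ (- (1 + s)) * T = (2 `^ (1 + s) * T `^ s)^-1.
  rewrite powRN powRM ?(ltW T0)// !powRD ?(gt_eqF T0) ?implybT//.
    rewrite !powRr1 ?(ltW T0)//.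
    have := lt0r_neq0 (powR_gt0 s T0).
    have := lt0r_neq0 (powR_gt0 s (@ltr0n R 2)).
    have := lt0r_neq0 T0.
    by move=> h1 h2 h3; field; rewrite h1 h2 h3.
  by rewrite pnatr_eq0 implybT.
by rewrite e mulrC ler_pdivrMr ?mulr_gt0 ?powR_gt0// mulrC.
Qed.


(** This takes the place of strong continuity of the heat flow at time [0]: finite energy forces
    [heatD t u = O(t^s)] by [heatD_le_heatQ], and [heatDE] converts this into a limit for
    [heatA]. *)
Lemma heatA_cvg s : 0 < s -> (heatQ s u < +oo)%E ->
  heatA u n.+1%:R^-1 @[n --> \oo] --> N.
Proof.
move=> s0 Qoo.
have Qf : heatQ s u \is a fin_num by rewrite ge0_fin_numE ?heatQ_ge0.
set q := fine (heatQ s u).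
have t0 n : 0 < n.+1%:R^-1 :> R by rewrite invr_gt0.
have D0 n : 0 <= 2 * N - 2 * heatA u n.+1%:R^-1.
  by have := heatD_ge0 n.+1%:R^-1 u; rewrite heatDE// lee_fin.
have Dq n : 2 * N - 2 * heatA u n.+1%:R^-1 <= 2 `^ (1 + s) * n.+1%:R^-1 `^ s * q.
  have := heatD_le_heatQ s0 (t0 n).
  by rewrite heatDE// -(fineK Qf) -EFinM lee_fin.
have h0 : (n.+1%:R^-1 : R) `^ s @[n --> \oo] --> 0.
  by apply: (cvg_at_rightP _ _ _).1 (powR_cvg0 s0) _ _; split => //;
    exact: cvg_harmonic.
have c0 : 2 `^ (1 + s) * (n.+1%:R^-1 : R) `^ s * q / 2 @[n --> \oo] --> 0.
  rewrite -[X in _ --> X](mul0r (2^-1 : R)); apply: cvgM; last exact: cvg_cst.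
  rewrite -[X in _ --> X](mul0r q); apply: cvgM; last exact: cvg_cst.
  rewrite -[X in _ --> X](mulr0 (2 `^ (1 + s))); apply: cvgM h0.
  exact: cvg_cst.
have cN : N - heatA u n.+1%:R^-1 @[n --> \oo] --> 0.
  apply: (@squeeze_cvgr _ _ _ _ (cst 0)
      (fun n => 2 `^ (1 + s) * (n.+1%:R^-1 : R) `^ s * q / 2)) => //.
    apply: nearW => n /=; have := D0 n; have := Dq n.
    set A := heatA _ _; set B := 2 `^ _ * _ * _ => h1 h2.
    by apply/andP; split; lra.
  exact: cvg_cst.
have : N - (N - heatA u n.+1%:R^-1) @[n --> \oo] --> N - 0.
  by apply: cvgB => //; exact: cvg_cst.
rewrite subr0; apply: cvg_trans; apply: near_eq_cvg.
by apply: nearW => n; rewrite subKr.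
Qed.

(** Plancherel's identity for functions of finite energy. The Gaussian weights increase to [1] along
    [t = 1 / (n + 1)], so the left side is obtained by monotone convergence and the right side from
    [heatA_cvg]. *)
Lemma integral_fsq s : 0 < s -> (heatQ s u < +oo)%E ->
  (\int[leb d]_xi (fsq u xi)%:E = ((2 * pi) ^+ d * N)%:E)%E.
Proof.
move=> s0 Qoo.
have t0 n : 0 < n.+1%:R^-1 :> R by rewrite invr_gt0.
pose g n xi : \bar R := (gaussd n.+1%:R^-1 xi * fsq u xi)%:E.
have gE n : (\int[leb d]_xi g n xi = ((2 * pi) ^+ d * heatA u n.+1%:R^-1)%:E)%E.
  by rewrite -(heatA_gaussd (t0 n)) fineK// integrable_fin_num//;
    exact: integrable_gaussd_fsq.
have mfs := measurable_fsq.
have cv1 : (\int[leb d]_xi g n xi)%E @[n --> \oo] --> (\int[leb d]_xi (fsq u xi)%:E)%E.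
  have cvp xi : g n xi @[n --> \oo] --> (fsq u xi)%:E.
    apply: cvg_EFin; first exact: nearW.
    rewrite -[X in _ --> X]mul1r; apply: cvgM; last exact: cvg_cst.
    rewrite /gaussd -[X in _ --> X]expR0; apply: (cvg_comp _ expR); last exact: continuous_expR.
    rewrite -oppr0; apply: cvgN; rewrite -[X in _ --> X](mul0r (dotv xi xi)).
    by apply: cvgM; [exact: cvg_harmonic|exact: cvg_cst].
  have -> : (\int[leb d]_xi (fsq u xi)%:E = \int[leb d]_xi limn (g ^~ xi))%E.
    by apply: eq_integral => xi _; apply/esym/cvg_lim => //; exact: cvp.
  apply: cvg_monotone_convergence => //.
  - move=> n; apply/measurable_EFinP; apply: measurable_funM => //.
    exact: measurable_gaussd.
  - by move=> n xi _; rewrite lee_fin mulr_ge0 ?expR_ge0 ?fsq_ge0.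
  - move=> xi _ m n mn; rewrite lee_fin ler_wpM2r ?fsq_ge0// ler_expR lerN2.
    by rewrite ler_wpM2r ?dotv_ge0// lef_pV2 ?posrE// ler_nat.
have cv2 : (\int[leb d]_xi g n xi)%E @[n --> \oo] --> ((2 * pi) ^+ d * N)%:E.
  under eq_fun do rewrite gE.
  apply: cvg_EFin; first exact: nearW.
  by apply: cvgM; [exact: cvg_cst|exact: (heatA_cvg s0)].
exact: (cvg_unique _ cv1 cv2).
Qed.

(** Plancherel's identity minus its version with a Gaussian weight. *)
Lemma integral_fsq_complement s t : 0 < s -> (heatQ s u < +oo)%E -> 0 < t ->
  (\int[leb d]_xi ((1 - gaussd t xi) * fsq u xi)%:E =
   ((2 * pi) ^+ d / 2)%:E * heatD t u)%E.
Proof.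
move=> s0 Qoo t0.
have ifs : (leb d).-integrable setT (EFin \o fsq u).
  apply/integrableP; split; first by apply/measurable_EFinP; exact: measurable_fsq.
  under eq_integral do rewrite /= ger0_norm ?fsq_ge0//.
  by rewrite (integral_fsq s0 Qoo) ltry.
have ig := integrable_gaussd_fsq iu t0.
pose h xi := gaussd t xi * fsq u xi.
have E xi : ((1 - gaussd t xi) * fsq u xi)%:E = ((fsq u xi)%:E - (h xi)%:E)%E.
  by rewrite -EFinB mulrBl mul1r.
under eq_integral do rewrite E.
rewrite (integralB measurableT ifs ig) (integral_fsq s0 Qoo).
have -> : (\int[leb d]_xi (h xi)%:E = ((2 * pi) ^+ d * heatA u t)%:E)%E.
  by rewrite -(heatA_gaussd t0) fineK// integrable_fin_num.
by rewrite heatDE// -EFinB -EFinM; congr EFin; field.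
Qed.

End one_function.
End heat_energy.

(** * The energy on the frequency side *)

Section spectral.
Variable R : realType.
Notation mu := (@lebesgue_measure R).
Notation leb := (leb R).
Implicit Types s t : R.

(** The integral equals [Gamma (1 - s) / s], but only its positivity and finiteness matter. The
    absolute value keeps the integrand nonnegative on the whole line. *)
Definition kappa s : R := fine (\int[mu]_t (tw s t * `|1 - expR (- t)|)%:E).

Let mexp1 : measurable_fun setT (fun t : R => `|1 - expR (- t)|).
Proof.
apply: measurableT_comp => //; apply: measurable_funB => //.
by apply: measurableT_comp.
Qed.

Let kappa_lty s : 0 < s < 1 -> (\int[mu]_t (tw s t * `|1 - expR (- t)|)%:E < +oo)%E.
Proof.
move=> /andP[s0 s1]; apply: (@integral_tw_lty _ s _ 1 1 0) => //.
- move=> t /andP[t0 _]; rewrite powRr1 ?(ltW t0)// mul1r ger0_norm.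
    by rewrite lerBlDl -lerBlDr; exact: expR_ge1Dx.
  by rewrite subr_ge0 expR_le1 oppr_le0 ltW.
- move=> t t1; rewrite powRr0 mul1r ger0_norm ?gerBl ?expR_ge0//.
  by rewrite subr_ge0 expR_le1 oppr_le0 (le_trans ler01).
Qed.

Lemma kappaE s : 0 < s < 1 ->
  (\int[mu]_t (tw s t * `|1 - expR (- t)|)%:E = (kappa s)%:E)%E.
Proof.
move=> s01; rewrite /kappa fineK// ge0_fin_numE ?kappa_lty//.
by apply: integral_ge0 => t _; rewrite lee_fin mulr_ge0 ?tw_ge0.
Qed.

Lemma kappa_gt0 s : 0 < s < 1 -> 0 < kappa s.
Proof.
move=> s01; rewrite -lte_fin -kappaE//; apply: integral_tw_gt0 => // t t0.
by rewrite normr_gt0 subr_eq0 eq_sym lt_eqF// expR_lt1 oppr_lt0.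
Qed.

Lemma enorm_powR d s (xi : 'rV[R]_d) : enorm xi `^ (2 * s) = dotv xi xi `^ s.
Proof. by rewrite powRrM powR_mulrn ?sqrtr_ge0// sqr_sqrtr ?dotv_ge0. Qed.

Lemma integral_tw_gaussd d s (xi : 'rV[R]_d) : 0 < s < 1 ->
  (\int[mu]_t (tw s t * `|1 - gaussd t xi|)%:E =
   (kappa s * enorm xi `^ (2 * s))%:E)%E.
Proof.
move=> /[dup] s01 /andP[s0 s1]; rewrite enorm_powR.
have := dotv_ge0 xi; rewrite le_eqVlt => /predU1P[a0|a0].
  rewrite -a0 powR0 ?gt_eqF// mulr0; apply: integral0_eq => t _.
  by rewrite /gaussd -a0 mulr0 oppr0 expR0 subrr normr0 mulr0.
have := @integral_tw_scale _ s _ (fun t => `|1 - expR (- t)|%:E) a0.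
under eq_integral do rewrite mulrC -EFinM.
under [X in (_ * X)%E]eq_integral do rewrite -EFinM.
rewrite kappaE// => H; rewrite mulrC EFinM -H//.
exact/measurable_EFinP.
Qed.

Section one_function.
Variables (d : nat) (u : 'rV[R]_d -> R).
Hypothesis iu : (leb d).-integrable setT (EFin \o u).
Hypothesis iu2 : (leb d).-integrable setT (EFin \o (fun x => u x ^+ 2)).

(** At fixed time, [integral_fsq_complement] writes [heatD] as an integral of [fsq] against
    [1 - gaussd t]. Tonelli's theorem and [integral_tw_gaussd] then turn the time integral into the
    symbol [|xi|^(2s)]. *)
Lemma heatQ_spectral s : 0 < s < 1 -> (heatQ s u < +oo)%E ->
  heatQ s u = ((2 * kappa s / (2 * pi) ^+ d)%:E *
    \int[leb d]_xi (enorm xi `^ (2 * s) * fsq u xi)%:E)%E.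
Proof.
move=> s01 Qoo; have /andP[s0 s1] := s01.
have c0 : 0 < (2 * pi) ^+ d :> R by rewrite exprn_gt0// mulr_gt0// pi_gt0.
have compl t := @integral_fsq_complement _ _ _ iu iu2 s t s0 Qoo.
move: (2 * pi) c0 compl => c c0 compl.
have mfs := measurable_fsq iu.
pose F t xi := (tw s t * `|1 - gaussd t xi| * fsq u xi)%:E.
have F0 t xi : (0 <= F t xi)%E.
  rewrite lee_fin; apply: mulr_ge0; last exact: fsq_ge0.
  by apply: mulr_ge0; first exact: tw_ge0.
have mtw := measurable_tw s.
have mF : measurable_fun setT (fun p : measurableTypeR R * 'rV[R]_d => F p.1 p.2).
  apply/measurable_EFinP; apply: measurable_funM; last exact: measurableT_comp.
  apply: measurable_funM; first exact: measurableT_comp.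
  apply: measurableT_comp => //; apply: measurable_funB => //.
  exact: measurable_gaussd.
transitivity ((2 / c ^+ d)%:E * \int[mu]_t \int[leb d]_xi F t xi)%E.
  rewrite -ge0_integralZl_EFin//; last 3 first.
  - by move=> t _; apply: integral_ge0.
  - exact: measurable_leb_integral2.
  - by rewrite divr_ge0// ltW.
  rewrite heatQ.unlock; apply: eq_integral => t _.
  have [t0|t0] := leP t 0.
    rewrite tw_le0E// mul0e integral0_eq ?mule0// => xi _.
    by rewrite /F tw_le0E// !mul0r.
  have -> : (\int[leb d]_xi F t xi = (tw s t)%:E * ((c ^+ d / 2)%:E * heatD t u))%E.
    rewrite -compl// -ge0_integralZl_EFin ?tw_ge0//.
    - apply: eq_integral => xi _; rewrite -EFinM /F mulrA; congr (_ * _ * _)%:E.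
      rewrite ger0_norm// subr_ge0 expR_le1 oppr_le0 mulr_ge0 ?dotv_ge0//.
      exact: ltW.
    - move=> xi _; rewrite lee_fin mulr_ge0 ?fsq_ge0// subr_ge0 expR_le1 oppr_le0.
      by rewrite mulr_ge0 ?dotv_ge0// ltW.
    - apply/measurable_EFinP; apply: measurable_funM => //.
      by apply: measurable_funB => //; exact: measurable_gaussd.
  rewrite muleCA; congr (_ * _)%E; rewrite muleA -EFinM.
  have -> : 2 / c ^+ d * (c ^+ d / 2) = 1.
    by move: (c ^+ d) c0 => e e0; field; exact: lt0r_neq0.
  by rewrite mul1e.
rewrite (@tonelli_swap _ _ _ _ _ mu (leb d) F mF F0).
have -> : (\int[leb d]_xi \int[mu]_t F t xi = (kappa s)%:E *
    \int[leb d]_xi (enorm xi `^ (2 * s) * fsq u xi)%:E)%E.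
  rewrite -ge0_integralZl_EFin//; last 3 first.
  - by move=> xi _; rewrite lee_fin mulr_ge0 ?powR_ge0 ?fsq_ge0.
  - apply/measurable_EFinP; apply: measurable_funM => //.
    by apply: (measurableT_comp (measurable_powR _)); exact: measurable_enorm.
  - by rewrite ltW// kappa_gt0.
  apply: eq_integral => xi _.
  rewrite -EFinM mulrA EFinM -integral_tw_gaussd// -ge0_integralZr//; last 3 first.
  - apply/measurable_EFinP; apply: measurable_funM => //.
    apply: measurableT_comp => //; apply: measurable_funB => //.
    by apply: measurable_gaussd.
  - by move=> t _; rewrite lee_fin mulr_ge0 ?tw_ge0.
  - by rewrite lee_fin fsq_ge0.
by rewrite muleA -EFinM; congr (_%:E * _)%E; ring.
Qed.

End one_function.

Section two_functions.
Variables (d : nat) (u v : 'rV[R]_d -> R) (a : R).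
Let w x := a * u x + v x.

(** Expansion of the square of [a (u x - u y) - (v x - v y)]. The crude bound supplies the
    finiteness from which the exact expansion [heatQ_lincombE] starts. *)
Lemma heatD_lincomb_le t : measurable_fun setT u -> measurable_fun setT v ->
  (heatD t w <= (2 * a ^+ 2)%:E * heatD t u + 2%:E * heatD t v)%E.
Proof.
move=> mu' mv; have mw : measurable_fun setT w.
  by apply: measurable_funD => //; exact: measurable_funM.
have a0 : 0 <= 2 * a ^+ 2 by rewrite mulr_ge0 ?sqr_ge0.
pose K (h : 'rV[R]_d -> R) x y := ((h x - h y) ^+ 2 * heat t (x - y))%:E.
have mK h : measurable_fun setT h ->
    measurable_fun setT (fun p : 'rV[R]_d * 'rV[R]_d => K h p.1 p.2).
  by move=> mh; exact: measurable_heat_pair.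
have K0 h x y : (0 <= K h x y)%E by exact: heat_pair_ge0.
rewrite !heatD.unlock.
rewrite -(iteratedZ (leb d) (leb d) (mK u mu') (K0 u) a0).
rewrite -(iteratedZ (leb d) (leb d) (mK v mv) (K0 v) (ler0n _ 2)).
rewrite -(iteratedD (leb d) (leb d) (f := fun x y => ((2 * a ^+ 2)%:E * K u x y)%E)
  (g := fun x y => (2%:E * K v x y)%E)); first last.
- by move=> x y; rewrite mule_ge0.
- by move=> x y; rewrite mule_ge0.
- exact: measurable_funeM (mK v mv).
- exact: measurable_funeM (mK u mu').
apply: (le_iterated _ _ (mK w mw)).
- by apply: emeasurable_funD; apply: measurable_funeM; exact: mK.
- exact: K0.
move=> x y; rewrite -!EFinM -EFinD lee_fin; move: (heat_ge0 t (x - y)).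
move: (heat t (x - y)) => h h_ge0.
rewrite [leRHS](_ : _ =
  (2 * a ^+ 2 * (u x - u y) ^+ 2 + 2 * (v x - v y) ^+ 2) * h); last by ring.
apply: ler_wpM2r => //.
rewrite -subr_ge0 (_ : _ - _ = (a * (u x - u y) - (v x - v y)) ^+ 2) ?sqr_ge0//.
rewrite /w; ring.
Qed.

Lemma heatQ_lincomb_le s : measurable_fun setT u -> measurable_fun setT v ->
  (heatQ s w <= (2 * a ^+ 2)%:E * heatQ s u + 2%:E * heatQ s v)%E.
Proof.
move=> mu' mv; have mw : measurable_fun setT w.
  by apply: measurable_funD => //; exact: measurable_funM.
have a0 : 0 <= 2 * a ^+ 2 by rewrite mulr_ge0 ?sqr_ge0.
have mtw : measurable_fun setT (fun t => (tw s t)%:E).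
  by apply/measurable_EFinP; exact: measurable_tw.
have mQ (h : 'rV[R]_d -> R) : measurable_fun setT h ->
    measurable_fun setT (fun t => (tw s t)%:E * heatD t h)%E.
  by move=> mh; apply: emeasurable_funM => //; exact: measurable_heatD.
have Q0 (h : 'rV[R]_d -> R) t : (0 <= (tw s t)%:E * heatD t h)%E.
  by rewrite mule_ge0 ?heatD_ge0// lee_fin tw_ge0.
rewrite heatQ.unlock -!ge0_integralZl_EFin//; try exact: mQ.
rewrite -ge0_integralD//; last 4 first.
- by move=> x _; rewrite mule_ge0.
- by apply: emeasurable_funM => //; exact: mQ.
- by move=> x _; rewrite mule_ge0.
- by apply: emeasurable_funM => //; exact: mQ.
apply: ge0_le_integral => //.
- exact: mQ.
- by apply: emeasurable_funD; apply: emeasurable_funM => //; exact: mQ.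
move=> t _; rewrite muleCA (muleCA 2%:E) -muleDr.
- by apply: lee_wpmul2l; [rewrite lee_fin tw_ge0|exact: heatD_lincomb_le].
- by [].
- by apply: ge0_adde_def; rewrite inE mule_ge0 ?heatD_ge0// lee_fin.
Qed.

End two_functions.
End spectral.

(** * Polarization of the energy *)

Section cross.
Variable R : realType.
Notation mu := (@lebesgue_measure R).
Notation leb := (leb R).
Implicit Types s t a : R.

(** The class L1 and L2 at once, where the Fourier transform is an absolutely convergent integral
    and [heatDE] holds. It contains every L2 function that vanishes outside a ball ([L12_of_L2]). *)
Definition L12 d (u : 'rV[R]_d -> R) :=
  (leb d).-integrable setT (EFin \o u) /\
  (leb d).-integrable setT (EFin \o (fun x => u x ^+ 2)).

Lemma L12_measurable d (u : 'rV[R]_d -> R) : L12 u -> measurable_fun setT u.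
Proof. by move=> [iu _]; apply/measurable_EFinP; exact: measurable_int iu. Qed.

Lemma L12_lincomb d a (u v : 'rV[R]_d -> R) : L12 u -> L12 v ->
  L12 (fun x => a * u x + v x).
Proof.
move=> Lu Lv; have mu' := L12_measurable Lu; have mv := L12_measurable Lv.
have [iu iu2] := Lu; have [iv iv2] := Lv; split.
  exact: (integrableD measurableT (integrableZl measurableT a iu) iv).
have := integrableD measurableT (integrableZl measurableT (2 * a ^+ 2) iu2)
  (integrableZl measurableT 2 iv2).
apply: le_integrable => //.
  apply/measurable_EFinP; apply: measurable_funX.
  by apply: measurable_funD => //; exact: measurable_funM.
move=> x _ /=; rewrite lee_fin ger0_norm ?sqr_ge0// ger0_norm; last first.
  by rewrite addr_ge0// mulr_ge0 ?sqr_ge0// mulr_ge0 ?sqr_ge0.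
rewrite -subr_ge0 (_ : _ - _ = (a * u x - v x) ^+ 2) ?sqr_ge0//; ring.
Qed.

(** The real part of the product of the transform of [u] with the conjugate transform of [v], up to
    normalization. *)
Definition fcross d (u v : 'rV[R]_d -> R) xi : R :=
  fcos u xi * fcos v xi + fsin u xi * fsin v xi.

Section integrals.
Variable d : nat.

Lemma measurable_enorm_powR e :
  measurable_fun setT (fun xi : 'rV[R]_d => enorm xi `^ e).
Proof.
by apply: (measurableT_comp (measurable_powR _)); exact: measurable_enorm.
Qed.

Lemma integrable_spectral s (u : 'rV[R]_d -> R) : 0 < s < 1 -> L12 u ->
  (heatQ s u < +oo)%E ->
  (leb d).-integrable setT (EFin \o (fun xi => enorm xi `^ (2 * s) * fsq u xi)).
Proof.
move=> s01 [iu iu2] Qoo.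
have k0 : 0 < 2 * kappa s / (2 * pi) ^+ d.
  by rewrite divr_gt0 ?mulr_gt0 ?kappa_gt0// exprn_gt0// mulr_gt0// pi_gt0.
have h0 xi : 0 <= enorm xi `^ (2 * s) * fsq u xi.
  by rewrite mulr_ge0 ?powR_ge0 ?fsq_ge0.
apply/integrableP; split.
  apply/measurable_EFinP; apply: measurable_funM; first exact: measurable_enorm_powR.
  exact: measurable_fsq.
under eq_integral do rewrite /= ger0_norm//.
have QE := heatQ_spectral iu iu2 s01 Qoo; move: Qoo; rewrite QE.
set I := (\int[_]_x _)%E; have I0 : (0 <= I)%E by apply: integral_ge0 => xi _; rewrite lee_fin.
case: I I0 => [r _|_|//]; first by rewrite !ltry.
by rewrite gt0_muley ?lte_fin.
Qed.

Lemma integrable_cross s (u v : 'rV[R]_d -> R) : 0 < s < 1 -> L12 u -> L12 v ->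
  (heatQ s u < +oo)%E -> (heatQ s v < +oo)%E ->
  (leb d).-integrable setT (EFin \o (fun xi => enorm xi `^ (2 * s) * fcross u v xi)).
Proof.
move=> s01 Lu Lv Qu Qv.
have [iu _] := Lu; have [iv _] := Lv.
have := integrableD measurableT (integrable_spectral s01 Lu Qu)
  (integrable_spectral s01 Lv Qv).
apply: le_integrable => //.
  apply/measurable_EFinP; apply: measurable_funM; first exact: measurable_enorm_powR.
  by apply: measurable_funD; apply: measurable_funM;
    [exact: measurable_fcos|exact: measurable_fcos|exact: measurable_fsin|exact: measurable_fsin].
move=> xi _ /=; rewrite lee_fin -mulrDr normrM [leRHS]normrM.
have h0 : 0 <= fsq u xi + fsq v xi by apply: addr_ge0; exact: fsq_ge0.
rewrite ler_wpM2l// (ger0_norm h0).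
rewrite /fcross /fsq ler_norml.
move: (fcos u xi) (fcos v xi) (fsin u xi) (fsin v xi) => p q r w.
have := sqr_ge0 (p - q); have := sqr_ge0 (r - w).
have := sqr_ge0 (p + q); have := sqr_ge0 (r + w).
have := sqr_ge0 p; have := sqr_ge0 q; have := sqr_ge0 r; have := sqr_ge0 w.
by move=> *; apply/andP; split; nra.
Qed.

Lemma fcos_lincomb a (u v : 'rV[R]_d -> R) xi : L12 u -> L12 v ->
  fcos (fun x => a * u x + v x) xi = a * fcos u xi + fcos v xi.
Proof.
move=> [iu _] [iv _].
have mc : measurable_fun setT (fun x : 'rV[R]_d => cos (dotv x xi)).
  have ms : measurable_fun setT (@cos R).
    by apply: continuous_measurable_fun; exact: continuous_cos.
  by apply: (measurableT_comp ms); exact: measurable_dotv.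
have c1 (x : 'rV[R]_d) : `|cos (dotv x xi)| <= 1 by rewrite ler_norml cos_geN1 cos_le1.
have jc := integrable_bounded_mul iu mc c1.
have kc := integrable_bounded_mul iv mc c1.
rewrite /fcos -RintegralZl// -RintegralD//.
  by apply: eq_Rintegral => x _; ring.
exact: (integrableZl measurableT a jc).
Qed.

Lemma fsin_lincomb a (u v : 'rV[R]_d -> R) xi : L12 u -> L12 v ->
  fsin (fun x => a * u x + v x) xi = a * fsin u xi + fsin v xi.
Proof.
move=> [iu _] [iv _].
have mc : measurable_fun setT (fun x : 'rV[R]_d => sin (dotv x xi)).
  have ms : measurable_fun setT (@sin R).
    by apply: continuous_measurable_fun; exact: continuous_sin.
  by apply: (measurableT_comp ms); exact: measurable_dotv.
have c1 (x : 'rV[R]_d) : `|sin (dotv x xi)| <= 1 by rewrite ler_norml sin_geN1 sin_le1.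
have jc := integrable_bounded_mul iu mc c1.
have kc := integrable_bounded_mul iv mc c1.
rewrite /fsin -RintegralZl// -RintegralD//.
  by apply: eq_Rintegral => x _; ring.
exact: (integrableZl measurableT a jc).
Qed.

Lemma heatQ_fin s (u : 'rV[R]_d -> R) : (heatQ s u < +oo)%E -> heatQ s u \is a fin_num.
Proof. by move=> h; rewrite ge0_fin_numE ?heatQ_ge0. Qed.

Lemma heatQ_spectralR s (u : 'rV[R]_d -> R) : 0 < s < 1 -> L12 u ->
  (heatQ s u < +oo)%E -> heatQ s u = (2 * kappa s / (2 * pi) ^+ d *
    \int[leb d]_xi (enorm xi `^ (2 * s) * fsq u xi))%:E.
Proof.
move=> s01 Lu Qu; have [iu iu2] := Lu.
rewrite (heatQ_spectral iu iu2 s01 Qu) [RHS]EFinM [in RHS]fineK//.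
by apply: integrable_fin_num => //; exact: integrable_spectral.
Qed.

(** Polarization on the frequency side. The cross term is left in spectral form because that is the
    quantity prescribed by a weak equation. *)
Lemma heatQ_lincombE s a (u v : 'rV[R]_d -> R) : 0 < s < 1 -> L12 u -> L12 v ->
  (heatQ s u < +oo)%E -> (heatQ s v < +oo)%E ->
  heatQ s (fun x => a * u x + v x) = (a ^+ 2 * fine (heatQ s u) +
    a * (4 * kappa s / (2 * pi) ^+ d *
      \int[leb d]_xi (enorm xi `^ (2 * s) * fcross u v xi)) +
    fine (heatQ s v))%:E.
Proof.
move=> s01 Lu Lv Qu Qv.
have Lw := L12_lincomb a Lu Lv.
have Qw : (heatQ s (fun x => (a * u x + v x)%R) < +oo)%E.
  apply: (le_lt_trans (heatQ_lincomb_le a s (L12_measurable Lu) (L12_measurable Lv))).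
  by rewrite -(fineK (heatQ_fin Qu)) -(fineK (heatQ_fin Qv)) -!EFinM -EFinD ltry.
rewrite (heatQ_spectralR s01 Lw Qw) (heatQ_spectralR s01 Lu Qu) (heatQ_spectralR s01 Lv Qv) /=.
have iu := integrable_spectral s01 Lu Qu.
have iv := integrable_spectral s01 Lv Qv.
have iuv := integrable_cross s01 Lu Lv Qu Qv.
have E xi : enorm xi `^ (2 * s) * fsq (fun x => a * u x + v x) xi =
   a ^+ 2 * (enorm xi `^ (2 * s) * fsq u xi) +
   2 * a * (enorm xi `^ (2 * s) * fcross u v xi) +
   enorm xi `^ (2 * s) * fsq v xi.
  rewrite /fsq /fcross fcos_lincomb// fsin_lincomb//; ring.
under eq_Rintegral do rewrite E.
have j1 := integrableZl measurableT (a ^+ 2) iu.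
have j2 := integrableZl measurableT (2 * a) iuv.
have j12 := integrableD measurableT j1 j2.
rewrite RintegralD// RintegralD// RintegralZl// RintegralZl//.
by congr EFin; ring.
Qed.

End integrals.
End cross.

(** * The weak formulation *)

Section fourier_transform.
Variable R : realType.
Notation mu := (@lebesgue_measure R).
Notation leb := (leb R).
Implicit Types s t r : R.

Section dim.
Variable d : nat.
Implicit Types (u v f : 'rV[R]_d -> R) (U : set 'rV[R]_d).

Lemma L2_measurable U u : L2 U u -> measurable_fun setT (u \_ U).
Proof. by rewrite /L2 inE => /andP[]; rewrite inE. Qed.

Lemma L2_integrable_sqr U u : L2 U u ->
  (leb d).-integrable setT (EFin \o (fun x => (u \_ U) x ^+ 2)).
Proof. exact: Lfun2_integrable_sqr. Qed.

Lemma L2TP u : L2 setT u <-> measurable_fun setT u /\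
  (\int[leb d]_x (u x ^+ 2)%:E < +oo)%E.
Proof.
split=> [Lu|[mu' u2]].
  have := L2_measurable Lu; have := L2_integrable_sqr Lu.
  rewrite patch_setT => /integrable_lty H mu'; split => //; exact: H.
rewrite /L2 patch_setT inE; apply/andP; split; rewrite inE//=.
rewrite /finite_norm unlock poweR_lty//.
under eq_integral do rewrite /= powR_mulrn// real_normK ?num_real//.
by [].
Qed.

Definition vanish_out r u := {ae leb d, forall z, ~ (enorm z < r) -> u z = 0}.

Lemma measurable_enorm_ball r : measurable [set z : 'rV[R]_d | enorm z < r].
Proof.
have m : measurable_fun setT (fun z : 'rV[R]_d => enorm z) by exact: measurable_enorm.
have := m measurableT `]-oo, r[%classic (measurable_itv _).
rewrite setTI; congr measurable; apply/seteqP; split => z /=; by rewrite in_itv.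
Qed.

Lemma coord_le_enorm (z : 'rV[R]_d) i : `|z ord0 i| <= enorm z.
Proof.
rewrite -sqrtr_sqr ler_wsqrtr// /dotv (bigD1 i)//= expr2 lerDl.
by apply: sumr_ge0 => j _; rewrite -expr2 sqr_ge0.
Qed.

Lemma enorm_ball_lty r : (leb d [set z | (enorm z < r)%R] < +oo)%E.
Proof.
have [r0|r0] := leP 0 r; last first.
  rewrite (_ : [set _ | _] = set0) ?measure0//.
  apply/seteqP; split => z //=; apply/negP; rewrite -leNgt.
  by rewrite (le_trans (ltW r0))// sqrtr_ge0.
apply: (@le_lt_trans _ _ (leb d (box (- r - 1) r))).
  apply: le_measure; rewrite ?inE; [exact: measurable_enorm_ball|exact: measurable_box|].
  move=> z /= zr i; rewrite in_itv/=.
  have := le_lt_trans (coord_le_enorm z i) zr.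
  by rewrite ltr_norml => /andP[h1 h2]; rewrite (ltW h2) andbT; lra.
by rewrite leb_box ?ltry//; lra.
Qed.

(** Almost everywhere [|u| <= u^2 + 1] on the ball and [u = 0] off it, and the ball has finite
    measure. *)
Lemma L12_of_L2 r u : L2 setT u -> vanish_out r u -> L12 u.
Proof.
move=> /L2TP[mu' u2] vu.
have iu2 : (leb d).-integrable setT (EFin \o (fun x => u x ^+ 2)).
  apply/integrableP; split.
    by apply/measurable_EFinP; exact: measurable_funX.
  by under eq_integral do rewrite /= ger0_norm ?sqr_ge0//.
split => //.
set A := [set z : 'rV[R]_d | enorm z < r].
have mA : measurable A by exact: measurable_enorm_ball.
have mnu : measurable_fun setT (fun x => `|u x|%:E).
  by apply/measurable_EFinP; exact: measurableT_comp.
have m2 : measurable_fun setT (fun x => ((u x) ^+ 2)%:E).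
  by apply/measurable_EFinP; exact: measurable_funX.
have m1 : measurable_fun setT (fun x => (\1_A x : R)%:E) by apply/measurable_EFinP.
apply/integrableP; split; first exact/measurable_EFinP.
apply: (@le_lt_trans _ _ (\int[leb d]_x ((u x ^+ 2)%:E + (\1_A x)%:E))%E).
  apply: ae_ge0_le_integral => //.
  - by move=> x _; rewrite -EFinD lee_fin addr_ge0 ?sqr_ge0.
  - exact: emeasurable_funD.
  case: vu => N [mN N0 sN]; exists N; split => // x /=.
  move=> h; apply: sN => /= hx; apply: h => _.
  rewrite -EFinD lee_fin; have [xA|xA] := boolP (x \in A).
    rewrite indicE xA /=.
    have := sqr_ge0 (`|u x| - 1); rewrite -(real_normK (num_real (u x))).
    have := normr_ge0 (u x); move: `|u x| => q; nra.
  rewrite hx ?normr0 ?addr_ge0 ?sqr_ge0//.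
  by move: xA; rewrite notin_setE.
rewrite ge0_integralD//.
  rewrite integral_indic// setIT; apply: lte_add_pinfty => //; exact: enorm_ball_lty.
by move=> x _; rewrite lee_fin sqr_ge0.
Qed.

Lemma coord_le_norm (z : 'rV[R]_d) i : `|z ord0 i| <= `|z|.
Proof.
rewrite /Num.norm/= mx_normrE.
exact: (le_bigmax _ (fun ij => `|z ij.1 ij.2|) (ord0, i)).
Qed.

Lemma enorm_le_coord M (z : 'rV[R]_d) : (forall i, `|z ord0 i| <= M) ->
  enorm z <= Num.sqrt (d%:R * M ^+ 2).
Proof.
move=> zM; rewrite ler_wsqrtr//.
rewrite -[X in X%:R]card_ord mulr_natl -sumr_const; apply: ler_sum => i _.
by rewrite -expr2 -real_normK ?num_real// lerXn2r ?nnegrE// (le_trans _ (zM i)).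
Qed.

Lemma closure_bounded U : bounded_set U ->
  exists r, 0 < r /\ (forall z, closure U z -> enorm z < r).
Proof.
move=> [M [_ HM]].
pose K := M + 1; have UK x : U x -> `|x| <= K.
  by apply: HM; rewrite /K ltrDl.
(* The unit inside the square covers the distance from a point of the closure to [U], the last one
   makes the inequality strict; the square root passes from the sup norm to the Euclidean norm. *)
exists (Num.sqrt (d%:R * (K + 1) ^+ 2) + 1); split.
  by rewrite ltr_wpDl// sqrtr_ge0.
move=> z cz; rewrite (@le_lt_trans _ _ (Num.sqrt (d%:R * (K + 1) ^+ 2)))//; last first.
  by rewrite ltrDl.
apply: enorm_le_coord => i.
have [y [Uy zy]] := cz _ (nbhsx_ballx z 1 ltr01).
have := zy.2 ord0 i; rewrite -ball_normE/= => h.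
rewrite -(subrK (y ord0 i) (z ord0 i)) (le_trans (ler_normD _ _))// addrC lerD//.
  exact: le_trans (coord_le_norm y i) (UK _ Uy).
exact: ltW.
Qed.

Definition ft u xi : R[i] := ((2 * pi) `^ (- (d%:R / 2)))%:C%C *
  (fcos u xi -i* fsin u xi)%C.

(** Once the ball contains the support, truncation changes nothing: the limit that defines [fourier]
    is taken along an eventually constant family. *)
Lemma fourier_truncE r0 r u xi : (leb d).-integrable setT (EFin \o u) ->
  vanish_out r0 u -> r0 <= r -> fourier_trunc r u xi = ft u xi.
Proof.
move=> iu vu r0r; rewrite /fourier_trunc /ft /cintegral; congr (_ * _).
have mu' : measurable_fun setT u by apply/measurable_EFinP; exact: measurable_int iu.
set A := [set z : 'rV[R]_d | enorm z < r].
have mA : measurable A by exact: measurable_enorm_ball.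
have trunc (w : R -> R) : measurable_fun setT w ->
    \int[leb d]_(x in A) (u x * w (dotv x xi)) = \int[leb d]_x (u x * w (dotv x xi)).
  move=> mw.
  have mwd : measurable_fun setT (fun x : 'rV[R]_d => w (dotv x xi)).
    by apply: (measurableT_comp mw); exact: measurable_dotv.
  have muw : measurable_fun setT (fun x => (u x * w (dotv x xi))%:E).
    by apply/measurable_EFinP; exact: measurable_funM.
  rewrite /Rintegral integral_mkcond; congr fine.
  apply: ae_eq_integral => //.
    by apply: (measurable_restrictT _ _).1 => //; exact: measurable_funTS.
  case: vu => N [mN N0 sN]; exists N; split => // x /= h; apply: sN => /= hx.
  apply: h => _; rewrite patchE; case: ifPn => //.
  rewrite notin_setE /A/= => nx; rewrite hx ?mul0r// => h.
  by apply: nx; exact: lt_le_trans r0r.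
congr (_ +i* _)%C.
  rewrite /fcos -trunc; last first.
    by apply: continuous_measurable_fun; exact: continuous_cos.
  by apply: eq_Rintegral => x _ /=; rewrite mul0r subr0.
rewrite /fsin -mulN1r -RintegralZl//; last first.
  apply: integrable_bounded_mul => //.
    have ms : measurable_fun setT (@sin R).
      by apply: continuous_measurable_fun; exact: continuous_sin.
    by apply: (measurableT_comp ms); exact: measurable_dotv.
  by move=> x; rewrite ler_norml sin_geN1 sin_le1.
under [RHS]eq_Rintegral do rewrite mulN1r -mulrN.
rewrite -(trunc (fun y => - sin y)).
  by apply: eq_Rintegral => x _ /=; rewrite mul0r addr0.
apply: measurableT_comp => //.
by apply: continuous_measurable_fun; exact: continuous_sin.
Qed.

Let c := ((2 * pi) `^ (- (d%:R / 2))) : R.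

Lemma Re_ft u xi : complex.Re (ft u xi) = c * fcos u xi.
Proof. by rewrite /ft/= mul0r subr0. Qed.

Lemma Im_ft u xi : complex.Im (ft u xi) = - (c * fsin u xi).
Proof. by rewrite /ft/= mul0r addr0 mulrN. Qed.

Lemma measurable_Re_ft u : (leb d).-integrable setT (EFin \o u) ->
  measurable_fun setT (fun xi => complex.Re (ft u xi)).
Proof.
move=> iu; under eq_fun do rewrite Re_ft.
by apply: measurable_funM => //; exact: measurable_fcos.
Qed.

Lemma measurable_Im_ft u : (leb d).-integrable setT (EFin \o u) ->
  measurable_fun setT (fun xi => complex.Im (ft u xi)).
Proof.
move=> iu; under eq_fun do rewrite Im_ft.
apply: measurableT_comp => //.
by apply: measurable_funM => //; exact: measurable_fsin.
Qed.

(** [ft u] has the property that defines the Fourier transform, so the value chosen by [xget] has it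
    too, and the two are at L2 distance zero. *)
Lemma fourier_ae r0 u : (leb d).-integrable setT (EFin \o u) -> vanish_out r0 u ->
  [/\ measurable_fun setT (fun xi => complex.Re (fourier u xi)),
      measurable_fun setT (fun xi => complex.Im (fourier u xi)) &
      {ae leb d, forall xi, fourier u xi = ft u xi}].
Proof.
move=> iu vu.
have dist_trunc (w : 'rV[R]_d -> R[i]) : (\forall r \near +oo%R,
    (\int[leb d]_xi (complex.Re (w xi - fourier_trunc r u xi) ^+ 2 +
       complex.Im (w xi - fourier_trunc r u xi) ^+ 2)%:E =
    \int[leb d]_xi (complex.Re (w xi - ft u xi) ^+ 2 +
       complex.Im (w xi - ft u xi) ^+ 2)%:E)%E).
  exists r0; split; first exact: num_real.
  move=> r r0r; apply: eq_integral => xi _.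
  by rewrite (fourier_truncE xi iu vu (ltW r0r)).
have ex : is_fourier u (ft u).
  split; [exact: measurable_Re_ft|exact: measurable_Im_ft|].
  apply: cvg_near_cst; apply: filterS (dist_trunc (ft u)) => r ->.
  by apply: integral0_eq => xi _; rewrite subrr /= expr0n addr0.
have [mRe mIm cv] : is_fourier u (fourier u) by exact: (xgetPex _ (ex_intro _ _ ex)).
split => //.
set h := fun xi => (complex.Re (fourier u xi - ft u xi) ^+ 2 +
       complex.Im (fourier u xi - ft u xi) ^+ 2)%:E.
have I0 : (\int[leb d]_xi h xi = 0)%E.
  have cst : (\int[leb d]_xi
      (complex.Re (fourier u xi - fourier_trunc r u xi) ^+ 2 +
       complex.Im (fourier u xi - fourier_trunc r u xi) ^+ 2)%:E)%E @[r --> +oo%R] -->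
      (\int[leb d]_xi h xi)%E.
    exact: cvg_near_cst (dist_trunc _).
  exact: cvg_unique cst cv.
have h0 xi : (0 <= h xi)%E by rewrite lee_fin addr_ge0 ?sqr_ge0.
have mh : measurable_fun setT h.
  apply/measurable_EFinP; apply: measurable_funD; apply: measurable_funX.
    under eq_fun do rewrite raddfB.
    by apply: measurable_funB => //; exact: measurable_Re_ft.
  under eq_fun do rewrite raddfB.
  by apply: measurable_funB => //; exact: measurable_Im_ft.
have [H _] := ae_eq_integral_abs (leb d) measurableT mh.
have {H} [|N [mN N0 sN]] := H.
  by under eq_integral do rewrite gee0_abs//.
exists N; split => // xi /= ne; apply: sN => /= H; apply: ne.
have := H I; rewrite /h => -[] /eqP.
rewrite paddr_eq0 ?sqr_ge0// !sqrf_eq0 => /andP[/eqP re /eqP im].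
apply/eqP; rewrite -subr_eq0; apply/eqP.
by move: re im; case: (_ - _) => a b /= -> ->.
Qed.

End dim.
End fourier_transform.

(** * The singular kernel as a superposition of heat kernels, and the weak equation *)

Section weak_form.
Variable R : realType.
Notation mu := (@lebesgue_measure R).
Notation leb := (leb R).
Implicit Types s t r : R.

Lemma powR_invl (x p : R) : 0 < x -> x^-1 `^ p = (x `^ p)^-1.
Proof. by move=> x0; rewrite -(powR_inv1 (ltW x0)) -powRrM mulN1r powRN. Qed.

(** The heat kernel at a point of Euclidean norm one, as a function of time. *)
Definition heat_profile d (t : R) : R :=
  (Num.sqrt (4 * pi * t))^-1 ^+ d * expR (- (4 * t)^-1).

Lemma heat_profile_gt0 d t : 0 < t -> 0 < heat_profile d t.
Proof.
by move=> t0; rewrite mulr_gt0 ?expR_gt0// exprn_gt0// invr_gt0 sqrtr_gt0 !mulr_gt0 ?pi_gt0.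
Qed.

Lemma heat_profile_ge0 d t : 0 <= heat_profile d t.
Proof. by rewrite mulr_ge0 ?expR_ge0// exprn_ge0// invr_ge0. Qed.

Lemma measurable_heat_profile d : measurable_fun setT (heat_profile d).
Proof.
apply: measurable_funM.
  apply: measurable_funX; apply: (measurableT_comp (@measurable_invr R)).
  apply: (measurableT_comp (f := @Num.sqrt R)).
    by apply: continuous_measurable_fun; exact: sqrt_continuous.
  exact: measurable_funM.
apply: measurableT_comp => //; apply: measurableT_comp => //.
apply: (measurableT_comp (@measurable_invr R)).
exact: measurable_funM.
Qed.

Lemma heat_profileE d t (z : 'rV[R]_d) : 0 < dotv z z -> 0 < t ->
  heat t z = (enorm z)^-1 ^+ d * heat_profile d ((dotv z z)^-1 * t).
Proof.
move=> q0 t0; rewrite /heat /heat_profile /enorm mulrA -exprMn -invfM.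
have p0 : 0 < pi :> R := pi_gt0 R.
rewrite -sqrtrM ?ltW//; congr ((Num.sqrt _)^-1 ^+ d * expR (- _)).
  by move: p0 (pi : R) => _ p; field; exact: lt0r_neq0.
by field; rewrite ?lt0r_neq0.
Qed.

Definition kernel_const d s : R := fine (\int[mu]_t (tw s t * heat_profile d t)%:E).

(** In the variable [x = (4 t)^-1] the profile is at most [x^(d/2) expR (- x)], since [pi >= 1], and
    the exponential dominates every power. The exponent [p = 1] serves small times and [p = 0] large
    ones. *)
Lemma heat_profile_le d p : 0 <= p -> exists C : R,
  forall t, 0 < t -> heat_profile d t <= C * t `^ p.
Proof.
move=> p0; have h0 : 0 <= d%:R / 2 + p by rewrite addr_ge0// divr_ge0.
have [C [C0 HC]] := @exp_dominates_powR R _ h0.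
exists (C * 4 `^ p) => t t0.
have t40 : 0 < 4 * t by rewrite mulr_gt0.
have x0 : 0 < (4 * t)^-1 by rewrite invr_gt0.
have xp0 : 0 < (4 * t)^-1 `^ p by exact: powR_gt0.
have -> : C * 4 `^ p * t `^ p = C / (4 * t)^-1 `^ p.
  by rewrite -mulrA -powRM ?(ltW t0)// powR_invl// invrK.
rewrite ler_pdivlMr// (le_trans _ (HC _ x0))// powRD ?(gt_eqF x0) ?implybT//.
rewrite mulrAC ler_wpM2r ?expR_ge0//.
rewrite ler_wpM2r ?powR_ge0//.
have -> : (4 * t)^-1 `^ (d%:R / 2) = (Num.sqrt (4 * t))^-1 ^+ d.
  rewrite -sqrtrV; last exact: ltW.
  by rewrite -powR_mulrn ?sqrtr_ge0// -powR12_sqrt ?(ltW x0)// -powRrM [2^-1 * _]mulrC.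
rewrite lerXn2r ?nnegrE ?invr_ge0 ?sqrtr_ge0//.
have p1 : 1 <= pi :> R by apply: le_trans (pi_ge2 R); rewrite ler1n.
rewrite lef_pV2 ?posrE ?sqrtr_gt0 ?mulr_gt0 ?pi_gt0// ler_wsqrtr// -mulrA ler_wpM2l//.
by rewrite ler_peMl// ltW.
Qed.

Lemma kernel_const_lty d s : 0 < s < 1 ->
  (\int[mu]_t (tw s t * heat_profile d t)%:E < +oo)%E.
Proof.
move=> /andP[s0 s1].
have [C1 H1] := @heat_profile_le d 1 ler01; have [C0 H0] := @heat_profile_le d 0 (lexx _).
apply: (@integral_tw_lty R s (heat_profile d) (Num.max C1 C0) 1 0) => //.
- exact: measurable_heat_profile.
- by move=> t _; exact: heat_profile_ge0.
- move=> t /andP[t0 _]; rewrite (le_trans (H1 t t0))// ler_wpM2r ?powR_ge0//.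
  by rewrite le_max lexx.
- move=> t t1; rewrite (le_trans (H0 t (lt_le_trans ltr01 t1)))// ler_wpM2r ?powR_ge0//.
  by rewrite le_max lexx orbT.
Qed.

Lemma kernel_const_gt0 d s : 0 < s < 1 -> 0 < kernel_const d s.
Proof.
move=> s01; rewrite fine_gt0// kernel_const_lty// andbT.
apply: integral_tw_gt0; first exact: measurable_heat_profile.
exact: heat_profile_gt0.
Qed.

(** Parabolic scaling reduces [z] to norm one. The factor [|z|^-d] comes from the kernel and
    [|z|^(-2s)] from the weight. *)
Lemma integral_tw_heat d s (z : 'rV[R]_d) : 0 < s < 1 -> 0 < dotv z z ->
  (\int[mu]_t (tw s t * heat t z)%:E =
   (kernel_const d s / enorm z `^ (d%:R + 2 * s))%:E)%E.
Proof.
move=> s01 z0; have e0 : 0 < enorm z by rewrite sqrtr_gt0.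
have q0 : 0 < (dotv z z)^-1 by rewrite invr_gt0.
have mg := @measurable_heat_profile d.
have kE : (kernel_const d s)%:E = (\int[mu]_t ((tw s t)%:E * (heat_profile d t)%:E))%E.
  rewrite fineK; first by apply: eq_integral => t _; rewrite EFinM.
  rewrite ge0_fin_numE ?kernel_const_lty//; apply: integral_ge0 => t _.
  by rewrite lee_fin mulr_ge0 ?tw_ge0 ?heat_profile_ge0.
transitivity (((enorm z)^-1 ^+ d)%:E *
    \int[mu]_t ((tw s t)%:E * (heat_profile d ((dotv z z)^-1 * t))%:E))%E.
  rewrite -ge0_integralZl_EFin//.
  - apply: eq_integral => t _; have [t0|t0] := leP t 0.
      by rewrite tw_le0E// !mul0r mul0e mule0.
    by rewrite heat_profileE// -!EFinM; congr EFin; ring.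
  - by move=> t _; rewrite lee_fin mulr_ge0 ?tw_ge0 ?heat_profile_ge0.
  - apply/measurable_EFinP; apply: measurable_funM; first exact: measurable_tw.
    by apply: (measurableT_comp mg); exact: measurable_funM.
  - by rewrite exprn_ge0// invr_ge0 ltW.
rewrite (@integral_tw_scale R s _ (fun t => (heat_profile d t)%:E))//; last 2 first.
- exact/measurable_EFinP.
- by move=> t; rewrite lee_fin heat_profile_ge0.
rewrite -kE -!EFinM; congr EFin.
rewrite [LHS]mulrA mulrC; congr (_ * _).
rewrite powRD ?(gt_eqF e0) ?implybT// invfM powR_mulrn ?ltW// exprVn; congr (_ * _).
rewrite powRrM powR_mulrn ?ltW// /enorm sqr_sqrtr ?ltW//.
by rewrite powR_invl.
Qed.

(** Tonelli's theorem and [integral_tw_heat]. The value of [c] never enters, only its sign, so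
    neither [frac_const] nor [kernel_const] has to be computed. *)
Lemma energyE d s : 0 < s < 1 -> exists c : R, 0 < c /\
  forall u : 'rV[R]_d -> R, measurable_fun setT u -> energy s u = (c%:E * heatQ s u)%E.
Proof.
move=> s01; have K0 := kernel_const_gt0 d s01.
have f0 := @frac_const_gt0 R d s s01.
exists (frac_const d s / 2 / kernel_const d s); split.
  by rewrite !divr_gt0.
move=> u mu'.
have mxy : measurable_fun setT (fun p : 'rV[R]_d * 'rV[R]_d => p.1 - p.2).
  exact: measurable_rVB.
have mu2 : measurable_fun setT (fun p : 'rV[R]_d * 'rV[R]_d => (u p.1 - u p.2) ^+ 2).
  by apply: measurable_funX; apply: measurable_funB; exact: measurableT_comp.
pose G (x y : 'rV[R]_d) := ((u x - u y) ^+ 2 / enorm (x - y) `^ (d%:R + 2 * s))%:E.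
have G0 x y : (0 <= G x y)%E by rewrite lee_fin divr_ge0 ?sqr_ge0 ?powR_ge0.
have mG : measurable_fun setT (fun p : 'rV[R]_d * 'rV[R]_d => G p.1 p.2).
  apply/measurable_EFinP; apply: measurable_funM => //.
  apply: (measurableT_comp (@measurable_invr R)).
  by apply: (measurableT_comp (@measurable_enorm_powR R d _)).
have -> : heatQ s u = ((kernel_const d s)%:E * \int[leb d]_x \int[leb d]_y G x y)%E.
  pose F t (x y : 'rV[R]_d) := (tw s t * ((u x - u y) ^+ 2 * heat t (x - y)))%:E.
  have F0 t x y : (0 <= F t x y)%E.
    by rewrite lee_fin mulr_ge0 ?tw_ge0// mulr_ge0 ?sqr_ge0 ?heat_ge0.
  have mF : measurable_fun setT
      (fun p : measurableTypeR R * 'rV[R]_d * 'rV[R]_d => F p.1.1 p.1.2 p.2).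
    have m2 : measurable_fun setT (fun p : measurableTypeR R * 'rV[R]_d * 'rV[R]_d =>
       (p.1.2, p.2)).
      by apply: measurable_fun_pair => //; exact: measurableT_comp.
    have m1 : measurable_fun setT (fun p : measurableTypeR R * 'rV[R]_d * 'rV[R]_d =>
       p.1.1) by exact: measurableT_comp.
    apply/measurable_EFinP; apply: measurable_funM.
      exact: (measurableT_comp (measurable_tw s) m1).
    apply: measurable_funM; first exact: (measurableT_comp mu2 m2).
    by apply: measurable_heat => //; exact: (measurableT_comp mxy m2).
  transitivity (\int[mu]_t \int[leb d]_x \int[leb d]_y F t x y)%E.
    rewrite heatQ.unlock; apply: eq_integral => t _; rewrite heatD.unlock.
    by rewrite -(iteratedZ (leb d) (leb d) (measurable_heat_pair t mu' mu')
      (heat_pair_ge0 t u u) (tw_ge0 s t)).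
  rewrite (@tonelli_swap _ _ _ _ _ mu (leb d) (fun t x => \int[leb d]_y F t x y)%E); last 2 first.
  - exact: (measurable_leb_integral2 (F := fun p y => F p.1 p.2 y)).
  - by move=> t x; exact: integral_ge0.
  rewrite -ge0_integralZl_EFin ?ltW//; last 2 first.
  - by move=> x _; exact: integral_ge0.
  - exact: measurable_leb_integral2.
  apply: eq_integral => x _.
  rewrite (@tonelli_swap _ _ _ _ _ mu (leb d) (fun t y => F t x y)) //; last first.
    have m3 : measurable_fun setT (fun p : measurableTypeR R * 'rV[R]_d => (p.1, x, p.2)).
      by apply: measurable_fun_pair => //; exact: measurable_fun_pair.
    exact: (measurableT_comp mF m3).
  have mGx : measurable_fun setT (G x).
    exact: (measurableT_comp mG (@pair1_measurable _ _ _ _ x)).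
  rewrite -(ge0_integralZl_EFin (leb d) measurableT (fun y _ => G0 x y) mGx (ltW K0)).
  apply: eq_integral => y _.
  (* On the diagonal [(u x - u y)^2] vanishes on both sides, whatever the kernels are worth
     there. *)
  have [z0|z0] := ltP 0 (dotv (x - y) (x - y)); last first.
    have : dotv (x - y) (x - y) == 0 by rewrite eq_le z0 dotv_ge0.
    rewrite dotv_eq0 subr_eq0 => /eqP ->; rewrite /G subrr expr0n !mul0r mule0.
    by apply: integral0_eq => t _; rewrite /F subrr expr0n mul0r mulr0.
  transitivity ((\int[mu]_t ((((u x - u y) ^+ 2)%:E) * (tw s t * heat t (x - y))%:E))%E).
    by apply: eq_integral => t _; rewrite /F -EFinM mulrCA.
  rewrite ge0_integralZl_EFin ?sqr_ge0//; last 2 first.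
  - by move=> t _; rewrite lee_fin mulr_ge0 ?tw_ge0 ?heat_ge0.
  - apply/measurable_EFinP; apply: measurable_funM; first exact: measurable_tw.
    exact: measurable_heat.
  by rewrite integral_tw_heat// /G -!EFinM; congr EFin; ring.
rewrite muleA -EFinM divfK ?gt_eqF// /energy; congr (_ * _)%E.
by rewrite (@fubini_tonelli1 _ _ _ _ _ (leb d) (leb d) (fun p => G p.1 p.2)).
Qed.

Lemma Re_mul_conj r (a b : R[i]) : complex.Re (r%:C%C * a * b^*%C) =
  r * (complex.Re a * complex.Re b + complex.Im a * complex.Im b).
Proof. by case: a b => a1 a2 [b1 b2] /=; ring. Qed.

Lemma Htilde_heatQ d s U (v : 'rV[R]_d -> R) : 0 < s < 1 -> Htilde s U v ->
  (heatQ s v < +oo)%E.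
Proof.
move=> s01 [[/L2TP[mv _] Ev] _]; have [c [c0 cE]] := energyE d s01.
move: Ev; rewrite cE// !ltey; apply: contra => /eqP ->.
by rewrite gt0_muley// lte_fin.
Qed.

Lemma Htilde_L12 d s U (v : 'rV[R]_d -> R) : bounded_set U -> Htilde s U v ->
  L12 v /\ exists r, vanish_out r v.
Proof.
move=> bU [[Lv _] [N [mN N0 sN]]]; have [r [_ Ur]] := closure_bounded bU.
have vv : vanish_out r v.
  exists N; split => // z /= h.
  by apply: sN => /= h2; apply: h => nz; apply: h2 => cz; apply: nz; exact: Ur.
by split; [exact: L12_of_L2 vv|exists r].
Qed.

(** The real part of the weak equation, with [fourier] replaced almost everywhere by Fourier
    integrals; their two normalizations [(2 pi)^(-d/2)] multiply to [(2 pi)^(-d)]. *)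
Lemma weak_cross d s U (f u phi : 'rV[R]_d -> R) : 0 < s < 1 -> bounded_set U ->
  weak_solution s U f u -> Htilde s U phi ->
  ((2 * pi) ^+ d)^-1 * \int[leb d]_xi (enorm xi `^ (2 * s) * fcross u phi xi) =
  \int[leb d]_(z in U) (f z * phi z).
Proof.
move=> s01 bU [Hu weak] Hphi.
have [Lu [ru vu]] := Htilde_L12 bU Hu; have [Lp [rp vp]] := Htilde_L12 bU Hphi.
have [mRu mIu [N [mN N0 sN]]] := fourier_ae Lu.1 vu.
have [mRp mIp [M [mM M0 sM]]] := fourier_ae Lp.1 vp.
have mcross : measurable_fun setT (fun xi => enorm xi `^ (2 * s) * fcross u phi xi).
  apply: measurable_funM; first exact: measurable_enorm_powR.
  by apply: measurable_funD; apply: measurable_funM;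
    (exact: (measurable_fcos Lu.1) || exact: (measurable_fcos Lp.1) ||
     exact: (measurable_fsin Lu.1) || exact: (measurable_fsin Lp.1)).
have p0 : 0 < pi :> R := pi_gt0 R.
have c2 : ((2 * pi) `^ (- (d%:R / 2))) ^+ 2 = ((2 * pi) ^+ d)^-1 :> R.
  rewrite -powR_mulrn ?powR_ge0// -powRrM mulNr divfK ?pnatr_eq0//.
  by rewrite powRN powR_mulrn// mulr_ge0// ltW.
have icross := integrable_cross s01 Lu Lp (Htilde_heatQ s01 Hu) (Htilde_heatQ s01 Hphi).
have WR : \int[leb d]_xi (complex.Re ((enorm xi `^ (2 * s))%:C%C * fourier u xi *
    (fourier phi xi)^*%C)) = \int[leb d]_(z in U) (f z * phi z).
  exact: (congr1 (@complex.Re R) (weak _ Hphi)).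
rewrite -WR -RintegralZl// /Rintegral; congr fine.
apply: ae_eq_integral => //.
- apply/measurable_EFinP; exact: measurable_funM (measurable_cst _) mcross.
- apply/measurable_EFinP; under eq_fun do rewrite Re_mul_conj.
  apply: measurable_funM; first exact: measurable_enorm_powR.
  exact: (measurable_funD (measurable_funM mRu mRp) (measurable_funM mIu mIp)).
exists (N `|` M); split; [exact: measurableU|by rewrite measureU0|].
move=> xi /=; apply: contra_notP => /not_orP[nN nM] _.
have /contrapT uE : ~ ~ (fourier u xi = ft u xi) by move=> h; apply: nN; exact: sN.
have /contrapT pE : ~ ~ (fourier phi xi = ft phi xi) by move=> h; apply: nM; exact: sM.
rewrite Re_mul_conj uE pE !Re_ft !Im_ft -c2 /fcross; congr EFin; ring.
Qed.

(** The form in which both equations are used: the energy is expanded around a solution and the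
    source replaces the cross term. Since [heatQ] is [2 kappa s] times the spectral energy, twice
    the bilinear form becomes the factor [4 * kappa s]. *)
Lemma heatQ_weak d s U (f u phi : 'rV[R]_d -> R) a : 0 < s < 1 -> bounded_set U ->
  weak_solution s U f u -> Htilde s U phi ->
  heatQ s (fun x => a * u x + phi x) = (a ^+ 2 * fine (heatQ s u) +
    4 * kappa s * a * \int[leb d]_(z in U) (f z * phi z) + fine (heatQ s phi))%:E.
Proof.
move=> s01 bU wu Hphi; have Hu := wu.1.
have [Lu _] := Htilde_L12 bU Hu; have [Lp _] := Htilde_L12 bU Hphi.
rewrite heatQ_lincombE//; [|exact: Htilde_heatQ Hu|exact: Htilde_heatQ Hphi].
rewrite -(weak_cross s01 bU wu Hphi); congr EFin; ring.
Qed.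
End weak_form.

(** * Energies of slices *)

(** The interaction of two slices of one function, taken at different values of t; equal slices give
    back [heatD]. *)
HB.lock Definition heatC (R : realType) (d : nat) (t : R) (u v : 'rV[R]_d -> R) : \bar R :=
  (\int[leb R d]_x \int[leb R d]_y ((u x - v y) ^+ 2 * heat t (x - y))%:E)%E.

Section slices.
Variable R : realType.
Notation mu := (@lebesgue_measure R).
Notation leb := (leb R).
Implicit Types s r : R.

Lemma heatCC d r (u : 'rV[R]_d -> R) : heatC r u u = heatD r u.
Proof. by rewrite heatC.unlock heatD.unlock. Qed.

Lemma heatC_ge0 d r (u v : 'rV[R]_d -> R) : (0 <= heatC r u v)%E.
Proof.
by rewrite heatC.unlock; apply: integral_ge0 => x _; apply: integral_ge0 => y _;
  rewrite lee_fin mulr_ge0 ?sqr_ge0 ?heat_ge0.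
Qed.

Lemma measurable_heatC_param d dT (T : measurableType dT) r
    (u v : T -> 'rV[R]_d -> R) :
  measurable_fun setT (fun p : T * 'rV[R]_d => u p.1 p.2) ->
  measurable_fun setT (fun p : T * 'rV[R]_d => v p.1 p.2) ->
  measurable_fun setT (fun w => heatC r (u w) (v w)).
Proof.
move=> mu' mv; under eq_fun do rewrite heatC.unlock.
apply: (@measurable_leb_integral2 _ _ _ d
   (fun w x => \int[leb d]_y ((u w x - v w y) ^+ 2 * heat r (x - y))%:E)%E).
  apply: (@measurable_leb_integral2 _ _ _ d
    (fun (p : T * 'rV[R]_d) y =>
       ((u p.1 p.2 - v p.1 y) ^+ 2 * heat r (p.2 - y))%:E)%E).
    have m1 : measurable_fun setT (fun q : T * 'rV[R]_d * 'rV[R]_d => (q.1.1, q.2)).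
      by apply: measurable_fun_pair => //; exact: measurableT_comp.
    apply/measurable_EFinP; apply: measurable_funM.
      apply: measurable_funX; apply: measurable_funB.
        exact: (measurableT_comp mu' measurable_fst).
      exact: (measurableT_comp mv m1).
    apply: measurable_heat => //.
    by apply: measurable_rVB => //; exact: measurableT_comp.
  by move=> p y; rewrite lee_fin mulr_ge0 ?sqr_ge0 ?heat_ge0.
by move=> w x; apply: integral_ge0 => y _; rewrite lee_fin mulr_ge0 ?sqr_ge0 ?heat_ge0.
Qed.

Section quadrilateral.
Variable d : nat.
Implicit Types (a b c : 'rV[R]_d -> R).

Let mK := @measurable_heat_pair R d.
Let K0 := @heat_pair_ge0 R d.

(** The kernel has mass one. Squared L2 norms thus become instances of [heatC], so that inequalities
    mixing norms and energies can be checked under the integral sign. *)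
Lemma heatC0r r c : 0 < r -> measurable_fun setT c ->
  heatC r c (fun=> 0) = (\int[leb d]_x (c x ^+ 2)%:E)%E.
Proof.
move=> r0 mc; rewrite heatC.unlock; apply: eq_integral => x _.
under eq_integral do rewrite subr0 EFinM.
rewrite ge0_integralZl_EFin ?sqr_ge0//; last 2 first.
- by move=> y _; rewrite lee_fin heat_ge0.
- by apply/measurable_EFinP; apply: measurable_heat => //; exact: measurable_rVB.
by rewrite integral_heat// mule1.
Qed.

Lemma heatC0l r c : 0 < r -> measurable_fun setT c ->
  heatC r (fun=> 0) c = (\int[leb d]_x (c x ^+ 2)%:E)%E.
Proof.
move=> r0 mc; rewrite -(heatC0r r0 mc) !heatC.unlock.
have swap := @tonelli_swap _ _ _ _ _ (leb d) (leb d)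
  (fun x y => ((0 - c y) ^+ 2 * heat r (x - y))%:E)
  (mK r (measurable_cst (0 : measurableTypeR R)) mc) (K0 r (fun=> 0) c).
rewrite [LHS]swap.
apply: eq_integral => x _; apply: eq_integral => y _.
by rewrite sub0r subr0 sqrrN -heatN opprB.
Qed.

(** The integrand of a finite sum of [heatC] terms, without the kernel. Through [le_heatC_sum], an
    inequality between such sums reduces to a polynomial inequality at a pair of points, and no
    finiteness is involved. *)
Definition sqsum (ps : seq (('rV[R]_d -> R) * ('rV[R]_d -> R))) (x y : 'rV[R]_d) : R :=
  \sum_(p <- ps) (p.1 x - p.2 y) ^+ 2.

Definition measurable_pairs (ps : seq (('rV[R]_d -> R) * ('rV[R]_d -> R))) :=
  foldr (fun p P => [/\ measurable_fun setT p.1, measurable_fun setT p.2 & P]) True ps.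

Lemma measurable_sqsum r ps : measurable_pairs ps ->
  measurable_fun setT (fun p : 'rV[R]_d * 'rV[R]_d =>
     (sqsum ps p.1 p.2 * heat r (p.1 - p.2))%:E).
Proof.
elim: ps => [_|[f g] ps IH /= [mf mg /IH ms]].
  by under eq_fun do rewrite /sqsum big_nil mul0r; exact: measurable_cst.
under eq_fun do rewrite /sqsum big_cons mulrDl EFinD.
by apply: emeasurable_funD; [exact: mK|exact: ms].
Qed.

Definition sqsum_ge0 r ps x y : (0 <= (sqsum ps x y * heat r (x - y))%:E)%E.
Proof. by rewrite lee_fin mulr_ge0 ?heat_ge0// sumr_ge0// => p _; exact: sqr_ge0. Qed.

Lemma heatC_sum r ps : measurable_pairs ps ->
  (\sum_(p <- ps) heatC r p.1 p.2 =
   \int[leb d]_x \int[leb d]_y (sqsum ps x y * heat r (x - y))%:E)%E.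
Proof.
elim: ps => [_|[f g] ps IH /= [mf mg ms]].
  rewrite big_nil integral0_eq// => x _; rewrite integral0_eq// => y _.
  by rewrite /sqsum big_nil mul0r.
rewrite big_cons /= IH// heatC.unlock.
rewrite -(iteratedD _ _ (mK r mf mg) (measurable_sqsum r ms) (K0 r f g) (sqsum_ge0 r ps)).
apply: eq_integral => x _; apply: eq_integral => y _.
by rewrite /sqsum big_cons mulrDl EFinD.
Qed.

Lemma le_heatC_sum r ps1 ps2 : measurable_pairs ps1 -> measurable_pairs ps2 ->
  (forall x y, sqsum ps1 x y <= sqsum ps2 x y) ->
  (\sum_(p <- ps1) heatC r p.1 p.2 <= \sum_(p <- ps2) heatC r p.1 p.2)%E.
Proof.
move=> m1 m2 le12; rewrite !heatC_sum//.
apply: (le_iterated _ _ (measurable_sqsum r m1) (measurable_sqsum r m2) (sqsum_ge0 r ps1)).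
by move=> x y; rewrite lee_fin ler_wpM2r ?heat_ge0.
Qed.

Let m0 : measurable_fun setT (fun _ : 'rV[R]_d => 0 : measurableTypeR R).
Proof. exact: measurable_cst. Qed.

(* With v = a - b, both sides differ by the double integral of
   2 v x v y heat r (x - y), which is nonnegative. *)
Lemma heatC_quad_ge r a b : 0 < r -> L12 a -> L12 b ->
  (heatD r a + heatD r b <= heatC r a b + heatC r b a)%E.
Proof.
move=> r0 La Lb; have ma := L12_measurable La; have mb := L12_measurable Lb.
pose v x := - 1 * b x + a x.
have Lv : L12 v by exact: L12_lincomb.
have mv := L12_measurable Lv.
set I := (\int[leb d]_x (v x ^+ 2)%:E)%E.
have Nfin : I \is a fin_num by apply: integrable_fin_num => //; exact: Lv.2.
have Dv : (heatD r v <= I + I)%E.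
  rewrite (heatDE Lv.1 Lv.2 r0) -(fineK Nfin) -EFinD lee_fin.
  have := heatA_ge0 Lv.1 r0; rewrite /I /Rintegral.
  by move: (fine _) (heatA _ _) => p q; lra.
have E : (heatD r a + heatD r b + (I + I) <=
   heatC r a b + heatC r b a + heatD r v)%E.
  have := @le_heatC_sum r [:: (a, a); (b, b); (v, fun=> 0); (fun=> 0, v)]
    [:: (a, b); (b, a); (v, v)].
  rewrite !big_cons !big_nil /= !adde0 (heatC0r r0 mv) (heatC0l r0 mv) !heatCC -!addeA.
  apply=> // x y; rewrite /sqsum !big_cons !big_nil /= /v -subr_ge0.
  by rewrite [leRHS](_ : _ = 0)//; ring.
have := le_trans E (leeD2l _ Dv).
by rewrite leeD2rE// fin_numD Nfin.
Qed.

(** Pointwise, with [v = a - b], the excess of the left side over the two energies is [2 v x v y],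
    at most [(v x)^2 + (v y)^2]; the difference is the square used at the end. *)
Lemma heatC_quad_le r a b : 0 < r -> measurable_fun setT a -> measurable_fun setT b ->
  (heatC r a b + heatC r b a <= heatD r a + heatD r b +
    2%:E * \int[leb d]_x ((a x - b x) ^+ 2)%:E)%E.
Proof.
move=> r0 ma mb; pose v x := a x - b x.
have mv : measurable_fun setT v by exact: measurable_funB.
have -> : (2%:E * \int[leb d]_x ((a x - b x) ^+ 2)%:E =
   heatC r v (fun=> 0%R) + heatC r (fun=> 0%R) v)%E.
  by rewrite mule_natl mule2n (heatC0r r0 mv) (heatC0l r0 mv).
have := @le_heatC_sum r [:: (a, b); (b, a)]
  [:: (a, a); (b, b); (v, fun=> 0); (fun=> 0, v)].
rewrite !big_cons !big_nil /= !adde0 !heatCC -!addeA.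
apply=> // x y; rewrite /sqsum !big_cons !big_nil /= /v.
have := sqr_ge0 (a x - a y - b x + b y); nra.
Qed.

End quadrilateral.
End slices.

Section iterated_more.
Variable R : realType.
Notation mu := (@lebesgue_measure R).
Notation leb := (leb R).
Implicit Types s r : R.

Lemma heat_convl k r (g : 'rV[R]_k -> \bar R) : 0 < r -> measurable_fun setT g ->
  (forall t, 0 <= g t)%E ->
  (\int[leb k]_t \int[leb k]_t' ((heat r (t - t'))%:E * g t) = \int[leb k]_t g t)%E.
Proof.
move=> r0 mg g0; apply: eq_integral => t _.
rewrite ge0_integralZr//; last 2 first.
- by apply/measurable_EFinP; apply: measurable_heat => //; exact: measurable_rVB.
- by move=> y _; rewrite lee_fin heat_ge0.
by rewrite integral_heat// mul1e.
Qed.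

Lemma measurable_heatB k r : measurable_fun setT (fun p : 'rV[R]_k * 'rV[R]_k => (heat r (p.1 - p.2))%:E).
Proof. by apply/measurable_EFinP; apply: measurable_heat => //; exact: measurable_rVB. Qed.

Lemma heat_conv_swap k r (g : 'rV[R]_k -> 'rV[R]_k -> \bar R) :
  measurable_fun setT (fun p : 'rV[R]_k * 'rV[R]_k => g p.1 p.2) ->
  (forall t t', 0 <= g t t')%E ->
  (\int[leb k]_t \int[leb k]_t' ((heat r (t - t'))%:E * g t' t) =
   \int[leb k]_t \int[leb k]_t' ((heat r (t - t'))%:E * g t t'))%E.
Proof.
move=> mg g0.
have m1 : measurable_fun setT (fun p : 'rV[R]_k * 'rV[R]_k =>
    (heat r (p.1 - p.2))%:E * g p.1 p.2)%E.
  exact: emeasurable_funM (@measurable_heatB k r) mg.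
rewrite [RHS](@tonelli_swap _ _ _ _ _ (leb k) (leb k)
  (fun t t' => (heat r (t - t'))%:E * g t t')%E m1); last first.
  by move=> t t'; rewrite mule_ge0// lee_fin heat_ge0.
by apply: eq_integral => t _; apply: eq_integral => t' _; rewrite -heatN opprB.
Qed.

(** Three exchanges bring the pair of slices outside and the pair of points inside. *)
Lemma tonelli4 n k (F : 'rV[R]_n -> 'rV[R]_k -> 'rV[R]_n -> 'rV[R]_k -> \bar R) :
  measurable_fun setT (fun p : ('rV[R]_n * 'rV[R]_k) * ('rV[R]_n * 'rV[R]_k) =>
    F p.1.1 p.1.2 p.2.1 p.2.2) ->
  (forall x t y t', 0 <= F x t y t')%E ->
  (\int[leb n]_x \int[leb k]_t \int[leb n]_y \int[leb k]_t' F x t y t' =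
   \int[leb k]_t \int[leb k]_t' \int[leb n]_x \int[leb n]_y F x t y t')%E.
Proof.
move=> mF F0.
transitivity (\int[leb n]_x \int[leb k]_t \int[leb k]_t' \int[leb n]_y F x t y t')%E.
  apply: eq_integral => x _; apply: eq_integral => t _.
  apply: (@tonelli_swap _ _ _ _ _ (leb n) (leb k) (fun y t' => F x t y t')) => //.
  exact: (measurableT_comp mF (@pair1_measurable _ _ _ _ (x, t))).
have mH : measurable_fun setT (fun q : 'rV[R]_n * 'rV[R]_k * 'rV[R]_k =>
    \int[leb n]_y F q.1.1 q.1.2 y q.2)%E.
  apply: (@measurable_leb_integral2 _ _ _ n (fun q y => F q.1.1 q.1.2 y q.2)) => //.
  have m4 : measurable_fun setT (fun q : 'rV[R]_n * 'rV[R]_k * 'rV[R]_k * 'rV[R]_n =>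
      (q.1.1, (q.2, q.1.2))).
    apply: measurable_fun_pair; first exact: measurableT_comp.
    by apply: measurable_fun_pair => //; exact: measurableT_comp.
  exact: (measurableT_comp mF m4).
have H0 x t t' : (0 <= \int[leb n]_y F x t y t')%E by exact: integral_ge0.
rewrite (@tonelli_swap _ _ _ _ _ (leb n) (leb k)
  (fun x t => \int[leb k]_t' \int[leb n]_y F x t y t')%E); last 2 first.
- exact: (@measurable_leb_integral2 _ _ _ k
    (fun (p : 'rV[R]_n * 'rV[R]_k) t' => \int[leb n]_y F p.1 p.2 y t')%E).
- by move=> x t; exact: integral_ge0.
apply: eq_integral => t _.
apply: (@tonelli_swap _ _ _ _ _ (leb n) (leb k)
  (fun x t' => \int[leb n]_y F x t y t')%E) => //.
have m3 : measurable_fun setT (fun q : 'rV[R]_n * 'rV[R]_k => (q.1, t, q.2)).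
  by apply: measurable_fun_pair => //; exact: measurable_fun_pair.
exact: (measurableT_comp mH m3).
Qed.

Section family.
Context dT (T : measurableType dT) (m : {sigma_finite_measure set T -> \bar R}) (d : nat).
Variable v : T -> 'rV[R]_d -> R.
Hypothesis mv : measurable_fun setT (fun p : T * 'rV[R]_d => v p.1 p.2).

Let mD : measurable_fun setT (fun p : T * measurableTypeR R => heatD p.2 (v p.1)).
Proof.
apply: (@measurable_heatD_param _ d _ _ snd (fun (p : T * measurableTypeR R) => v p.1)) => //.
have m2 : measurable_fun setT (fun q : T * measurableTypeR R * 'rV[R]_d => (q.1.1, q.2)).
  by apply: measurable_fun_pair => //; exact: measurableT_comp.
exact: (measurableT_comp mv m2).
Qed.

Lemma measurable_heatD_family :
  measurable_fun setT (fun r : measurableTypeR R => \int[m]_t heatD r (v t))%E.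
Proof.
apply: (@measurable_fun_fubini_tonelli_G _ _ _ _ _ m (fun p => heatD p.2 (v p.1))) => //.
by move=> p; exact: heatD_ge0.
Qed.

Lemma measurable_heatQ_family s : measurable_fun setT (fun t => heatQ s (v t)).
Proof.
under eq_fun do rewrite heatQ.unlock.
apply: (@measurable_iterated _ _ _ _ _ mu (fun t r => (tw s r)%:E * heatD r (v t))%E).
  apply: emeasurable_funM mD; apply/measurable_EFinP.
  exact: (measurableT_comp (measurable_tw s) measurable_snd).
by move=> t r; rewrite mule_ge0 ?heatD_ge0// lee_fin tw_ge0.
Qed.

Lemma heatQ_family s : (\int[m]_t heatQ s (v t) =
   \int[mu]_r ((tw s r)%:E * \int[m]_t heatD r (v t)))%E.
Proof.
under eq_integral do rewrite heatQ.unlock.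
have mtw := measurable_tw s.
rewrite (@tonelli_swap _ _ _ _ _ m mu (fun t r => (tw s r)%:E * heatD r (v t))%E); last 2 first.
- apply: emeasurable_funM mD; apply/measurable_EFinP; exact: (measurableT_comp mtw measurable_snd).
- by move=> t r; rewrite mule_ge0 ?heatD_ge0// lee_fin tw_ge0.
apply: eq_integral => r _; rewrite ge0_integralZl_EFin ?tw_ge0//.
- by move=> t _; exact: heatD_ge0.
- exact: (measurableT_comp mD (@pair2_measurable _ _ _ _ r)).
Qed.

End family.

End iterated_more.

(** * Comparison of an energy with the energies of its slices *)

Section slices_cylinder.
Variable R : realType.
Notation mu := (@lebesgue_measure R).
Notation leb := (leb R).
Implicit Types s r : R.
Variables n k : nat.
Implicit Types w : 'rV[R]_(n + k) -> R.

Lemma measurable_row2 w : measurable_fun setT w ->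
  measurable_fun setT (fun p : 'rV[R]_n * 'rV[R]_k => w (row_mx p.1 p.2)).
Proof. by move=> mw; apply: (measurableT_comp mw); exact: measurable_row_mx. Qed.

Lemma measurable_row2' w : measurable_fun setT w ->
  measurable_fun setT (fun p : 'rV[R]_k * 'rV[R]_n => w (row_mx p.2 p.1)).
Proof. by move=> mw; apply: (measurableT_comp mw); exact: measurable_row_mx. Qed.

Lemma measurable_vslice w t : measurable_fun setT w ->
  measurable_fun setT (fun x : 'rV[R]_n => w (row_mx x t)).
Proof. by move=> mw; apply: (measurableT_comp mw); exact: measurable_row_mx. Qed.

Lemma measurable_hslice w x : measurable_fun setT w ->
  measurable_fun setT (fun t : 'rV[R]_k => w (row_mx x t)).
Proof. by move=> mw; apply: (measurableT_comp mw); exact: measurable_row_mx. Qed.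

Lemma ge0_integral_leb_col (F : 'rV[R]_(n + k) -> \bar R) :
  measurable_fun setT F -> (forall x, 0 <= F x)%E ->
  (\int[leb (n + k)]_z F z = \int[leb k]_t \int[leb n]_x F (row_mx x t))%E.
Proof.
move=> mF F0; rewrite ge0_integral_leb_row//.
apply: (@tonelli_swap _ _ _ _ _ (leb n) (leb k) (fun x t => F (row_mx x t))) => //.
by apply: (measurableT_comp mF); exact: measurable_row_mx.
Qed.

Lemma measurable_heatC_vslice r w : measurable_fun setT w ->
  measurable_fun setT (fun p : 'rV[R]_k * 'rV[R]_k =>
    heatC r (fun x : 'rV[R]_n => w (row_mx x p.1)) (fun x : 'rV[R]_n => w (row_mx x p.2))).
Proof.
move=> mw; have mw2 := measurable_row2' mw.
apply: (@measurable_heatC_param _ n _ _ r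
  (fun (p : 'rV[R]_k * 'rV[R]_k) x => w (row_mx x p.1)) (fun p x => w (row_mx x p.2))).
  apply: (measurableT_comp mw); apply: measurable_row_mx => //.
  exact: measurableT_comp.
apply: (measurableT_comp mw); apply: measurable_row_mx => //.
exact: measurableT_comp.
Qed.

(** The factorization of the heat kernel: [heatD] of [w] is the interaction of its slices, weighted
    by the kernel in the remaining variables. *)
Lemma heatD_row r w : measurable_fun setT w ->
  heatD r w = (\int[leb k]_t \int[leb k]_t' ((heat r (t - t'))%:E *
    heatC r (fun x : 'rV[R]_n => w (row_mx x t)) (fun x : 'rV[R]_n => w (row_mx x t'))))%E.
Proof.
move=> mw.
have mK := measurable_heat_pair r mw mw; have K0 := heat_pair_ge0 r w w.
pose F x t y t' := (((w (row_mx x t) - w (row_mx y t')) ^+ 2 *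
  heat r (row_mx x t - row_mx y t' : 'rV[R]_(n + k)))%:E)%E.
transitivity (\int[leb n]_x \int[leb k]_t \int[leb n]_y \int[leb k]_t' F x t y t')%E.
  rewrite heatD.unlock ge0_integral_leb_row; last 2 first.
  - exact: measurable_leb_integral2.
  - by move=> x; exact: integral_ge0.
  apply: eq_integral => x _; apply: eq_integral => t _.
  rewrite ge0_integral_leb_row//.
  exact: (measurableT_comp mK (@pair1_measurable _ _ _ _ (row_mx x t))).
rewrite tonelli4; last 2 first.
- have m2 : measurable_fun setT (fun p : ('rV[R]_n * 'rV[R]_k) * ('rV[R]_n * 'rV[R]_k) =>
      (row_mx p.1.1 p.1.2, row_mx p.2.1 p.2.2) : 'rV[R]_(n + k) * 'rV[R]_(n + k)).
    by apply: measurable_fun_pair; apply: measurable_row_mx; exact: measurableT_comp.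
  exact: (measurableT_comp mK m2).
- by move=> *; exact: K0.
apply: eq_integral => t _; apply: eq_integral => t' _.
set a := (fun x : 'rV[R]_n => w (row_mx x t)); set b := (fun x : 'rV[R]_n => w (row_mx x t')).
have ma : measurable_fun setT a by exact: measurable_vslice.
have mb : measurable_fun setT b by exact: measurable_vslice.
rewrite heatC.unlock -(iteratedZ (leb n) (leb n) (measurable_heat_pair r ma mb)
  (heat_pair_ge0 r a b) (heat_ge0 r (t - t'))).
apply: eq_integral => x _.
apply: eq_integral => y _; rewrite -EFinM /F opp_row_mx add_row_mx heat_row_mx.
by congr EFin; rewrite [RHS]mulrCA [heat r (t - t') * _]mulrC.
Qed.

Lemma vslice_integrable_ae (f : 'rV[R]_(n + k) -> R) :
  (leb (n + k)).-integrable setT (EFin \o f) ->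
  {ae leb k, forall t, (leb n).-integrable setT (EFin \o (fun x => f (row_mx x t)))}.
Proof.
move=> fi; have mf : measurable_fun setT f by apply/measurable_EFinP; exact: measurable_int fi.
have mnf : measurable_fun setT (fun z : 'rV[R]_(n + k) => `|f z|%:E).
  by apply/measurable_EFinP; exact: measurableT_comp.
have := ae_iterated_lty (m1 := leb k) (m2 := leb n) (f := fun t x => `|f (row_mx x t)|%:E).
rewrite -(ge0_integral_leb_col (F := fun z => `|f z|%:E))//.
have /integrableP[_ /[swap]/[apply] H] := fi.
have {}H := H (measurableT_comp mnf (measurable_row_mx measurable_snd measurable_fst)).
apply: filterS (H (fun _ _ => normr_ge0 _)) => t fin; apply/integrableP; split => //.
by apply/measurable_EFinP; exact: measurable_vslice.
Qed.

Lemma hslice_integrable_ae (f : 'rV[R]_(n + k) -> R) :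
  (leb (n + k)).-integrable setT (EFin \o f) ->
  {ae leb n, forall x, (leb k).-integrable setT (EFin \o (fun t => f (row_mx x t)))}.
Proof.
move=> fi; have mf : measurable_fun setT f by apply/measurable_EFinP; exact: measurable_int fi.
have mnf : measurable_fun setT (fun z : 'rV[R]_(n + k) => `|f z|%:E).
  by apply/measurable_EFinP; exact: measurableT_comp.
have := ae_iterated_lty (m1 := leb n) (m2 := leb k) (f := fun x t => `|f (row_mx x t)|%:E).
rewrite -(ge0_integral_leb_row (F := fun z => `|f z|%:E))//.
have /integrableP[_ /[swap]/[apply] H] := fi.
have {}H := H (measurableT_comp mnf (measurable_row_mx measurable_fst measurable_snd)).
apply: filterS (H (fun _ _ => normr_ge0 _)) => x fin; apply/integrableP; split => //.
by apply/measurable_EFinP; exact: measurable_hslice.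
Qed.

Lemma L12_vslice_ae w : L12 w -> {ae leb k, forall t, L12 (fun x : 'rV[R]_n => w (row_mx x t))}.
Proof.
move=> [iw iw2].
by apply: filterS2 (vslice_integrable_ae iw) (vslice_integrable_ae iw2) => t i1 i2; split.
Qed.

Section slice_heatD.
Variables (r : R) (w : 'rV[R]_(n + k) -> R).
Hypotheses (r0 : 0 < r) (mw : measurable_fun setT w).

Let W t := (fun x : 'rV[R]_n => w (row_mx x t)).
Let h (t t' : 'rV[R]_k) := (heat r (t - t'))%:E.
Let mh : measurable_fun setT (fun p : 'rV[R]_k * 'rV[R]_k => h p.1 p.2).
Proof. exact: measurable_heatB. Qed.
Let h0 t t' : (0 <= h t t')%E. Proof. by rewrite lee_fin heat_ge0. Qed.

Let mC : measurable_fun setT (fun p : 'rV[R]_k * 'rV[R]_k => heatC r (W p.1) (W p.2)).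
Proof. exact: measurable_heatC_vslice. Qed.
Let mC' : measurable_fun setT (fun p : 'rV[R]_k * 'rV[R]_k => heatC r (W p.2) (W p.1)).
Proof.
have msw : measurable_fun setT (fun p : 'rV[R]_k * 'rV[R]_k => (p.2, p.1)).
  exact: measurable_fun_pair.
exact: (measurableT_comp mC msw).
Qed.
Let mD : measurable_fun setT (fun t => heatD r (W t)).
Proof.
have mdg : measurable_fun setT (fun t : 'rV[R]_k => (t, t)) by exact: measurable_fun_pair.
under eq_fun do rewrite -heatCC; exact: (measurableT_comp mC mdg).
Qed.
Let mD1 : measurable_fun setT (fun p : 'rV[R]_k * 'rV[R]_k => heatD r (W p.1)).
Proof. exact: (measurableT_comp mD measurable_fst). Qed.
Let mD2 : measurable_fun setT (fun p : 'rV[R]_k * 'rV[R]_k => heatD r (W p.2)).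
Proof. exact: (measurableT_comp mD measurable_snd). Qed.
Let D0 t : (0 <= heatD r (W t))%E. Proof. exact: heatD_ge0. Qed.
Let C0 t t' : (0 <= heatC r (W t) (W t'))%E. Proof. exact: heatC_ge0. Qed.

Let half (a b : \bar R) : (0 <= a)%E -> (0 <= b)%E -> (a + a <= b + b)%E -> (a <= b)%E.
Proof.
by move: a b => [a| |] [b| |]//=; rewrite ?leey// !lee_fin => _ _; lra.
Qed.

Let conv_sum (a b : 'rV[R]_k -> 'rV[R]_k -> \bar R) :
  measurable_fun setT (fun p : 'rV[R]_k * 'rV[R]_k => a p.1 p.2) ->
  measurable_fun setT (fun p : 'rV[R]_k * 'rV[R]_k => b p.1 p.2) ->
  (forall t t', 0 <= a t t')%E -> (forall t t', 0 <= b t t')%E ->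
  (\int[leb k]_t \int[leb k]_t' (h t t' * (a t t' + b t t')) =
   \int[leb k]_t \int[leb k]_t' (h t t' * a t t') +
   \int[leb k]_t \int[leb k]_t' (h t t' * b t t'))%E.
Proof.
move=> ma mb a0 b0.
under eq_integral do under eq_integral do rewrite ge0_muleDr//.
apply: (iteratedD (leb k) (leb k) (f := fun t t' => (h t t' * a t t')%E)
  (g := fun t t' => (h t t' * b t t')%E)).
- exact: emeasurable_funM mh ma.
- exact: emeasurable_funM mh mb.
- by move=> t t'; rewrite mule_ge0.
- by move=> t t'; rewrite mule_ge0.
Qed.

(** The kernel in t has mass one in each of its variables, so each of the two terms gives the full
    integral of slice energies. *)
Let sumD : (\int[leb k]_t \int[leb k]_t' (h t t' * (heatD r (W t) + heatD r (W t'))) =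
  \int[leb k]_t heatD r (W t) + \int[leb k]_t heatD r (W t))%E.
Proof.
rewrite (conv_sum mD1 mD2 (fun t _ => D0 t) (fun _ t' => D0 t')).
rewrite (heat_conv_swap r (g := fun t _ => heatD r (W t)) mD1 (fun t _ => D0 t)).
by rewrite !(heat_convl r0 mD D0).
Qed.

(** Symmetrization of [heatD_row]. It is needed because [heatC_quad_ge] and [heatC_quad_le] control
    only the sum of the two orders; the factor two is removed by [half]. *)
Let sumC : (\int[leb k]_t \int[leb k]_t'
    (h t t' * (heatC r (W t) (W t') + heatC r (W t') (W t))) = heatD r w + heatD r w)%E.
Proof.
rewrite (conv_sum mC mC' C0 (fun t t' => C0 t' t)).
by rewrite (heat_conv_swap r (g := fun t t' => heatC r (W t) (W t')) mC C0) -heatD_row.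
Qed.

(** [heatC_quad_ge] for almost every pair of slices, namely those in [L12], integrated against the
    kernel in t. *)
Lemma slice_heatD_le : L12 w ->
  (\int[leb k]_t heatD r (fun x : 'rV[R]_n => w (row_mx x t)) <= heatD r w)%E.
Proof.
move=> Lw.
apply: half; [by apply: integral_ge0 => t _; exact: D0|exact: heatD_ge0|].
rewrite -sumC -[leLHS]sumD; apply: ae_le_iterated.
- apply: emeasurable_funM mh _; exact: emeasurable_funD mD1 mD2.
- apply: emeasurable_funM mh _; exact: emeasurable_funD mC mC'.
- by move=> t t'; rewrite mule_ge0// adde_ge0.
- by move=> t t'; rewrite mule_ge0// adde_ge0.
have := L12_vslice_ae Lw => aeL.
apply: filterS (aeL) => t Lt; apply: filterS (aeL) => t' Lt'.
by rewrite lee_wpmul2l// heatC_quad_ge.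
Qed.

Let J t t' := (\int[leb n]_x ((W t x - W t' x) ^+ 2)%:E)%E.
Let J0 t t' : (0 <= J t t')%E.
Proof. by apply: integral_ge0 => x _; rewrite lee_fin sqr_ge0. Qed.
Let mJ : measurable_fun setT (fun p : 'rV[R]_k * 'rV[R]_k => J p.1 p.2).
Proof.
apply: (@measurable_leb_integral2 _ _ _ n
  (fun p x => ((W p.1 x - W p.2 x) ^+ 2)%:E)); last first.
  by move=> *; rewrite lee_fin sqr_ge0.
apply/measurable_EFinP; apply: measurable_funX; apply: measurable_funB;
  apply: (measurableT_comp mw); apply: measurable_row_mx => //;
  exact: measurableT_comp.
Qed.

(** Squared L2 distances of slices, weighted by the kernel in t, recombine by Tonelli's theorem into
    the energies of [w] as a function of t. *)
Let sumJ : (\int[leb k]_t \int[leb k]_t' (h t t' * J t t') =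
  \int[leb n]_x heatD r (fun t : 'rV[R]_k => w (row_mx x t)))%E.
Proof.
pose F (x : 'rV[R]_n) (t t' : 'rV[R]_k) := ((W t x - W t' x) ^+ 2 * heat r (t - t'))%:E.
have F0 x t t' : (0 <= F x t t')%E by rewrite lee_fin mulr_ge0 ?sqr_ge0 ?heat_ge0.
have mF : measurable_fun setT (fun q : 'rV[R]_n * 'rV[R]_k * 'rV[R]_k => F q.1.1 q.1.2 q.2).
  apply/measurable_EFinP; apply: measurable_funM.
    apply: measurable_funX; apply: measurable_funB; apply: (measurableT_comp mw);
    by apply: measurable_row_mx => //; exact: measurableT_comp.
  apply: measurable_heat => //; apply: measurable_rVB => //; exact: measurableT_comp.
transitivity (\int[leb n]_x \int[leb k]_t \int[leb k]_t' F x t t')%E; last first.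
  by apply: eq_integral => x _; rewrite heatD.unlock.
rewrite [RHS](@tonelli_swap _ _ _ _ _ (leb n) (leb k)
  (fun x t => \int[leb k]_t' F x t t')%E); last 2 first.
- exact: (@measurable_leb_integral2 _ _ _ k (fun (p : 'rV[R]_n * 'rV[R]_k) t' => F p.1 p.2 t')).
- by move=> x t; exact: integral_ge0.
apply: eq_integral => t _.
have m3 : measurable_fun setT (fun q : 'rV[R]_n * 'rV[R]_k => (q.1, t, q.2)).
  by apply: measurable_fun_pair => //; exact: measurable_fun_pair.
rewrite [RHS](@tonelli_swap _ _ _ _ _ (leb n) (leb k) (F ^~ t) (measurableT_comp mF m3)
  (fun x => F0 x t)).
apply: eq_integral => t' _; rewrite muleC -ge0_integralZr//.
- apply/measurable_EFinP; apply: measurable_funX.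
  by apply: measurable_funB; exact: measurable_vslice.
- by move=> x _; rewrite lee_fin sqr_ge0.
Qed.

(** [heatC_quad_le] on each pair of slices, integrated with the help of [sumC], [sumD] and
    [sumJ]. *)
Lemma heatD_le_slices :
  (heatD r w <= \int[leb k]_t heatD r (fun x : 'rV[R]_n => w (row_mx x t)) +
    \int[leb n]_x heatD r (fun t : 'rV[R]_k => w (row_mx x t)))%E.
Proof.
apply: half; first exact: heatD_ge0.
  by rewrite adde_ge0//; apply: integral_ge0 => x _; [exact: D0|exact: heatD_ge0].
rewrite -sumC addeACA -[X in (_ <= X + _)%E]sumD -sumJ.
rewrite -(conv_sum mJ mJ J0 J0) -conv_sum; last 4 first.
- exact: emeasurable_funD mD1 mD2.
- by apply: emeasurable_funD; exact: mJ.
- by move=> t t'; rewrite adde_ge0.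
- by move=> t t'; rewrite adde_ge0.
apply: le_iterated.
- apply: emeasurable_funM mh _; exact: emeasurable_funD mC mC'.
- apply: emeasurable_funM mh _; apply: emeasurable_funD; first exact: emeasurable_funD mD1 mD2.
  by apply: emeasurable_funD; exact: mJ.
- by move=> t t'; rewrite mule_ge0// adde_ge0.
- move=> t t'; rewrite lee_wpmul2l//.
  have := heatC_quad_le r0 (measurable_vslice t mw) (measurable_vslice t' mw).
  by rewrite mule_natl mule2n.
Qed.

End slice_heatD.

Lemma slice_heatQ_le s w : L12 w ->
  (\int[leb k]_t heatQ s (fun x : 'rV[R]_n => w (row_mx x t)) <= heatQ s w)%E.
Proof.
move=> Lw; have mw := L12_measurable Lw.
have mv : measurable_fun setT (fun p : 'rV[R]_k * 'rV[R]_n => w (row_mx p.2 p.1)).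
  exact: measurable_row2'.
rewrite (heatQ_family _ mv) heatQ.unlock; apply: ge0_le_integral => //.
- move=> r _; rewrite mule_ge0 ?lee_fin ?tw_ge0//.
  by apply: integral_ge0 => t _; exact: heatD_ge0.
- apply: emeasurable_funM; first by apply/measurable_EFinP; exact: measurable_tw.
  exact: (measurable_heatD_family _ mv).
- apply: emeasurable_funM; first by apply/measurable_EFinP; exact: measurable_tw.
  exact: measurable_heatD.
- move=> r _; have [r0|r0] := leP r 0; first by rewrite tw_le0E// !mul0e.
  by rewrite lee_wpmul2l ?lee_fin ?tw_ge0// slice_heatD_le.
Qed.

Lemma heatQ_le_slices s w : measurable_fun setT w ->
  (heatQ s w <= \int[leb k]_t heatQ s (fun x : 'rV[R]_n => w (row_mx x t)) +
    \int[leb n]_x heatQ s (fun t : 'rV[R]_k => w (row_mx x t)))%E.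
Proof.
move=> mw.
have mv : measurable_fun setT (fun p : 'rV[R]_k * 'rV[R]_n => w (row_mx p.2 p.1)).
  exact: measurable_row2'.
have mh : measurable_fun setT (fun p : 'rV[R]_n * 'rV[R]_k => w (row_mx p.1 p.2)).
  exact: measurable_row2.
have mtw : measurable_fun setT (fun r => (tw s r)%:E).
  by apply/measurable_EFinP; exact: measurable_tw.
have V0 r : (0 <= \int[leb k]_t heatD r (fun x : 'rV[R]_n => w (row_mx x t)))%E.
  by apply: integral_ge0 => t _; exact: heatD_ge0.
have H0 r : (0 <= \int[leb n]_x heatD r (fun t : 'rV[R]_k => w (row_mx x t)))%E.
  by apply: integral_ge0 => t _; exact: heatD_ge0.
have mV := measurable_heatD_family (leb k) (v := fun t x => w (row_mx x t)) mv.
have mH := measurable_heatD_family (leb n) (v := fun x t => w (row_mx x t)) mh.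
rewrite (heatQ_family _ mv) (heatQ_family _ mh) -ge0_integralD//; first last.
- exact: emeasurable_funM mtw mH.
- by move=> r _; rewrite mule_ge0 ?lee_fin ?tw_ge0//; exact: H0.
- exact: emeasurable_funM mtw mV.
- by move=> r _; rewrite mule_ge0 ?lee_fin ?tw_ge0//; exact: V0.
rewrite heatQ.unlock; apply: ge0_le_integral => //.
- by move=> r _; rewrite mule_ge0 ?lee_fin ?tw_ge0//; exact: heatD_ge0.
- apply: emeasurable_funM mtw _; exact: measurable_heatD.
- exact: emeasurable_funD (emeasurable_funM mtw mV) (emeasurable_funM mtw mH).
- move=> r _; have [r0|r0] := leP r 0; first by rewrite tw_le0E// !mul0e adde0.
  by rewrite -(ge0_muleDr _ (V0 r) (H0 r)) lee_wpmul2l ?lee_fin ?tw_ge0// heatD_le_slices.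
Qed.

End slices_cylinder.

(** * Poincare, scaling and Jensen *)

Section poincare.
Variable R : realType.
Notation mu := (@lebesgue_measure R).
Notation leb := (leb R).
Implicit Types s r : R.

Lemma heat_antitone d r (x y : 'rV[R]_d) : 0 < r -> dotv x x <= dotv y y ->
  heat r y <= heat r x.
Proof.
move=> r0 xy; rewrite /heat ler_wpM2l ?exprn_ge0 ?invr_ge0//.
by rewrite ler_expR lerN2 ler_wpM2r// invr_ge0 mulr_ge0// ltW.
Qed.

(* The kernel is bounded below on the product of the support of v and a unit
   box off that support. *)
Lemma poincare d s rho : (0 < d)%N -> 0 < s < 1 -> 0 <= rho -> exists C : R, 0 < C /\
  forall v : 'rV[R]_d -> R, measurable_fun setT v -> vanish_out rho v ->
  (\int[leb d]_x (v x ^+ 2)%:E <= C%:E * heatQ s v)%E.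
Proof.
move=> d0 s01 rho0.
(* For [|x| < rho] and [y] in the box [F] below, each coordinate of [x - y] is at most [2 rho + 1]
   in absolute value, so [z] minimizes the kernel over these pairs at every time simultaneously. *)
pose z : 'rV[R]_d := const_mx (2 * rho + 1).
have zz : dotv z z = d%:R * (2 * rho + 1) ^+ 2.
  rewrite /dotv; under eq_bigr do rewrite !mxE -expr2.
  by rewrite sumr_const card_ord [RHS]mulr_natl.
have rho1 : 0 < 2 * rho + 1 by rewrite ltr_wpDl// mulr_ge0.
have z0 : 0 < dotv z z by rewrite zz mulr_gt0 ?ltr0n// exprn_gt0.
have e0 : 0 < enorm z by rewrite sqrtr_gt0.
pose c := kernel_const d s / enorm z `^ (d%:R + 2 * s).
have c0 : 0 < c by rewrite divr_gt0 ?kernel_const_gt0// powR_gt0.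
exists c^-1; split; first by rewrite invr_gt0.
move=> v mv vv.
have I0 : (0 <= \int[leb d]_x (v x ^+ 2)%:E)%E.
  by apply: integral_ge0 => x _; rewrite lee_fin sqr_ge0.
have mv2 : measurable_fun setT (fun x => (v x ^+ 2)%:E).
  by apply/measurable_EFinP; exact: measurable_funX.
suff main : (c%:E * \int[leb d]_x (v x ^+ 2)%:E <= heatQ s v)%E.
  have := @lee_wpmul2l R (c^-1)%:E _ _ _ main.
  rewrite muleA -EFinM mulVf ?gt_eqF// mul1e; apply.
  by rewrite lee_fin invr_ge0 ltW.
have [N [mN N0 sN]] := vv.
have vN x : ~ N x -> ~ enorm x < rho -> v x = 0.
  by move=> nN; apply: contrapT => h; apply: nN; exact: sN.
(* A box of volume one, outside the ball because already one coordinate exceeds [rho]; this is where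
   [0 < d] enters. *)
pose F : set 'rV[R]_d := box rho (rho + 1).
have mF : measurable F by exact: measurable_box.
have F1 : leb d F = 1%E.
  by rewrite leb_box ?lerDl// addrAC subrr add0r expr1n.
have IF : (\int[leb d]_y (\1_F y)%:E = 1)%E.
  by rewrite (integral_indic _ measurableT mF) setIT.
have Fout y : F y -> ~ enorm y < rho.
  move=> Fy; apply/negP; rewrite -leNgt.
  have := Fy (Ordinal d0); rewrite in_itv/= => /andP[h _].
  by rewrite (le_trans (ltW h))// (le_trans (ler_norm _))// coord_le_enorm.
have key r : 0 < r -> ((heat r z)%:E * \int[leb d]_x (v x ^+ 2)%:E <= heatD r v)%E.
  move=> r0.
  pose f (x y : 'rV[R]_d) := ((v x ^+ 2 * heat r z)%:E * (\1_F y)%:E)%E.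
  have -> : ((heat r z)%:E * \int[leb d]_x (v x ^+ 2)%:E =
      \int[leb d]_x \int[leb d]_y f x y)%E.
    rewrite -ge0_integralZl_EFin ?heat_ge0//; last first.
      by move=> x _; rewrite lee_fin sqr_ge0.
    apply: eq_integral => x _; rewrite /f ge0_integralZl_EFin//.
    - by rewrite IF mule1 -EFinM mulrC.
    - exact/measurable_EFinP.
    - by rewrite mulr_ge0 ?sqr_ge0 ?heat_ge0.
  rewrite heatD.unlock; apply: ae_le_iterated.
  - apply: emeasurable_funM; last first.
      apply/measurable_EFinP.
      have m1F : measurable_fun setT (\1_F : 'rV[R]_d -> R) by exact: measurable_indic.
      exact: (measurableT_comp m1F measurable_snd).
    apply/measurable_EFinP; apply: measurable_funM => //.
    by apply: measurable_funX; exact: measurableT_comp.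
  - apply/measurable_EFinP; apply: measurable_funM.
      by apply: measurable_funX; apply: measurable_funB; exact: measurableT_comp.
    by apply: measurable_heat => //; exact: measurable_rVB.
  - by move=> x y; rewrite mule_ge0 ?lee_fin// mulr_ge0 ?sqr_ge0 ?heat_ge0.
  - by move=> x y; rewrite lee_fin mulr_ge0 ?sqr_ge0 ?heat_ge0.
  exists N; split => // x /=; apply: contra_notP => Nx.
  exists N; split => // y /=; apply: contra_notP => Ny.
  rewrite /f indicE; case: (boolP (y \in F)) => /= [/set_mem Fy|_]; last first.
    by rewrite mule0 lee_fin mulr_ge0 ?sqr_ge0 ?heat_ge0.
  rewrite mule1 lee_fin (vN y Ny (Fout y Fy)) subr0.
  have [xr|xr] := pselect (enorm x < rho); last first.
    by rewrite (vN x Nx xr) expr0n !mul0r.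
  rewrite ler_wpM2l ?sqr_ge0// heat_antitone// zz [leRHS]mulr_natl.
  rewrite -[X in _ <= _ *+ X]card_ord -sumr_const; apply: ler_sum => i _.
  rewrite -expr2 -real_normK ?num_real// lerXn2r ?nnegrE//; first exact: ltW.
  rewrite !mxE (le_trans (ler_normB _ _))//.
  have := Fy i; rewrite in_itv/= => /andP[h1 h2].
  have := le_lt_trans (coord_le_enorm x i) xr.
  rewrite (ger0_norm (le_trans rho0 (ltW h1))); move: `|x _ _| (y _ _) h2 => p q; lra.
(* The constant [c] is the time integral of [tw s r * heat r z], so [key] can be integrated in
   time. *)
have -> : (c%:E * \int[leb d]_x (v x ^+ 2)%:E =
   \int[mu]_r ((tw s r)%:E * ((heat r z)%:E * \int[leb d]_x (v x ^+ 2)%:E)))%E.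
  rewrite /c -integral_tw_heat// -ge0_integralZr//; last 2 first.
  - apply/measurable_EFinP; apply: measurable_funM; first exact: measurable_tw.
    exact: measurable_heat.
  - by move=> r _; rewrite lee_fin mulr_ge0 ?tw_ge0 ?heat_ge0.
  by apply: eq_integral => r _; rewrite EFinM muleA.
rewrite heatQ.unlock; apply: ge0_le_integral => //.
- by move=> r _; rewrite !mule_ge0// lee_fin ?tw_ge0 ?heat_ge0.
- apply: emeasurable_funM; first by apply/measurable_EFinP; exact: measurable_tw.
  apply: emeasurable_funM => //; apply/measurable_EFinP; exact: measurable_heat.
- apply: emeasurable_funM; first by apply/measurable_EFinP; exact: measurable_tw.
  exact: measurable_heatD.
- move=> r _; have [r0|r0] := leP r 0; first by rewrite tw_le0E// !mul0e.
  by rewrite lee_wpmul2l ?lee_fin ?tw_ge0// key.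
Qed.

Lemma heat_scale d c r (z : 'rV[R]_d) : 0 < c -> 0 < r ->
  heat r z = c ^+ d * heat (c ^+ 2 * r) (c *: z).
Proof.
move=> c0 r0; rewrite /heat mulrA; congr (_ * expR (- _)); last first.
  rewrite (_ : dotv (c *: z) (c *: z) = c ^+ 2 * dotv z z); last first.
    by rewrite /dotv mulr_sumr; apply: eq_bigr => i _; rewrite !mxE; ring.
  by field; rewrite !gt_eqF.
rewrite -exprMn; congr (_ ^+ d).
rewrite (_ : 4 * pi * (c ^+ 2 * r) = c ^+ 2 * (4 * pi * r)); last by ring.
rewrite [in RHS]sqrtrM ?sqr_ge0// sqrtr_sqr gtr0_norm// invfM mulrA mulfV ?mul1r//.
exact: lt0r_neq0.
Qed.

Lemma heatD_scale d c r (u : 'rV[R]_d -> R) : 0 < c -> 0 < r -> measurable_fun setT u ->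
  heatD r (fun x => u (c *: x)) = ((c^-1 ^+ d)%:E * heatD (c ^+ 2 * r) u)%E.
Proof.
move=> c0 r0 mu'.
pose F (x y : 'rV[R]_d) := ((u x - u y) ^+ 2 * heat (c ^+ 2 * r) (x - y))%:E.
have F0 x y : (0 <= F x y)%E by rewrite lee_fin mulr_ge0 ?sqr_ge0 ?heat_ge0.
have mF : measurable_fun setT (fun p : 'rV[R]_d * 'rV[R]_d => F p.1 p.2).
  exact: measurable_heat_pair.
have mI := measurable_leb_integral2 mF F0.
have I0 x : (0 <= \int[leb d]_y F x y)%E by exact: integral_ge0.
have ci0 : 0 <= c^-1 ^+ d by rewrite exprn_ge0// invr_ge0 ltW.
have cd0 : 0 <= c ^+ d by rewrite exprn_ge0// ltW.
rewrite !heatD.unlock -(ge0_integral_leb_scale c0 mI I0).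
apply: eq_integral => x _.
have mFx : measurable_fun setT (F (c *: x)) by exact: iterated_measurable1.
rewrite -[RHS]mul1e (_ : 1%E = (c ^+ d * c^-1 ^+ d)%:E); last first.
  by rewrite -exprMn mulfV ?gt_eqF// expr1n.
rewrite EFinM -muleA -(ge0_integral_leb_scale c0 mFx (F0 _)).
have mFc : measurable_fun setT (fun y : 'rV[R]_d => F (c *: x) (c *: y)).
  by apply: (measurableT_comp mFx); exact: measurable_rVZ.
rewrite -(ge0_integralZl_EFin (leb d) measurableT (fun y _ => F0 (c *: x) (c *: y)) mFc cd0).
apply: eq_integral => y _; rewrite /F -EFinM -scalerBr [in LHS](heat_scale _ c0 r0).
by rewrite mulrCA.
Qed.

(** Dilating space by [c] dilates time by [c^2], and the weight [tw] turns the latter into [c^(2s)].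
    With [c = l^-1] in dimension [k] this is the order [l^(k - 2s)] of the cutoff energy. *)
Lemma heatQ_scale d s c (u : 'rV[R]_d -> R) : 0 < c -> measurable_fun setT u ->
  heatQ s (fun x => u (c *: x)) = ((c^-1 ^+ d * c `^ (2 * s))%:E * heatQ s u)%E.
Proof.
move=> c0 mu'; have c20 : 0 < c ^+ 2 by exact: exprn_gt0.
have ci0 : 0 <= c^-1 ^+ d by rewrite exprn_ge0// invr_ge0 ltW.
have mD : measurable_fun setT (fun r : measurableTypeR R => heatD r u) by exact: measurable_heatD.
rewrite EFinM -muleA.
have -> : c `^ (2 * s) = (c ^+ 2) `^ s by rewrite powRrM powR_mulrn// ltW.
rewrite [in RHS]heatQ.unlock -(integral_tw_scale _ c20 mD (fun r => heatD_ge0 r u)).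
rewrite -ge0_integralZl_EFin//; last 2 first.
- by move=> r _; rewrite mule_ge0 ?heatD_ge0// lee_fin tw_ge0.
- apply: emeasurable_funM; first by apply/measurable_EFinP; exact: measurable_tw.
  by apply: (measurableT_comp mD); exact: measurable_funM.
rewrite heatQ.unlock; apply: eq_integral => r _.
have [r0|r0] := leP r 0; first by rewrite tw_le0E// !mul0e mule0.
by rewrite heatD_scale// muleCA.
Qed.

Section jensen.
Context dT (T : measurableType dT) (nu : {sigma_finite_measure set T -> \bar R}).
Variables (B : set T) (m : R).
Hypotheses (mB : measurable B) (nuB : nu B = m%:E) (m0 : 0 < m).

(** The integral of the square of [w - c * \1_B] is nonnegative when [c] is the mean of [w]; an
    infinite second moment makes the claim trivial. *)
Lemma sqr_mean_le (w : T -> R) : nu.-integrable setT (EFin \o w) ->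
  (forall t, ~ B t -> w t = 0) ->
  (((m^-1 * \int[nu]_t w t) ^+ 2)%:E <= (m^-1)%:E * \int[nu]_t (w t ^+ 2)%:E)%E.
Proof.
move=> iw wB; have mw : measurable_fun setT w by apply/measurable_EFinP; exact: measurable_int iw.
have I0 : (0 <= \int[nu]_t (w t ^+ 2)%:E)%E.
  by apply: integral_ge0 => t _; rewrite lee_fin sqr_ge0.
have mi0 : 0 < m^-1 by rewrite invr_gt0.
have [Ioo|Ifin] := eqVneq (\int[nu]_t (w t ^+ 2)%:E)%E +oo%E.
  by rewrite Ioo gt0_muley ?lte_fin// leey.
have iw2 : nu.-integrable setT (EFin \o (fun t => w t ^+ 2)).
  apply/integrableP; split; first by apply/measurable_EFinP; exact: measurable_funX.
  under eq_integral do rewrite /= ger0_norm ?sqr_ge0//.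
  by rewrite ltey.
have I1 : (\int[nu]_t (\1_B t)%:E = m%:E)%E.
  by rewrite (integral_indic _ measurableT mB) setIT.
have i1 : nu.-integrable setT (EFin \o (\1_B : T -> R)).
  apply/integrableP; split; first exact/measurable_EFinP.
  under eq_integral do rewrite /= ger0_norm//.
  by rewrite I1 ltry.
pose c := m^-1 * \int[nu]_t w t.
have : 0 <= \int[nu]_t (w t - c * \1_B t) ^+ 2.
  by apply: Rintegral_ge0 => t _; exact: sqr_ge0.
have E t : (w t - c * \1_B t) ^+ 2 = w t ^+ 2 + (- (2 * c) * w t + c ^+ 2 * \1_B t).
  rewrite indicE; case: (boolP (t \in B)) => /= [_|]; first by ring.
  by rewrite notin_setE => /wB ->; ring.
under eq_Rintegral do rewrite E.
have j1 := integrableZl measurableT (- (2 * c)) iw.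
have j2 := integrableZl measurableT (c ^+ 2) i1.
have j12 := integrableD measurableT j1 j2.
rewrite RintegralD// RintegralD// RintegralZl// RintegralZl//.
have -> : \int[nu]_t \1_B t = m :> R.
  by rewrite /Rintegral I1.
have cE : \int[nu]_t w t = m * c by rewrite /c mulrA mulfV ?gt_eqF// mul1r.
rewrite -/c cE => H.
rewrite -(@fineK _ (\int[nu]_t (w t ^+ 2)%:E)%E); last by rewrite ge0_fin_numE// ltey.
rewrite -EFinM lee_fin mulrC ler_pdivlMr//.
move: H; rewrite /Rintegral; move: (fine _) => q; lra.
Qed.

Variables (n : nat) (v : T -> 'rV[R]_n -> R) (A : 'rV[R]_n -> R).
Hypotheses (mv : measurable_fun setT (fun p : T * 'rV[R]_n => v p.1 p.2))
  (mA : measurable_fun setT A) (vB : forall t x, ~ B t -> v t x = 0)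
  (vA : {ae leb n, forall x, nu.-integrable setT (EFin \o (v ^~ x)) /\
           A x = m^-1 * \int[nu]_t v t x}).

(** For almost every pair [x], [y], [sqr_mean_le] is applied to [v t x - v t y]; the hypothesis [vA]
    makes the increment of [A] the mean of these increments. *)
Lemma jensen_heatD r : (heatD r A <= (m^-1)%:E * \int[nu]_t heatD r (v t))%E.
Proof.
pose F t (x y : 'rV[R]_n) := ((v t x - v t y) ^+ 2 * heat r (x - y))%:E.
have F0 t x y : (0 <= F t x y)%E by rewrite lee_fin mulr_ge0 ?sqr_ge0 ?heat_ge0.
have mF : measurable_fun setT (fun q : T * 'rV[R]_n * 'rV[R]_n => F q.1.1 q.1.2 q.2).
  have m1 : measurable_fun setT (fun q : T * 'rV[R]_n * 'rV[R]_n => (q.1.1, q.2)).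
    by apply: measurable_fun_pair => //; exact: measurableT_comp.
  apply/measurable_EFinP; apply: measurable_funM.
    apply: measurable_funX; apply: measurable_funB.
      exact: (measurableT_comp mv measurable_fst).
    exact: (measurableT_comp mv m1).
  by apply: measurable_heat => //; apply: measurable_rVB => //; exact: measurableT_comp.
have mF' : measurable_fun setT (fun q : 'rV[R]_n * 'rV[R]_n * T => F q.2 q.1.1 q.1.2).
  have m2 : measurable_fun setT (fun q : 'rV[R]_n * 'rV[R]_n * T => (q.2, q.1.1, q.1.2)).
    apply: measurable_fun_pair; last exact: measurableT_comp.
    by apply: measurable_fun_pair => //; exact: measurableT_comp.
  exact: (measurableT_comp mF m2).
pose G x y := (\int[nu]_t F t x y)%E.
have G0 x y : (0 <= G x y)%E by exact: integral_ge0.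
have mG : measurable_fun setT (fun p : 'rV[R]_n * 'rV[R]_n => G p.1 p.2).
  exact: (@measurable_iterated _ _ _ _ _ nu (fun p t => F t p.1 p.2)).
have -> : (\int[nu]_t heatD r (v t) = \int[leb n]_x \int[leb n]_y G x y)%E.
  under eq_integral do rewrite heatD.unlock.
  rewrite (@tonelli_swap _ _ _ _ _ nu (leb n) (fun t x => \int[leb n]_y F t x y)%E); last 2 first.
  - exact: (@measurable_leb_integral2 _ _ _ n (fun p y => F p.1 p.2 y)).
  - by move=> t x; exact: integral_ge0.
  apply: eq_integral => x _.
  have m3 : measurable_fun setT (fun p : T * 'rV[R]_n => (p.1, x, p.2)).
    by apply: measurable_fun_pair => //; exact: measurable_fun_pair.
  exact: (@tonelli_swap _ _ _ _ _ nu (leb n) (fun t y => F t x y) (measurableT_comp mF m3)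
    (fun t y => F0 t x y)).
have mi0 : 0 <= m^-1 by rewrite invr_ge0 ltW.
rewrite -(iteratedZ (leb n) (leb n) mG G0 mi0).
rewrite heatD.unlock.
apply: (@ae_le_iterated _ _ _ _ _ (leb n) (leb n)
  (fun x y => ((A x - A y) ^+ 2 * heat r (x - y))%:E) (fun x y => (m^-1)%:E * G x y)%E).
- exact: measurable_heat_pair.
- exact: measurable_funeM.
- exact: heat_pair_ge0.
- by move=> x y; rewrite mule_ge0.
apply: filterS (vA) => x [ix Ax]; apply: filterS (vA) => y [iy Ay].
have -> : A x - A y = m^-1 * \int[nu]_t (v t x - v t y).
  by rewrite (RintegralB measurableT ix iy) mulrBr Ax Ay.
have mvx z : measurable_fun setT (v ^~ z).
  exact: (measurableT_comp mv (@pair2_measurable _ _ _ _ z)).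
have -> : G x y = (\int[nu]_t ((v t x - v t y) ^+ 2)%:E * (heat r (x - y))%:E)%E.
  rewrite -ge0_integralZr ?lee_fin ?heat_ge0//.
  - by apply/measurable_EFinP; apply: measurable_funX; exact: measurable_funB.
  - by move=> t _; rewrite lee_fin sqr_ge0.
rewrite muleA EFinM lee_wpmul2r ?lee_fin ?heat_ge0//.
apply: (@sqr_mean_le (fun t => v t x - v t y)); first exact: (integrableB measurableT ix iy).
by move=> t nB; rewrite !vB// subrr.
Qed.

Lemma jensen_heatQ s : (heatQ s A <= (m^-1)%:E * \int[nu]_t heatQ s (v t))%E.
Proof.
have mi0 : 0 <= m^-1 by rewrite invr_ge0 ltW.
have mtw : measurable_fun setT (fun r => (tw s r)%:E).
  by apply/measurable_EFinP; exact: measurable_tw.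
have J0 r : (0 <= \int[nu]_t heatD r (v t))%E.
  by apply: integral_ge0 => t _; exact: heatD_ge0.
have mJ := measurable_heatD_family nu mv.
rewrite (heatQ_family nu mv) -ge0_integralZl_EFin//; last 2 first.
- by move=> r _; rewrite mule_ge0 ?lee_fin ?tw_ge0//; exact: J0.
- exact: emeasurable_funM mtw mJ.
rewrite heatQ.unlock; apply: ge0_le_integral => //.
- by move=> r _; rewrite mule_ge0 ?heatD_ge0// lee_fin tw_ge0.
- by apply: emeasurable_funM mtw _; exact: measurable_heatD.
- by apply: measurable_funeM; exact: emeasurable_funM mtw mJ.
- move=> r _; rewrite muleCA lee_wpmul2l ?lee_fin ?tw_ge0//; exact: jensen_heatD.
Qed.

End jensen.

End poincare.

(** * Lipschitz cutoffs *)

Section cutoff.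
Variable R : realType.
Notation mu := (@lebesgue_measure R).
Notation leb := (leb R).
Implicit Types s r : R.

(** With [y = |z|^2 / (8 r)], half of the exponent absorbs [|z|^2] through [y expR (- y) <= 1], and
    the other half is the exponent at time [2 r]. *)
Lemma sqr_heat_le d r (z : 'rV[R]_d) : 0 < r ->
  dotv z z * heat r z <= 8 * r * Num.sqrt 2 ^+ d * heat (2 * r) z.
Proof.
move=> r0; rewrite /heat.
have p0 : 0 < pi :> R := pi_gt0 R.
have s0 : 0 < Num.sqrt (4 * pi * r) by rewrite sqrtr_gt0 !mulr_gt0.
have -> : Num.sqrt (4 * pi * (2 * r)) = Num.sqrt 2 * Num.sqrt (4 * pi * r).
  by rewrite -sqrtrM//; congr Num.sqrt; ring.
have t0 : 0 < Num.sqrt 2 :> R by rewrite sqrtr_gt0.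
rewrite (invfM (Num.sqrt 2)) exprMn [(Num.sqrt 2)^-1 ^+ d]exprVn.
set A := (Num.sqrt (4 * pi * r))^-1 ^+ d; set E1 := expR _; set E2 := expR _.
have A0 : 0 <= A by rewrite exprn_ge0// invr_ge0 ltW.
have b0 : Num.sqrt 2 ^+ d != 0 :> R by rewrite expf_neq0// gt_eqF.
have -> : 8 * r * Num.sqrt 2 ^+ d * ((Num.sqrt 2 ^+ d)^-1 * A * E2) = A * (8 * r * E2).
  by move: (Num.sqrt 2 ^+ d) b0 => b b0; field.
rewrite (mulrCA (dotv z z)) ler_wpM2l// /E1 /E2.
pose y := dotv z z / (8 * r).
have -> : dotv z z / (4 * r) = y + y by rewrite /y; field; rewrite gt_eqF.
have -> : dotv z z / (4 * (2 * r)) = y by rewrite /y; field; rewrite gt_eqF.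
have -> : dotv z z = 8 * r * y by rewrite /y; field; rewrite gt_eqF.
rewrite opprD expRD -(mulrA _ y) ler_wpM2l//; first by rewrite mulr_ge0// ltW.
rewrite mulrA ler_piMl ?expR_ge0// expRN ler_pdivrMr ?expR_gt0// mul1r.
by rewrite (le_trans _ (expR_ge1Dx y))// lerDr.
Qed.

Section lipschitz_energy.
Variables (d : nat) (h : 'rV[R]_d -> R) (L : R) (S : set 'rV[R]_d).
Hypotheses (mh : measurable_fun setT h) (h01 : forall x, 0 <= h x <= 1)
  (Lh : forall x y, `|h x - h y| <= L * enorm (x - y))
  (mS : measurable S) (S_fin : (leb d S < +oo)%E) (hS : forall x, ~ S x -> h x = 0).

(** A pair of points contributes only when one of them lies in [S]; the mass of the kernel then
    bounds the double integral by twice [M] times the measure of [S]. The time [r'] may differ from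
    [r], as [sqr_heat_le] requires. *)
Lemma heatD_support_le r r' M : 0 < r' -> 0 <= M ->
  (forall x y, (h x - h y) ^+ 2 * heat r (x - y) <= M * heat r' (x - y)) ->
  (heatD r h <= (2 * M * fine (leb d S))%:E)%E.
Proof.
move=> r'0 M0 H.
(* Its square is [M] on [S], so the majorant is the sum of the interactions of [c] with zero in both
   orders. *)
pose c x := Num.sqrt M * \1_S x.
have mc : measurable_fun setT c by exact: measurable_funM.
have c2 : (\int[leb d]_x (c x ^+ 2)%:E = (M * fine (leb d S))%:E)%E.
  rewrite EFinM fineK ?ge0_fin_numE//.
  transitivity (M%:E * \int[leb d]_x (\1_S x)%:E)%E; last first.
    by rewrite (integral_indic _ measurableT mS) setIT.
  rewrite -ge0_integralZl_EFin//; last exact/measurable_EFinP.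
  apply: eq_integral => x _; rewrite /c exprMn sqr_sqrtr// -EFinM indicE.
  by case: (x \in S); rewrite ?expr1n ?expr0n.
have -> : ((2 * M * fine (leb d S))%:E = heatC r' c (fun=> 0%R) + heatC r' (fun=> 0%R) c)%E.
  by rewrite heatC0r// heatC0l// c2 -EFinD; congr EFin; ring.
have m0 : measurable_fun setT (fun _ : 'rV[R]_d => 0 : measurableTypeR R).
  exact: measurable_cst.
rewrite -heatCC !heatC.unlock.
have mc0 := measurable_heat_pair r' mc m0; have m0c := measurable_heat_pair r' m0 mc.
rewrite -(iteratedD _ _ mc0 m0c (heat_pair_ge0 r' c (fun=> 0)) (heat_pair_ge0 r' (fun=> 0) c)).
apply: (le_iterated _ _ (measurable_heat_pair r mh mh)).
- exact: emeasurable_funD mc0 m0c.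
- exact: heat_pair_ge0.
move=> x y; rewrite -EFinD lee_fin -mulrDl subr0 sub0r sqrrN /c !exprMn sqr_sqrtr//.
have [Sx|nSx] := boolP (x \in S); have [Sy|nSy] := boolP (y \in S);
  rewrite !indicE ?Sx ?Sy ?(negbTE nSx) ?(negbTE nSy) /= ?expr1n ?expr0n ?mulr1 ?mulr0 ?addr0 ?add0r.
- by rewrite (le_trans (H x y))// ler_wpM2r ?heat_ge0// lerDl.
- exact: H.
- exact: H.
- move: nSx nSy; rewrite !notin_setE => /hS -> /hS ->.
  by rewrite subrr expr0n !mul0r.
Qed.

(** [heatD r h] is bounded because [0 <= h <= 1], and it is [O(r)] by the Lipschitz bound; the
    exponents [0] and [1] lie on either side of [s]. *)
Lemma heatQ_lipschitz_lty s : 0 < s < 1 -> (heatQ s h < +oo)%E.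
Proof.
move=> /andP[s0 s1].
pose D r := fine (heatD r h).
pose V := fine (leb d S).
have V0 : 0 <= V by rewrite fine_ge0.
have b0 r : 0 < r -> (heatD r h <= (2 * 1 * V)%:E)%E.
  move=> r0; apply: (heatD_support_le r0 ler01) => x y.
  rewrite mul1r ler_piMl ?heat_ge0//.
  have := h01 x; have := h01 y; move: (h x) (h y) => p q /andP[? ?] /andP[? ?].
  by rewrite -ler_sqrt// sqrtr1 sqrtr_sqr ler_norml; apply/andP; split; lra.
have b1 r : 0 < r -> (heatD r h <= (2 * (L ^+ 2 * (8 * r * Num.sqrt 2 ^+ d)) * V)%:E)%E.
  move=> r0; apply: (@heatD_support_le r (2 * r)); first by rewrite mulr_gt0.
    by rewrite mulr_ge0 ?sqr_ge0// mulr_ge0 ?exprn_ge0// mulr_ge0// ltW.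
  move=> x y.
  apply: (@le_trans _ _ (L ^+ 2 * (dotv (x - y) (x - y) * heat r (x - y)))).
    rewrite mulrA ler_wpM2r ?heat_ge0//.
    have -> : dotv (x - y) (x - y) = enorm (x - y) ^+ 2 by rewrite sqr_sqrtr// dotv_ge0.
    rewrite -exprMn -real_normK ?num_real// lerXn2r ?nnegrE//.
    exact: le_trans (Lh x y).
  by rewrite -(mulrA (L ^+ 2)) ler_wpM2l ?sqr_ge0// sqr_heat_le.
have fin r : 0 < r -> heatD r h = (D r)%:E.
  move=> r0; rewrite fineK// ge0_fin_numE ?heatD_ge0//.
  exact: le_lt_trans (b0 r r0) (ltry _).
have mD : measurable_fun setT D.
  apply: measurableT_comp => //; exact: measurable_heatD.
have -> : heatQ s h = (\int[mu]_r (tw s r * D r)%:E)%E.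
  rewrite heatQ.unlock; apply: eq_integral => r _.
  have [r0|r0] := leP r 0; first by rewrite tw_le0E// mul0r mul0e.
  by rewrite fin// EFinM.
pose C := 2 * (L ^+ 2 * (8 * Num.sqrt 2 ^+ d)) * V + 2 * V.
have C1 : 0 <= 2 * (L ^+ 2 * (8 * Num.sqrt 2 ^+ d)) * V.
  by rewrite mulr_ge0// mulr_ge0// mulr_ge0 ?sqr_ge0// mulr_ge0// exprn_ge0.
apply: (@integral_tw_lty R s D C 1 0) => //.
- by move=> r _; rewrite fine_ge0 ?heatD_ge0.
- move=> r /andP[r0 _]; rewrite (powRr1 (ltW r0)) -lee_fin -fin// (le_trans (b1 r r0))// lee_fin.
  have -> : C * r = 2 * (L ^+ 2 * (8 * r * Num.sqrt 2 ^+ d)) * V + 2 * V * r.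
    by rewrite /C; ring.
  by rewrite lerDl; apply: mulr_ge0 (ltW r0); rewrite mulr_ge0.
- move=> r r1; have r0 := lt_le_trans ltr01 r1.
  by rewrite powRr0 mulr1 -lee_fin -fin// (le_trans (b0 r r0))// lee_fin mulr1 /C lerDr.
Qed.

End lipschitz_energy.

Section complement_distance.
Variables (k : nat) (B : set 'rV[R]_k).
Hypotheses (oB : open B) (nB : ~` B !=set0).

Definition cdist (t : 'rV[R]_k) : R := inf [set `|t - y| | y in ~` B].

Lemma cdist_le t y : ~ B y -> cdist t <= `|t - y|.
Proof.
move=> By; apply: ge_inf; last by exists y.
by exists 0 => _ [z _ <-].
Qed.

Lemma le_cdist t e : (forall y, ~ B y -> e <= `|t - y|) -> e <= cdist t.
Proof.
move=> H; apply: lb_le_inf; first by case: nB => y By; exists `|t - y|, y.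
by move=> _ [y By <-]; exact: H.
Qed.

Lemma cdist_ge0 t : 0 <= cdist t.
Proof. by apply: le_cdist => y _. Qed.

Lemma cdist_out t : ~ B t -> cdist t = 0.
Proof.
move=> Bt; apply/eqP; rewrite eq_le cdist_ge0 andbT.
by rewrite (le_trans (cdist_le t Bt))// subrr normr0.
Qed.

Lemma cdist_gt0 t : B t -> 0 < cdist t.
Proof.
move=> Bt; have /nbhs_ballP[e /= e0 eB] := open_nbhs_nbhs (conj oB Bt).
apply: (lt_le_trans e0); apply: le_cdist => y By.
rewrite leNgt; apply/negP => ty; apply: By; apply: eB.
by rewrite -ball_normE.
Qed.

Lemma cdist_lipschitz t t' : `|cdist t - cdist t'| <= `|t - t'|.
Proof.
have H a b : cdist a - cdist b <= `|a - b|.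
  rewrite lerBlDr addrC -lerBlDr; apply: le_cdist => y By.
  rewrite lerBlDr (le_trans (cdist_le a By))//.
  by rewrite -[a - y](subrKA b) addrC; exact: ler_normD.
by rewrite ler_norml H andbT lerNl opprB distrC H.
Qed.

(** The slope [j] trades closeness to the indicator of [B] against energy: the indicator itself may
    have infinite energy, whereas each cutoff is Lipschitz and vanishes off [B]. *)
Definition cutoff j t := Num.min 1 (j%:R * cdist t).

Lemma cutoff_itv j t : 0 <= cutoff j t <= 1.
Proof. by rewrite /cutoff le_min ler01 mulr_ge0 ?cdist_ge0//= ge_min lexx. Qed.

Lemma cutoff_out j t : ~ B t -> cutoff j t = 0.
Proof. by move=> /cdist_out h; rewrite /cutoff h mulr0 /Num.min ltNge ler01. Qed.

Lemma norm_le_enorm (z : 'rV[R]_k) : `|z| <= enorm z.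
Proof.
rewrite /Num.norm/= mx_normrE; apply: bigmax_le; first exact: sqrtr_ge0.
by move=> [i j] _ /=; rewrite (ord1 i); exact: coord_le_enorm.
Qed.

Lemma cutoff_lipschitz j t t' : `|cutoff j t - cutoff j t'| <= j%:R * enorm (t - t').
Proof.
apply: (@le_trans _ _ `|j%:R * cdist t - j%:R * cdist t'|).
  rewrite /cutoff; move: (j%:R * _) (j%:R * _) => a b.
  rewrite /Num.min; case: ltP => ha; case: ltP => hb; rewrite ?subrr ?normr0//.
  - by rewrite !ger0_norm; lra.
  - by rewrite !ler0_norm; lra.
rewrite -mulrBr normrM normr_nat ler_wpM2l//.
exact: le_trans (cdist_lipschitz t t') (norm_le_enorm _).
Qed.

(** Superlevel sets are open by the Lipschitz bound, hence measurable by [open_measurable_rV]. *)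
Lemma measurable_cdist : measurable_fun setT cdist.
Proof.
apply: (measurability _ (RGenOInfty.measurableE R)).
move=> /= _ [_ [a ->]] <-; apply: measurableI => //; apply: open_measurable_rV.
rewrite openE => t /=; rewrite in_itv/= andbT => at_.
apply/nbhs_ballP; exists (cdist t - a); first by rewrite /= subr_gt0.
move=> t' /=; rewrite -ball_normE /= in_itv/= andbT => tt'.
have := le_lt_trans (cdist_lipschitz t t') tt'.
by rewrite ltr_norml => /andP[_]; lra.
Qed.

Lemma measurable_cutoff j : measurable_fun setT (cutoff j).
Proof.
apply: measurable_minr => //.
by apply: measurable_funM => //; exact: measurable_cdist.
Qed.

Lemma cutoff_cvg t : B t -> cutoff j t @[j --> \oo] --> (1 : R).
Proof.
move=> Bt; apply: cvg_near_cst; near=> j.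
rewrite /cutoff; apply/min_idPl.
rewrite -ler_pdivrMr ?cdist_gt0//; near: j; exact: nbhs_infty_ger.
Unshelve. all: by end_near.
Qed.

Hypothesis B_fin : (leb k B < +oo)%E.

Lemma cutoff_approx e : 0 < e -> exists j,
  (\int[leb k]_(t in B) ((1 - cutoff j t) ^+ 2)%:E < e%:E)%E.
Proof.
move=> e0; have mB := open_measurable_rV oB.
have mc j : measurable_fun B (fun t => ((1 - cutoff j t) ^+ 2)%:E).
  apply/measurable_funTS/measurable_EFinP; apply: measurable_funX.
  by apply: measurable_funB => //; exact: measurable_cutoff.
have cv : (\int[leb k]_(t in B) ((1 - cutoff j t) ^+ 2)%:E)%E @[j --> \oo] -->
    (\int[leb k]_(t in B) 0)%E.
  apply: (@dominated_cvg _ _ _ (leb k) B mB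
    (fun j t => ((1 - cutoff j t) ^+ 2)%:E) (fun=> 0%E) (fun=> 1%E)) => //.
  - move=> t Bt; apply: cvg_EFin; first by near=> j.
    rewrite (_ : 0 = (1 - 1) ^+ 2 :> R); last by rewrite subrr expr0n.
    rewrite /comp /=.
    have h : (1 - cutoff j t)%R @[j --> \oo] --> (1 - 1 : R).
      by apply: cvgB; [exact: cvg_cst|exact: cutoff_cvg].
    exact: (cvgM h h).
  - apply/integrableP; split => //.
    under eq_integral do rewrite abse1.
    by rewrite integral_cst// mul1e.
  - move=> j t Bt /=; rewrite lee_fin ger0_norm ?sqr_ge0//.
    by have := cutoff_itv j t; move: (cutoff j t) => p /andP[? ?]; nra.
have lt : \forall j \near \oo,
    (\int[leb k]_(t in B) ((1 - cutoff j t) ^+ 2)%:E < e%:E)%E.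
  move: cv; rewrite integral0 => cv.
  apply: (cv [set x | (x < e%:E)%E]); apply: open_nbhs_nbhs; split.
    exact: open_ereal_lt_ereal.
  by rewrite /= lte_fin.
by have [j _ H] := lt; exists j; exact: (H j (leqnn j)).
Unshelve. all: by end_near.
Qed.

End complement_distance.
End cutoff.

(** * Fubini on the cylinder *)

Section product_ae.
Variable R : realType.
Notation mu := (@lebesgue_measure R).
Notation leb := (leb R).
Implicit Types s r : R.
Variables n k : nat.

Lemma integral_indicT d (A : set 'rV[R]_d) : measurable A ->
  (leb d A = \int[leb d]_x (\1_A x)%:E)%E.
Proof. by move=> mA; rewrite (integral_indic _ measurableT mA) setIT. Qed.

Lemma ae_vslice (P : 'rV[R]_(n + k) -> Prop) : {ae leb (n + k), forall z, P z} ->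
  {ae leb k, forall t, {ae leb n, forall x, P (row_mx x t)}}.
Proof.
move=> [N [mN N0 sN]].
pose N' := [set p : 'rV[R]_k * 'rV[R]_n | N (row_mx p.2 p.1)].
have mN' : measurable N'.
  have mr : measurable_fun setT (fun p : 'rV[R]_k * 'rV[R]_n => row_mx p.2 p.1).
    exact: measurable_row_mx.
  by rewrite -[X in measurable X]setTI; exact: mr.
have := ae_iterated (m1 := leb k) (m2 := leb n) mN'.
have -> : (\int[leb k]_t \int[leb n]_x (\1_N' (t, x) : R)%:E = 0)%E.
  rewrite -N0 (integral_indicT mN) ge0_integral_leb_col; last 2 first.
  - by apply/measurable_EFinP; exact: measurable_indic.
  - by move=> z; rewrite lee_fin.
  apply: eq_integral => t _; apply: eq_integral => x _; rewrite !indicE.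
  by congr ((_ : bool)%:R%:E); apply/idP/idP; rewrite !inE.
move=> /(_ erefl); apply: filterS => t; apply: filterS => x nN.
by apply: contrapT => nP; apply: nN; exact: sN.
Qed.

Lemma ae_hslice (P : 'rV[R]_(n + k) -> Prop) : {ae leb (n + k), forall z, P z} ->
  {ae leb n, forall x, {ae leb k, forall t, P (row_mx x t)}}.
Proof.
move=> [N [mN N0 sN]].
pose N' := [set p : 'rV[R]_n * 'rV[R]_k | N (row_mx p.1 p.2)].
have mN' : measurable N'.
  have mr : measurable_fun setT (fun p : 'rV[R]_n * 'rV[R]_k => row_mx p.1 p.2).
    exact: measurable_row_mx.
  by rewrite -[X in measurable X]setTI; exact: mr.
have := ae_iterated (m1 := leb n) (m2 := leb k) mN'.
have -> : (\int[leb n]_x \int[leb k]_t (\1_N' (x, t) : R)%:E = 0)%E.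
  rewrite -N0 (integral_indicT mN) ge0_integral_leb_row; last 2 first.
  - by apply/measurable_EFinP; exact: measurable_indic.
  - by move=> z; rewrite lee_fin.
  apply: eq_integral => x _; apply: eq_integral => t _; rewrite !indicE.
  by congr ((_ : bool)%:R%:E); apply/idP/idP; rewrite !inE.
move=> /(_ erefl); apply: filterS => x; apply: filterS => t nN.
by apply: contrapT => nP; apply: nN; exact: sN.
Qed.

Lemma ae_lsubmx (P : 'rV[R]_n -> Prop) : {ae leb n, forall x, P x} ->
  {ae leb (n + k), forall z, P (lsubmx z)}.
Proof.
move=> [N [mN N0 sN]].
have ml : measurable_fun setT (fun z : 'rV[R]_(n + k) => lsubmx z).
  exact: measurable_lsubmx.
have mNl : measurable [set z : 'rV[R]_(n + k) | N (lsubmx z)].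
  by rewrite -[X in measurable X]setTI; exact: ml.
exists [set z | N (lsubmx z)]; split => //; last by move=> z /= nP; exact: sN.
rewrite (integral_indicT mNl) ge0_integral_leb_col.
- apply: integral0_eq => t _.
  rewrite -[RHS]N0 (integral_indicT mN).
  by apply: eq_integral => x _; rewrite !indicE; congr ((_ : bool)%:R%:E);
    apply/idP/idP; rewrite !inE /= row_mxKl.
- by apply/measurable_EFinP; exact: measurable_indic.
- by move=> z; rewrite lee_fin.
Qed.

Section fubini.
Implicit Types F : 'rV[R]_(n + k) -> R.

Let fubini_ge0 F : (leb (n + k)).-integrable setT (EFin \o F) -> (forall z, 0 <= F z) ->
  (leb k).-integrable setT (EFin \o (fun t => \int[leb n]_x F (row_mx x t))) /\
  \int[leb (n + k)]_z F z = \int[leb k]_t \int[leb n]_x F (row_mx x t).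
Proof.
move=> iF F0; have mF : measurable_fun setT F by apply/measurable_EFinP; exact: measurable_int iF.
have mF2 : measurable_fun setT (fun p : 'rV[R]_k * 'rV[R]_n => (F (row_mx p.2 p.1))%:E).
  by apply/measurable_EFinP; exact: measurable_row2'.
pose G t := (\int[leb n]_x (F (row_mx x t))%:E)%E.
have G0 t : (0 <= G t)%E by apply: integral_ge0 => x _; rewrite lee_fin.
have mG : measurable_fun setT G.
  apply: (@measurable_leb_integral2 _ _ _ n (fun t x => (F (row_mx x t))%:E)) => //.
  by move=> t x; rewrite lee_fin.
have IG : (\int[leb (n + k)]_z (F z)%:E = \int[leb k]_t G t)%E.
  by rewrite ge0_integral_leb_col//; exact/measurable_EFinP.
have mR : measurable_fun setT (fun t => \int[leb n]_x F (row_mx x t)).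
  exact: (measurableT_comp (fine_measurable measurableT) mG).
have ae : {ae leb k, forall t, setT t -> G t = (\int[leb n]_x F (row_mx x t))%:E}.
  apply: filterS (vslice_integrable_ae iF) => t it _.
  by rewrite fineK// integrable_fin_num.
have EI : (\int[leb k]_t G t = \int[leb k]_t (\int[leb n]_x F (row_mx x t))%:E)%E.
  by apply: ae_eq_integral => //; exact/measurable_EFinP.
split; last by rewrite /Rintegral IG EI.
apply/integrableP; split; first exact/measurable_EFinP.
apply: (@le_lt_trans _ _ (\int[leb (n + k)]_z (F z)%:E)%E).
  rewrite IG EI le_eqVlt; apply/orP; left; apply/eqP.
  by apply: eq_integral => t _ /=; rewrite ger0_norm// Rintegral_ge0.
have /integrableP[_] := iF; congr (_ < _)%E.
by apply: eq_integral => z _ /=; rewrite ger0_norm.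
Qed.

(** [F] is written as [|F|] minus [|F| - F], two nonnegative integrable functions covered by the
    preceding case. Slices are integrable almost everywhere only, so the inner integrals are
    compared almost everywhere. *)
Lemma Rintegral_leb_col F : (leb (n + k)).-integrable setT (EFin \o F) ->
  (leb k).-integrable setT (EFin \o (fun t => \int[leb n]_x F (row_mx x t))) /\
  \int[leb (n + k)]_z F z = \int[leb k]_t \int[leb n]_x F (row_mx x t).
Proof.
move=> iF; pose G z := `|F z|; pose H z := `|F z| - F z.
have iG : (leb (n + k)).-integrable setT (EFin \o G) by exact: integrable_norm.
have iH : (leb (n + k)).-integrable setT (EFin \o H).
  exact: (integrableB measurableT iG iF).
have [jG EG] := fubini_ge0 iG (fun z => normr_ge0 _).
have [jH EH] := fubini_ge0 iH (fun z => ltac:(by rewrite subr_ge0 ler_norm)).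
have mF : measurable_fun setT F by apply/measurable_EFinP; exact: measurable_int iF.
have FGH z : F z = G z - H z by rewrite /G /H opprB addrC subrK.
have jGH := integrableB measurableT jG jH.
have mR : measurable_fun setT (fun t => \int[leb n]_x F (row_mx x t)).
  apply: (measurable_Rintegral (leb n) (f := fun t x => F (row_mx x t))).
  exact: measurable_row2'.
have ae : {ae leb k, forall t, setT t -> \int[leb n]_x F (row_mx x t) =
    \int[leb n]_x G (row_mx x t) - \int[leb n]_x H (row_mx x t)}.
  apply: filterS2 (vslice_integrable_ae iG) (vslice_integrable_ae iH) => t i1 i2 _.
  rewrite -(RintegralB measurableT i1 i2).
  by apply: eq_Rintegral => x _; rewrite FGH.
have ae' : ae_eq (leb k) setT
    (EFin \o (fun t => \int[leb n]_x G (row_mx x t) - \int[leb n]_x H (row_mx x t)))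
    (EFin \o (fun t => \int[leb n]_x F (row_mx x t))).
  by apply: filterS ae => t h _ /=; rewrite h.
have mE : measurable_fun setT (EFin \o (fun t => \int[leb n]_x F (row_mx x t))).
  exact/measurable_EFinP.
split.
  apply/integrableP; split => //.
  have /integrableP[_] := jGH; congr (_ < _)%E; apply: ae_eq_integral => //.
  - exact: (measurableT_comp _ (measurable_int _ jGH)).
  - exact: measurableT_comp.
  - by apply: filterS ae' => t h tT; congr (`|_|)%E; exact: h.
have -> : \int[leb k]_t \int[leb n]_x F (row_mx x t) =
    \int[leb k]_t (\int[leb n]_x G (row_mx x t) - \int[leb n]_x H (row_mx x t)).
  rewrite /Rintegral; congr fine; apply/esym; apply: ae_eq_integral => //.
  exact: measurable_int jGH.
rewrite (RintegralB measurableT jG jH) -EG -EH -(RintegralB measurableT iG iH).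
by apply: eq_Rintegral => z _; rewrite FGH.
Qed.

End fubini.
End product_ae.

(** * Membership in [Htilde], slices and tensor products *)

Section htilde.
Variable R : realType.
Notation mu := (@lebesgue_measure R).
Notation leb := (leb R).
Implicit Types s r : R.

(** Replaces [energy] by [heatQ]; this is how membership is verified and exploited below. *)
Lemma HtildeP d s U (v : 'rV[R]_d -> R) : 0 < s < 1 -> Htilde s U v <->
  [/\ measurable_fun setT v, (\int[leb d]_x (v x ^+ 2)%:E < +oo)%E,
      (heatQ s v < +oo)%E & {ae leb d, forall z, ~ closure U z -> v z = 0}].
Proof.
move=> s01; have [c [c0 cE]] := energyE d s01; split.
  move=> Hv; have Q := Htilde_heatQ s01 Hv.
  by have [[/L2TP[mv v2] _] ae] := Hv; split.
move=> [mv v2 Q ae]; split => //; split; first exact/L2TP.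
rewrite cE//; move: Q; have := heatQ_ge0 s v.
by case: (heatQ s v) => [q| |]//= _ _; rewrite -EFinM ltry.
Qed.

Lemma sqr_lincomb_lty d (a : R) (u v : 'rV[R]_d -> R) :
  measurable_fun setT u -> measurable_fun setT v ->
  (\int[leb d]_x (u x ^+ 2)%:E < +oo)%E -> (\int[leb d]_x (v x ^+ 2)%:E < +oo)%E ->
  (\int[leb d]_x ((a * u x + v x) ^+ 2)%:E < +oo)%E.
Proof.
move=> mu' mv u2 v2.
have mu2 : measurable_fun setT (fun x => (u x ^+ 2)%:E).
  by apply/measurable_EFinP; exact: measurable_funX.
have mv2 : measurable_fun setT (fun x => (v x ^+ 2)%:E).
  by apply/measurable_EFinP; exact: measurable_funX.
have a0 : 0 <= 2 * a ^+ 2 by rewrite mulr_ge0// sqr_ge0.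
have iu x : (0 <= (u x ^+ 2)%:E)%E by rewrite lee_fin sqr_ge0.
have iv x : (0 <= (v x ^+ 2)%:E)%E by rewrite lee_fin sqr_ge0.
apply: (@le_lt_trans _ _ ((2 * a ^+ 2)%:E * \int[leb d]_x (u x ^+ 2)%:E +
    2%:E * \int[leb d]_x (v x ^+ 2)%:E)%E).
  rewrite -(ge0_integralZl_EFin (leb d) measurableT (fun x _ => iu x) mu2 a0).
  rewrite -(ge0_integralZl_EFin (leb d) measurableT (fun x _ => iv x) mv2 (ler0n _ 2)).
  rewrite -ge0_integralD//; first last.
  - exact: measurable_funeM.
  - by move=> x _; rewrite mule_ge0.
  - exact: measurable_funeM.
  - by move=> x _; rewrite mule_ge0.
  apply: ge0_le_integral => //.
  - by move=> x _; rewrite lee_fin sqr_ge0.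
  - apply/measurable_EFinP; apply: measurable_funX; apply: measurable_funD => //.
    exact: measurable_funM.
  - by apply: emeasurable_funD; exact: measurable_funeM.
  - move=> x _; rewrite -!EFinM -EFinD lee_fin.
    have := sqr_ge0 (a * u x - v x); move: (a * u x) (v x) (exprMn 2 a (u x)) => p q.
    by rewrite -(mulrA 2 (a ^+ 2)) => <-; nra.
have I0 (f : 'rV[R]_d -> R) : (0 <= \int[leb d]_x (f x ^+ 2)%:E)%E.
  by apply: integral_ge0 => x _; rewrite lee_fin sqr_ge0.
rewrite -[X in (_ * X + _)%E]fineK ?ge0_fin_numE//.
by rewrite -[X in (_ + _ * X)%E]fineK ?ge0_fin_numE// -!EFinM -EFinD ltry.
Qed.

Lemma Htilde_lincomb d s U a (u v : 'rV[R]_d -> R) : 0 < s < 1 ->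
  Htilde s U u -> Htilde s U v -> Htilde s U (fun x => a * u x + v x).
Proof.
move=> s01 /(HtildeP _ _ s01)[mu' u2 Qu au] /(HtildeP _ _ s01)[mv v2 Qv av].
apply/HtildeP => //; split.
- by apply: measurable_funD => //; exact: measurable_funM.
- exact: sqr_lincomb_lty.
- apply: (le_lt_trans (heatQ_lincomb_le a s mu' mv)).
  by rewrite -(fineK (heatQ_fin Qu)) -(fineK (heatQ_fin Qv)) -!EFinM -EFinD ltry.
- by apply: filterS2 au av => z h1 h2 nz; rewrite h1// h2// mulr0 addr0.
Qed.

Lemma heatQZ d s a (u : 'rV[R]_d -> R) : measurable_fun setT u ->
  heatQ s (fun x => a * u x) = ((a ^+ 2)%:E * heatQ s u)%E.
Proof.
move=> mu'; rewrite !heatQ.unlock -ge0_integralZl_EFin ?sqr_ge0//; first last.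
- apply: emeasurable_funM; first by apply/measurable_EFinP; exact: measurable_tw.
  exact: measurable_heatD.
- by move=> r _; rewrite mule_ge0 ?heatD_ge0// lee_fin tw_ge0.
apply: eq_integral => r _; rewrite muleCA; congr (_ * _)%E.
rewrite !heatD.unlock -(iteratedZ (leb d) (leb d) (measurable_heat_pair r mu' mu')
  (heat_pair_ge0 r u u) (sqr_ge0 a)).
apply: eq_integral => x _.
apply: eq_integral => y _; rewrite -EFinM -mulrBr exprMn; congr EFin.
exact: esym (mulrA _ _ _).
Qed.

Section cylinder_geometry.
Variables n k : nat.
Implicit Types (omega : set 'rV[R]_n) (D : set 'rV[R]_k).

Lemma bounded_cylinder omega D : bounded_set omega -> bounded_set D ->
  bounded_set (cylinder omega D).
Proof.
move=> [M1 [r1 H1]] [M2 [r2 H2]].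
exists (Num.max (M1 + 1) (M2 + 1)); split; first exact: num_real.
move=> M; rewrite gt_max => /andP[h1 h2] z [/= oz Dz].
have b1 : `|lsubmx z| <= M1 + 1 by apply: H1 => //; rewrite ltrDl.
have b2 : `|rsubmx z| <= M2 + 1 by apply: H2 => //; rewrite ltrDl.
have M0 : 0 <= M by rewrite (le_trans _ (ltW h1))// (le_trans _ b1).
rewrite /Num.norm/= mx_normrE; apply: bigmax_le => // -[i j] _ /=.
rewrite (ord1 i); have [j' ->|j' ->] := split_ordP j.
  have := le_trans (coord_le_norm (lsubmx z) j') (le_trans b1 (ltW h1)).
  by rewrite mxE.
have := le_trans (coord_le_norm (rsubmx z) j') (le_trans b2 (ltW h2)).
by rewrite mxE.
Qed.

Lemma closure_cylinder_lsubmx omega D z : closure (cylinder omega D) z ->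
  closure omega (lsubmx z).
Proof.
move=> cz A /nbhs_ballP[e /= e0 eA].
have [y [[oy _] zy]] := cz _ (nbhsx_ballx z e e0).
exists (lsubmx y); split => //; apply: eA; split => // i j.
by rewrite !mxE; exact: zy.2.
Qed.

Lemma closure_cylinder omega D x t : closure omega x -> D t ->
  closure (cylinder omega D) (row_mx x t).
Proof.
move=> cx Dt A /nbhs_ballP[e /= e0 eA].
have [y [oy xy]] := cx _ (nbhsx_ballx x e e0).
exists (row_mx y t); split; first by split; rewrite /= ?row_mxKl ?row_mxKr.
apply: eA; split => // i j; rewrite (ord1 i).
have [j' ->|j' ->] := split_ordP j.
  by rewrite !row_mxEl; exact: xy.2.
by rewrite !row_mxEr; exact: ballxx.
Qed.

(** By [slice_heatQ_le] the slice energies have a finite integral, so almost all of them are finite.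
    Almost every slice is thereby a legitimate test function for the equation on [omega]. *)
Lemma Htilde_vslice s omega D (w : 'rV[R]_(n + k) -> R) : 0 < s < 1 ->
  bounded_set omega -> bounded_set D ->
  Htilde s (cylinder omega D) w ->
  {ae leb k, forall t, Htilde s omega (fun x : 'rV[R]_n => w (row_mx x t))}.
Proof.
move=> s01 bo bD Hw; have [mw w2 Qw aw] := (HtildeP _ _ s01).1 Hw.
have [Lw _] := Htilde_L12 (bounded_cylinder bo bD) Hw.
have mv : measurable_fun setT (fun p : 'rV[R]_k * 'rV[R]_n => w (row_mx p.2 p.1)).
  exact: measurable_row2'.
have mQ : measurable_fun setT (fun t => heatQ s (fun x : 'rV[R]_n => w (row_mx x t))).
  exact: (measurable_heatQ_family (v := fun t x => w (row_mx x t)) mv).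
have iQ : (leb k).-integrable setT (fun t => heatQ s (fun x : 'rV[R]_n => w (row_mx x t))).
  apply/integrableP; split => //.
  under eq_integral do rewrite gee0_abs ?heatQ_ge0//.
  exact: le_lt_trans (slice_heatQ_le s Lw) Qw.
have aQ := integrable_ae measurableT iQ.
apply: filterS3 aQ (L12_vslice_ae Lw) (ae_vslice aw) => t Qt Lt at_.
apply/HtildeP => //; split.
- exact: measurable_vslice.
- have /integrableP[_] := Lt.2.
  by under eq_integral do rewrite /= ger0_norm ?sqr_ge0//.
- by rewrite -ge0_fin_numE ?heatQ_ge0//; exact: Qt.
- apply: filterS at_ => x h nx; apply: h => cz; apply: nx.
  by have := closure_cylinder_lsubmx cz; rewrite row_mxKl.
Qed.

Section tensor.
Variables (uinf : 'rV[R]_n -> R) (h : 'rV[R]_k -> R).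
Hypotheses (muinf : measurable_fun setT uinf) (mh : measurable_fun setT h).
Let U (z : 'rV[R]_(n + k)) := uinf (lsubmx z) * h (rsubmx z).

Lemma measurable_tensor : measurable_fun setT U.
Proof.
apply: measurable_funM.
  apply: (measurableT_comp muinf); exact: measurable_lsubmx.
apply: (measurableT_comp mh); exact: measurable_rsubmx.
Qed.

Lemma integral_tensor_sqr : (\int[leb (n + k)]_z (U z ^+ 2)%:E =
  \int[leb n]_x (uinf x ^+ 2)%:E * \int[leb k]_t (h t ^+ 2)%:E)%E.
Proof.
rewrite ge0_integral_leb_row; last 2 first.
- by apply/measurable_EFinP; apply: measurable_funX; exact: measurable_tensor.
- by move=> z; rewrite lee_fin sqr_ge0.
rewrite -ge0_integralZr//; last 3 first.
- by apply/measurable_EFinP; exact: measurable_funX.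
- by move=> x _; rewrite lee_fin sqr_ge0.
- by apply: integral_ge0 => t _; rewrite lee_fin sqr_ge0.
apply: eq_integral => x _; rewrite -ge0_integralZl_EFin ?sqr_ge0//; last 2 first.
- by move=> t _; rewrite lee_fin sqr_ge0.
- by apply/measurable_EFinP; exact: measurable_funX.
by apply: eq_integral => t _; rewrite /U row_mxKl row_mxKr exprMn EFinM.
Qed.

Lemma heatQ_tensor_le s : (heatQ s U <=
  heatQ s uinf * \int[leb k]_t (h t ^+ 2)%:E +
  \int[leb n]_x (uinf x ^+ 2)%:E * heatQ s h)%E.
Proof.
apply: le_trans (heatQ_le_slices s measurable_tensor) _.
have -> : (\int[leb k]_t heatQ s (fun x : 'rV[R]_n => U (row_mx x t)) =
    heatQ s uinf * \int[leb k]_t (h t ^+ 2)%:E)%E.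
  rewrite -ge0_integralZl ?heatQ_ge0//; last 2 first.
  - by apply/measurable_EFinP; exact: measurable_funX.
  - by move=> t _; rewrite lee_fin sqr_ge0.
  apply: eq_integral => t _; rewrite muleC -heatQZ//; congr heatQ.
  by apply/funext => x; rewrite /U row_mxKl row_mxKr mulrC.
have -> : (\int[leb n]_x heatQ s (fun t : 'rV[R]_k => U (row_mx x t)) =
    \int[leb n]_x (uinf x ^+ 2)%:E * heatQ s h)%E.
  rewrite -ge0_integralZr ?heatQ_ge0//; last 2 first.
  - by apply/measurable_EFinP; exact: measurable_funX.
  - by move=> t _; rewrite lee_fin sqr_ge0.
  apply: eq_integral => x _; rewrite -heatQZ//; congr heatQ.
  by apply/funext => t; rewrite /U row_mxKl row_mxKr.
exact: lexx.
Qed.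

End tensor.

Lemma Htilde_tensor s omega D uinf (h : 'rV[R]_k -> R) : 0 < s < 1 ->
  Htilde s omega uinf -> measurable_fun setT h ->
  (\int[leb k]_t (h t ^+ 2)%:E < +oo)%E -> (heatQ s h < +oo)%E ->
  (forall t, ~ D t -> h t = 0) ->
  Htilde s (cylinder omega D) (fun z => uinf (lsubmx z) * h (rsubmx z)).
Proof.
move=> s01 /(HtildeP _ _ s01)[mu' u2 Qu au] mh h2 Qh hD.
have I0 d (f : 'rV[R]_d -> R) : (0 <= \int[leb d]_x (f x ^+ 2)%:E)%E.
  by apply: integral_ge0 => x _; rewrite lee_fin sqr_ge0.
have fin2 d (f : 'rV[R]_d -> R) : (\int[leb d]_x (f x ^+ 2)%:E < +oo)%E ->
    (\int[leb d]_x (f x ^+ 2)%:E)%E \is a fin_num by move=> ?; rewrite ge0_fin_numE.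
apply/HtildeP => //; split.
- exact: measurable_tensor.
- by rewrite integral_tensor_sqr// -(fineK (fin2 _ _ u2)) -(fineK (fin2 _ _ h2)) -EFinM ltry.
- apply: le_lt_trans (heatQ_tensor_le mu' mh s) _.
  rewrite -(fineK (fin2 _ _ u2)) -(fineK (fin2 _ _ h2)).
  by rewrite -(fineK (heatQ_fin Qu)) -(fineK (heatQ_fin Qh)) -!EFinM -EFinD ltry.
- have au2 := @ae_lsubmx R n k _ au; apply: filterS au2 => z hz nz.
  have [Dz|nDz] := pselect (D (rsubmx z)); last by rewrite (hD _ nDz) mulr0.
  rewrite hz ?mul0r// => cz; apply: nz.
  by rewrite -[z]hsubmxK; exact: closure_cylinder.
Qed.

End cylinder_geometry.
End htilde.

(** * The estimate at fixed length *)

Section fixed_length.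
Variable R : realType.
Notation mu := (@lebesgue_measure R).
Notation leb := (leb R).
Variables (n k : nat) (s : R) (omega : set 'rV[R]_n) (D : set 'rV[R]_k).
Hypotheses (s01 : 0 < s < 1) (bomega : bounded_set omega) (bD : bounded_set D).
Variables (f u : 'rV[R]_(n + k) -> R) (finf uinf : 'rV[R]_n -> R).
Hypotheses (Lf : L2 (cylinder omega D) f) (Lfinf : L2 omega finf).
Hypotheses (wu : weak_solution s (cylinder omega D) f u)
  (wuinf : weak_solution s omega finf uinf).
Variable h : 'rV[R]_k -> R.
Hypotheses (mh : measurable_fun setT h) (h2 : (\int[leb k]_t (h t ^+ 2)%:E < +oo)%E)
  (Qh : (heatQ s h < +oo)%E) (hD : forall t, ~ D t -> h t = 0).

Let Omega := cylinder omega D.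
(** [U] is the competitor built from [uinf] and the cutoff; the error [w] is written in the form
    [a * _ + _] of the linear-combination lemmas; [g] is the corresponding defect of the sources,
    extended by zero. *)
Let U (z : 'rV[R]_(n + k)) := uinf (lsubmx z) * h (rsubmx z).
Let w z := - 1 * U z + u z.
Let g z := (f \_ Omega) z - (finf \_ omega) (lsubmx z) * h (rsubmx z).

Let bOmega : bounded_set Omega. Proof. exact: bounded_cylinder. Qed.
Let Hu : Htilde s Omega u := wu.1.
Let Huinf : Htilde s omega uinf := wuinf.1.
Let HU : Htilde s Omega U. Proof. exact: Htilde_tensor. Qed.
Let Hw : Htilde s Omega w. Proof. exact: Htilde_lincomb. Qed.
Let Lu : L12 u. Proof. exact: (Htilde_L12 bOmega Hu).1. Qed.
Let Lw : L12 w. Proof. exact: (Htilde_L12 bOmega Hw).1. Qed.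
Let Qu : (heatQ s u < +oo)%E. Proof. exact: Htilde_heatQ Hu. Qed.
Let Qw : (heatQ s w < +oo)%E. Proof. exact: Htilde_heatQ Hw. Qed.
Let muinf : measurable_fun setT uinf. Proof. by have [] := (HtildeP _ _ s01).1 Huinf. Qed.
Let mw : measurable_fun setT w. Proof. exact: L12_measurable. Qed.
Let mu' : measurable_fun setT u. Proof. exact: L12_measurable. Qed.

Let L2i d (A : set 'rV[R]_d) v : L2 A v ->
  (leb d).-integrable setT (EFin \o (fun x => (v \_ A) x ^+ 2)).
Proof. exact: L2_integrable_sqr. Qed.

Lemma L12_of_Htilde d A v : bounded_set A -> @Htilde R d s A v -> L12 v.
Proof. by move=> bA /(Htilde_L12 bA)[]. Qed.

Lemma integrable_mul_sqr d (a b : 'rV[R]_d -> R) :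
  measurable_fun setT a -> measurable_fun setT b ->
  (leb d).-integrable setT (EFin \o (fun x => a x ^+ 2)) ->
  (leb d).-integrable setT (EFin \o (fun x => b x ^+ 2)) ->
  (leb d).-integrable setT (EFin \o (fun x => a x * b x)).
Proof.
move=> ma mb ia ib; apply: le_integrable (integrableD measurableT ia ib) => //.
  by apply/measurable_EFinP; exact: measurable_funM.
move=> x _; rewrite /= lee_fin normrM (ger0_norm (addr_ge0 (sqr_ge0 _) (sqr_ge0 _))).
have := sqr_ge0 (`|a x| - `|b x|).
rewrite -(real_normK (num_real (a x))) -(real_normK (num_real (b x))).
have := normr_ge0 (a x); have := normr_ge0 (b x).
by move: `|a x| `|b x| => p q; nra.
Qed.

Let X := (\int[leb k]_t heatQ s (fun x : 'rV[R]_n => w (row_mx x t)))%E.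
Let Y := (\int[leb k]_t heatQ s (fun x : 'rV[R]_n => u (row_mx x t)))%E.

Let Xw : (X <= heatQ s w)%E. Proof. exact: slice_heatQ_le. Qed.
Let Yu : (Y <= heatQ s u)%E. Proof. exact: slice_heatQ_le. Qed.

Let integrable_slice_heatQ (v : 'rV[R]_(n + k) -> R) : L12 v -> (heatQ s v < +oo)%E ->
  (leb k).-integrable setT (fun t => heatQ s (fun x : 'rV[R]_n => v (row_mx x t))).
Proof.
move=> Lv Qv; have mv := L12_measurable Lv.
have mv2 : measurable_fun setT (fun p : 'rV[R]_k * 'rV[R]_n => v (row_mx p.2 p.1)).
  exact: measurable_row2'.
apply/integrableP; split.
  exact: (measurable_heatQ_family (v := fun t x => v (row_mx x t)) mv2).
under eq_integral do rewrite gee0_abs ?heatQ_ge0//.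
exact: le_lt_trans (slice_heatQ_le s Lv) Qv.
Qed.

Let iX := integrable_slice_heatQ Lw Qw.
Let iY := integrable_slice_heatQ Lu Qu.

Let finf0 := finf \_ omega.
Let mfinf0 : measurable_fun setT finf0. Proof. exact: L2_measurable. Qed.
Let f0 := f \_ Omega.
Let mf0 : measurable_fun setT f0. Proof. exact: L2_measurable. Qed.
Let V (z : 'rV[R]_(n + k)) := finf0 (lsubmx z) * h (rsubmx z).
Let mV : measurable_fun setT V. Proof. exact: measurable_tensor. Qed.

Let iV2 : (leb (n + k)).-integrable setT (EFin \o (fun z => V z ^+ 2)).
Proof.
apply/integrableP; split; first by apply/measurable_EFinP; exact: measurable_funX.
under eq_integral do rewrite /= ger0_norm ?sqr_ge0//.
rewrite integral_tensor_sqr//.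
have I0 d (a : 'rV[R]_d -> R) : (0 <= \int[leb d]_x (a x ^+ 2)%:E)%E.
  by apply: integral_ge0 => x _; rewrite lee_fin sqr_ge0.
have fi : (\int[leb n]_x (finf0 x ^+ 2)%:E < +oo)%E.
  have /integrableP[_] := L2i Lfinf.
  by under eq_integral do rewrite /= ger0_norm ?sqr_ge0//.
by rewrite lte_mul_pinfty// ge0_fin_numE.
Qed.

Let ifw : (leb (n + k)).-integrable setT (EFin \o (fun z => f0 z * w z)).
Proof. by apply: integrable_mul_sqr => //; [exact: L2i|exact: Lw.2]. Qed.

Let iVw : (leb (n + k)).-integrable setT (EFin \o (fun z => V z * w z)).
Proof. by apply: integrable_mul_sqr => //; exact: Lw.2. Qed.

Let setint d (A : set 'rV[R]_d) (a b : 'rV[R]_d -> R) :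
  \int[leb d]_(z in A) (a z * b z) = \int[leb d]_z ((a \_ A) z * b z).
Proof.
rewrite /Rintegral integral_mkcond; congr fine; apply: eq_integral => z _.
by rewrite !patchE; case: ifP => // _; rewrite mul0r.
Qed.

(** [U = u - w], so [heatQ_weak] with test function [- w] expands the energy of [U] around the
    solution [u]. *)
Let energy_identity : fine (heatQ s u) + fine (heatQ s w) =
  fine (heatQ s U) + 4 * kappa s * \int[leb (n + k)]_z (f0 z * w z).
Proof.
(* [- w] is presented as a linear combination with the zero function, to which [Htilde_lincomb]
   applies. *)
have HN : Htilde s Omega (fun z => - 1 * w z + (0 : R)).
  apply: Htilde_lincomb => //; apply/HtildeP => //; split => //.
  - by under eq_integral do rewrite expr0n; rewrite integral0.
  - have -> : (fun=> 0) = (fun z => 0 * w z) :> ('rV[R]_(n + k) -> R).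
      by apply/funext => z; rewrite mul0r.
    by rewrite heatQZ// expr0n mul0e.
  - exact: aeW.
have := heatQ_weak 1 s01 bOmega wu HN.
have -> : (fun x => 1 * u x + (- 1 * w x + 0)) = U.
  by apply/funext => z; rewrite /w; ring.
have -> : (fun x => - 1 * w x + 0) = (fun x => - 1 * w x).
  by apply/funext => z; rewrite addr0.
rewrite heatQZ// sqrrN expr1n mul1e => ->.
rewrite /= setint.
have -> : \int[leb (n + k)]_z ((f \_ Omega) z * (- 1 * w z + 0)) =
    - 1 * \int[leb (n + k)]_z (f0 z * w z).
  by rewrite -RintegralZl//; apply: eq_Rintegral => z _; rewrite /f0; ring.
ring.
Qed.

Let H2 := fine (\int[leb k]_t (h t ^+ 2)%:E)%E.
Let I2 := fine (\int[leb n]_x (uinf x ^+ 2)%:E)%E.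

(** On almost every slice [u = h t * uinf + w], so [heatQ_weak] for [uinf] with amplitude [h t]
    expands its energy; the identity follows by integrating over t. *)
Let slice_identity : fine Y = H2 * fine (heatQ s uinf) +
  4 * kappa s * \int[leb (n + k)]_z (V z * w z) + fine X.
Proof.
have [jV ->] := Rintegral_leb_col iVw.
have jh : (leb k).-integrable setT (EFin \o (fun t => h t ^+ 2)).
  apply/integrableP; split; first by apply/measurable_EFinP; exact: measurable_funX.
  by under eq_integral do rewrite /= ger0_norm ?sqr_ge0//.
pose a t := h t ^+ 2 * fine (heatQ s uinf).
pose b t := 4 * kappa s * \int[leb n]_x (V (row_mx x t) * w (row_mx x t)).
pose c t := fine (heatQ s (fun x : 'rV[R]_n => w (row_mx x t))).
have ja : (leb k).-integrable setT (EFin \o a) by exact: (integrableZr measurableT _ jh).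
have jb : (leb k).-integrable setT (EFin \o b) by exact: (integrableZl measurableT _ jV).
(* Slice energies are finite almost everywhere only, hence the passage from [heatQ] to its real
   value [c] up to a null set. *)
have cX : ae_eq (leb k) setT (fun t => heatQ s (fun x : 'rV[R]_n => w (row_mx x t)))
    (EFin \o c).
  apply: filterS (integrable_ae measurableT iX) => t Xt _ /=; rewrite /c fineK//.
  exact: Xt.
have mc : measurable_fun setT (EFin \o c).
  apply/measurable_EFinP.
  exact: (measurableT_comp (fine_measurable measurableT) (measurable_int _ iX)).
have XE : X = (\int[leb k]_t (c t)%:E)%E.
  by apply: ae_eq_integral => //; exact: measurable_int iX.
have jc : (leb k).-integrable setT (EFin \o c).
  apply/integrableP; split => //.
  under eq_integral do rewrite /= ger0_norm ?fine_ge0 ?heatQ_ge0//.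
  by rewrite -XE; exact: le_lt_trans Xw Qw.
have -> : fine X = \int[leb k]_t c t.
  by rewrite /Rintegral XE.
have -> : H2 * fine (heatQ s uinf) = \int[leb k]_t a t.
  by rewrite /a /= RintegralZr.
rewrite -[4 * _ * _]RintegralZl// -/b.
rewrite -(RintegralD measurableT ja jb) -(RintegralD measurableT (integrableD measurableT ja jb) jc).
rewrite /Rintegral; congr fine; apply: ae_eq_integral => //.
- exact: measurable_int iY.
- exact: measurable_int (integrableD measurableT (integrableD measurableT ja jb) jc).
apply: filterS (Htilde_vslice s01 bomega bD Hw) => t Ht _.
have := heatQ_weak (h t) s01 bomega wuinf Ht.
have -> : (fun x : 'rV[R]_n => h t * uinf x + w (row_mx x t)) = (fun x => u (row_mx x t)).
  by apply/funext => x; rewrite /w /U row_mxKl row_mxKr; ring.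
move=> ->; congr EFin; rewrite /a /b /c; congr (_ + _ + _).
rewrite -[LHS]mulrA; congr (_ * _); rewrite setint -RintegralZl//; last first.
  apply: integrable_mul_sqr => //.
  - by have [] := (HtildeP _ _ s01).1 Ht.
  - exact: L2i.
  - exact: (L12_of_Htilde bomega Ht).2.
by apply: eq_Rintegral => x _; rewrite /V /finf0 row_mxKl row_mxKr; ring.
Qed.

Let LU : L12 U. Proof. exact: (Htilde_L12 bOmega HU).1. Qed.
Let QU : (heatQ s U < +oo)%E. Proof. exact: Htilde_heatQ HU. Qed.
Let Quinf : (heatQ s uinf < +oo)%E. Proof. exact: Htilde_heatQ Huinf. Qed.

Let fin_sqr d (a : 'rV[R]_d -> R) : (\int[leb d]_x (a x ^+ 2)%:E < +oo)%E ->
  (\int[leb d]_x (a x ^+ 2)%:E)%E \is a fin_num.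
Proof.
by move=> H; rewrite ge0_fin_numE//; apply: integral_ge0 => x _; rewrite lee_fin sqr_ge0.
Qed.

Let Xfin : X \is a fin_num.
Proof.
rewrite ge0_fin_numE; last by apply: integral_ge0 => t _; exact: heatQ_ge0.
exact: le_lt_trans Xw Qw.
Qed.

Let Yfin : Y \is a fin_num.
Proof.
rewrite ge0_fin_numE; last by apply: integral_ge0 => t _; exact: heatQ_ge0.
exact: le_lt_trans Yu Qu.
Qed.

Variables (rho P : R).
Hypotheses (P0 : 0 < P) (omega_rho : forall x, closure omega x -> enorm x < rho)
  (poinc : forall v : 'rV[R]_n -> R, measurable_fun setT v -> vanish_out rho v ->
     (\int[leb n]_x (v x ^+ 2)%:E <= P%:E * heatQ s v)%E).

(** The Poincare inequality is applied on each slice over [omega] and integrated in t, so [P] does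
    not depend on the length of the cylinder. *)
Let poincare_w : \int[leb (n + k)]_z (w z ^+ 2) <= P * fine X.
Proof.
rewrite /Rintegral -lee_fin fineK; last by apply: integrable_fin_num => //; exact: Lw.2.
rewrite EFinM fineK// ge0_integral_leb_col; last 2 first.
- by apply/measurable_EFinP; exact: measurable_funX.
- by move=> z; rewrite lee_fin sqr_ge0.
rewrite -(ge0_integralZl_EFin (leb k) measurableT (fun t _ => heatQ_ge0 _ _)
  (measurable_int _ iX) (ltW P0)).
apply: ae_ge0_le_integral => //.
- by move=> t _; apply: integral_ge0 => x _; rewrite lee_fin sqr_ge0.
- apply: (@measurable_leb_integral2 _ _ _ n (fun t x => (w (row_mx x t) ^+ 2)%:E)).
    apply/measurable_EFinP; apply: measurable_funX.
    exact: measurable_row2'.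
  by move=> t x; rewrite lee_fin sqr_ge0.
- by move=> t _; rewrite mule_ge0 ?heatQ_ge0// lee_fin ltW.
- exact: measurable_funeM (measurable_int _ iX).
apply: filterS (Htilde_vslice s01 bomega bD Hw) => t Ht _.
have [mt _ _ at_] := (HtildeP _ _ s01).1 Ht.
apply: poinc => //; apply: filterS at_ => x hx nx; apply: hx => cx.
by apply: nx; exact: omega_rho.
Qed.

(** The first term is the cost of the cutoff, the second that of the sources. The term
    [H2 * fine (heatQ s uinf)] occurs in both [E2] and [E3] and cancels. *)
Lemma slice_defect_le :
  (\int[leb k]_t heatQ s (fun x : 'rV[R]_n => (w (row_mx x t))) <=
   (I2 * fine (heatQ s h) +
    8 * kappa s ^+ 2 * P * \int[leb (n + k)]_z (g z ^+ 2))%:E)%E.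
Proof.
rewrite -/X -(fineK Xfin) lee_fin.
have E1 := energy_identity; have E2 := slice_identity.
have E3 : fine (heatQ s U) <= H2 * fine (heatQ s uinf) + I2 * fine (heatQ s h).
  rewrite -lee_fin fineK ?heatQ_fin// EFinD !EFinM /H2 /I2 !fineK ?heatQ_fin ?fin_sqr//.
    by rewrite (muleC _ (heatQ s uinf)); exact: heatQ_tensor_le.
  by have [] := (HtildeP _ _ s01).1 Huinf.
have E4 : fine X <= fine (heatQ s w) by rewrite fine_le// heatQ_fin.
have E5 : fine Y <= fine (heatQ s u) by rewrite fine_le// heatQ_fin.
have mg : measurable_fun setT g by exact: measurable_funB.
have ig2 : (leb (n + k)).-integrable setT (EFin \o (fun z => g z ^+ 2)).
  have := integrableD measurableT (integrableZl measurableT 2 (L2i Lf))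
    (integrableZl measurableT 2 iV2).
  apply: le_integrable => //; first by apply/measurable_EFinP; exact: measurable_funX.
  move=> z _; rewrite /= lee_fin (ger0_norm (sqr_ge0 _)) (le_trans _ (ler_norm _))//.
  have := sqr_ge0 (f0 z + V z); rewrite /g -/(f0) -/(V z).
  by rewrite -/(f0 z); move: (f0 z) (V z) => p q; nra.
have E6 : \int[leb (n + k)]_z (f0 z * w z) - \int[leb (n + k)]_z (V z * w z) =
    \int[leb (n + k)]_z (g z * w z).
  rewrite -(RintegralB measurableT ifw iVw); apply: eq_Rintegral => z _.
  by rewrite /g -/(f0 z) -/(V z); ring.
have igw : (leb (n + k)).-integrable setT (EFin \o (fun z => g z * w z)).
  by apply: integrable_mul_sqr => //; exact: Lw.2.
(* Young's inequality; the weight [(2 P)^-1] is chosen so that Poincare's inequality turns the [w]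
   term into half of [fine X]. *)
have E7' (K : R) : 4 * K * \int[leb (n + k)]_z (g z * w z) <=
    (2 * P)^-1 * \int[leb (n + k)]_z (w z ^+ 2) +
    8 * K ^+ 2 * P * \int[leb (n + k)]_z (g z ^+ 2).
  have iw2 := Lw.2.
  rewrite -!RintegralZl//.
  rewrite -(RintegralD measurableT (integrableZl measurableT _ iw2) (integrableZl measurableT _ ig2)).
  apply: le_Rintegral => //.
  - exact: (integrableZl measurableT _ igw).
  - exact: (integrableD measurableT (integrableZl measurableT _ iw2) (integrableZl measurableT _ ig2)).
  move=> z _.
  have P2 : 0 < (2 * P)^-1 by rewrite invr_gt0 mulr_gt0.
  have -> : 8 * K ^+ 2 * P = (2 * P)^-1 * (4 * K * P) ^+ 2.
    by field; exact: lt0r_neq0.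
  have -> : 4 * K * (g z * w z) = (2 * P)^-1 * (2 * (w z * (4 * K * P * g z))).
    by field; exact: lt0r_neq0.
  have -> : (2 * P)^-1 * w z ^+ 2 + (2 * P)^-1 * (4 * K * P) ^+ 2 * g z ^+ 2 =
      (2 * P)^-1 * (w z ^+ 2 + (4 * K * P * g z) ^+ 2).
    by move: (2 * P)^-1 => c; ring.
  rewrite ler_wpM2l ?(ltW P2)//.
  by have := sqr_ge0 (w z - 4 * K * P * g z); move: (w z) (_ * g z) => p q; nra.
have E7 := E7' (kappa s).
have E8 : (2 * P)^-1 * \int[leb (n + k)]_z (w z ^+ 2) <= fine X / 2.
  rewrite invfM -mulrA mulrC ler_wpM2r// ler_pdivrMl//.
have X0 : 0 <= fine X by rewrite fine_ge0// integral_ge0// => t _; exact: heatQ_ge0.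
move: E1 E2 E3 E4 E5 E6 E7 E8 X0.
move: (fine (heatQ s u)) (fine (heatQ s w)) (fine (heatQ s U)) (fine X) (fine Y).
move: (H2 * fine (heatQ s uinf)) (I2 * fine (heatQ s h)).
move: (\int[leb (n + k)]_z (f0 z * w z)) (\int[leb (n + k)]_z (V z * w z)).
move: (\int[leb (n + k)]_z (g z * w z)) => e1 e2 e3 e4 e5 e6 e7 e8 e9 e10.
move: (8 * _ * _ * _) ((2 * P)^-1 * _) (4 * kappa s) => e11 e12 e13.
move=> E1 E2 E3 E4 E5 E6 E7 E8 E9.
(* [E1] to [E5] give [2 X <= I2 * heatQ h + 4 kappa <g, w>]; after [E7] and [E8] absorb [X / 2],
   what remains bounds [3 X / 2], hence [X] as it is nonnegative. *)
have : e13 * e2 - e13 * e3 = e13 * e1 by rewrite -mulrBr E6.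
lra.
Qed.

End fixed_length.

(** * Averages in t *)

Section averages.
Variable R : realType.
Notation mu := (@lebesgue_measure R).
Notation leb := (leb R).
Variables (n k : nat) (s : R) (D : set 'rV[R]_k) (m : R).
Hypotheses (mD : measurable D) (Dm : leb k D = m%:E) (m0 : 0 < m).
Implicit Types (u : 'rV[R]_(n + k) -> R) (c : 'rV[R]_n -> R).

Let integral_D (F : 'rV[R]_k -> \bar R) : measurable_fun setT F -> (forall t, 0 <= F t)%E ->
  (\int[leb k]_(t in D) F t = \int[leb k]_t ((\1_D t)%:E * F t))%E.
Proof.
move=> mF F0; rewrite integral_mkcond; apply: eq_integral => t _.
by rewrite patchE indicE; case: ifPn => _; rewrite ?mul1e ?mul0e.
Qed.

Lemma averageE u x : average D u x = m^-1 * \int[leb k]_t (\1_D t * u (row_mx x t)).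
Proof.
rewrite /average Dm /=; congr (_ * _); rewrite /Rintegral integral_mkcond; congr fine.
apply: eq_integral => t _.
by rewrite patchE indicE; case: ifPn => _; rewrite ?mul1r ?mul0r.
Qed.

Let m1 : measurable_fun setT (\1_D : 'rV[R]_k -> R). Proof. exact: measurable_indic. Qed.

Lemma measurable_average u : measurable_fun setT u -> measurable_fun setT (average D u).
Proof.
move=> mu'.
have -> : average D u = (fun x => m^-1 * \int[leb k]_t (\1_D t * u (row_mx x t))).
  by apply/funext => x; exact: averageE.
apply: measurable_funM => //.
apply: (measurable_Rintegral (leb k) (f := fun x t => \1_D t * u (row_mx x t))).
apply: measurable_funM; last exact: measurable_row2.
exact: (measurableT_comp m1 measurable_snd).
Qed.

Let i1 : (leb k).-integrable setT (EFin \o (\1_D : 'rV[R]_k -> R)).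
Proof.
apply/integrableP; split; first exact/measurable_EFinP.
under eq_integral do rewrite /= ger0_norm//.
by rewrite -integral_indicT// Dm ltry.
Qed.

Let integrable_indic_mul (b : 'rV[R]_k -> R) : (leb k).-integrable setT (EFin \o b) ->
  (leb k).-integrable setT (EFin \o (fun t => \1_D t * b t)).
Proof.
move=> ib; have mb : measurable_fun setT b by apply/measurable_EFinP; exact: measurable_int ib.
apply: le_integrable ib => //; first by apply/measurable_EFinP; exact: measurable_funM.
by move=> t _; rewrite /= lee_fin normrM ler_piMl// ger0_norm.
Qed.

(** Jensen's inequality for the family [\1_D t * (u (row_mx x t) - c x)]: its mean over [D] is the
    average minus [c], because [c] does not depend on t. *)
Lemma average_heatQ_le u c : L12 u -> measurable_fun setT c ->
  (heatQ s (fun x => (average D u x - c x)%R) <=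
   (m^-1)%:E * \int[leb k]_(t in D) heatQ s (fun x => (u (row_mx x t) - c x)%R))%E.
Proof.
move=> Lu mc; have mu' := L12_measurable Lu.
pose b t (x : 'rV[R]_n) := u (row_mx x t) - c x.
have mb : measurable_fun setT (fun p : 'rV[R]_k * 'rV[R]_n => b p.1 p.2).
  apply: measurable_funB; first exact: measurable_row2'.
  exact: (measurableT_comp mc measurable_snd).
pose v t (x : 'rV[R]_n) := \1_D t * b t x.
have mv : measurable_fun setT (fun p : 'rV[R]_k * 'rV[R]_n => v p.1 p.2).
  apply: measurable_funM => //.
  exact: (measurableT_comp m1 measurable_fst).
have mA : measurable_fun setT (fun x => average D u x - c x).
  by apply: measurable_funB => //; exact: measurable_average.
have vD t x : ~ D t -> v t x = 0 by move=> nD; rewrite /v indicE memNset// mul0r.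
apply: (@le_trans _ _ ((m^-1)%:E * \int[leb k]_t heatQ s (v t))%E).
  apply: (jensen_heatQ mD Dm m0 mv mA vD).
  apply: filterS (hslice_integrable_ae Lu.1) => x ix.
  have vE t : v t x = \1_D t * u (row_mx x t) - c x * \1_D t.
    by rewrite /v /b mulrBr [c x * _]mulrC.
  have j1 := integrable_indic_mul ix.
  have j2 := integrableZl measurableT (c x) i1.
  split.
    apply: eq_integrable (integrableB measurableT j1 j2) => // t _.
    by rewrite /= vE EFinB.
  under eq_Rintegral do rewrite vE.
  rewrite (RintegralB measurableT j1 j2) RintegralZl// averageE mulrBr.
  congr (_ - _); rewrite /Rintegral.
  by rewrite -integral_indicT// Dm /= mulrCA mulVf ?gt_eqF// mulr1.
rewrite integral_D; last 2 first.
- exact: (measurable_heatQ_family (v := b) mb).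
- by move=> t; exact: heatQ_ge0.
rewrite lee_wpmul2l ?lee_fin ?invr_ge0 ?(ltW m0)// le_eqVlt; apply/orP; left; apply/eqP.
apply: eq_integral => t _; rewrite /v heatQZ.
  by congr (_%:E * _)%E; rewrite indicE; case: (t \in D); rewrite ?expr1n ?expr0n.
exact: (measurableT_comp mb (@pair1_measurable _ _ _ _ t)).
Qed.

Lemma average_sqr_le u : L12 u ->
  (\int[leb n]_x (average D u x ^+ 2)%:E <=
   (m^-1)%:E * \int[leb (n + k)]_z (u z ^+ 2)%:E)%E.
Proof.
move=> Lu; have mu' := L12_measurable Lu.
have mi0 : 0 <= m^-1 by rewrite invr_ge0 ltW.
have u20 x t : (0 <= (u (row_mx x t) ^+ 2)%:E)%E by rewrite lee_fin sqr_ge0.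
have mI : measurable_fun setT (fun x : 'rV[R]_n => \int[leb k]_t (u (row_mx x t) ^+ 2)%:E)%E.
  apply: (@measurable_leb_integral2 _ _ _ k (fun x t => (u (row_mx x t) ^+ 2)%:E)) => //.
  apply/measurable_EFinP; apply: measurable_funX; exact: measurable_row2.
have I0 x : (0 <= \int[leb k]_t (u (row_mx x t) ^+ 2)%:E)%E by exact: integral_ge0.
rewrite ge0_integral_leb_row; last 2 first.
- by apply/measurable_EFinP; exact: measurable_funX.
- by move=> z; rewrite lee_fin sqr_ge0.
rewrite -(ge0_integralZl_EFin (leb n) measurableT (fun x _ => I0 x) mI mi0).
apply: ae_ge0_le_integral => //.
- by move=> x _; rewrite lee_fin sqr_ge0.
- by apply/measurable_EFinP; apply: measurable_funX; exact: measurable_average.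
- by move=> x _; rewrite mule_ge0.
- exact: measurable_funeM.
apply: filterS (hslice_integrable_ae Lu.1) => x ix _; rewrite averageE.
apply: (le_trans (sqr_mean_le mD Dm m0 (integrable_indic_mul ix) _)).
  by move=> t nD; rewrite indicE memNset// mul0r.
have mux : measurable_fun setT (fun t : 'rV[R]_k => u (row_mx x t)) by exact: measurable_hslice.
rewrite lee_wpmul2l ?lee_fin//; apply: ge0_le_integral => //.
- by move=> t _; rewrite lee_fin sqr_ge0.
- by apply/measurable_EFinP; apply: measurable_funX; exact: measurable_funM.
- by apply/measurable_EFinP; exact: measurable_funX.
- move=> t _; rewrite lee_fin exprMn; apply: ler_piMl; first exact: sqr_ge0.
  by rewrite indicE; case: (t \in D); rewrite ?expr1n ?expr0n.
Qed.

(** Jensen's inequality with [c = 0] and [slice_heatQ_le] bound the energy of the average. For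
    almost every [x] off the closure of [omega], [u] vanishes on almost the whole fibre over [x]. *)
Lemma Htilde_average omega u : 0 < s < 1 -> bounded_set omega -> bounded_set D ->
  Htilde s (cylinder omega D) u -> Htilde s omega (average D u).
Proof.
move=> s01 bo bD Hu; have [mu' u2 Qu au] := (HtildeP _ _ s01).1 Hu.
have [Lu _] := Htilde_L12 (bounded_cylinder bo bD) Hu.
have mi0 : 0 <= m^-1 by rewrite invr_ge0 ltW.
apply/HtildeP => //; split; first exact: measurable_average.
- apply: (le_lt_trans (average_sqr_le Lu)).
  rewrite -(@fineK _ (\int[leb (n + k)]_z (u z ^+ 2)%:E)%E).
    by rewrite -EFinM ltry.
  by rewrite ge0_fin_numE// integral_ge0// => z _; rewrite lee_fin sqr_ge0.
- have -> : average D u = (fun x => average D u x - 0) by apply/funext => x; rewrite subr0.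
  apply: (le_lt_trans (average_heatQ_le (c := fun=> 0) Lu (measurable_cst _))).
  have mQ : measurable_fun setT (fun t => heatQ s (fun x : 'rV[R]_n => u (row_mx x t))).
    exact: (measurable_heatQ_family (v := fun t x => u (row_mx x t)) (measurable_row2' mu')).
  apply: (@le_lt_trans _ _ ((m^-1)%:E * heatQ s u)%E); last first.
    by rewrite -(fineK (heatQ_fin Qu)) -EFinM ltry.
  rewrite lee_wpmul2l ?lee_fin//; apply: le_trans (slice_heatQ_le s Lu).
  under eq_integral => t _.
    rewrite (_ : (fun x => u (row_mx x t) - 0) = (fun x => u (row_mx x t))); last first.
      by apply/funext => x; rewrite subr0.
    over.
  apply: ge0_subset_integral => //.
  by move=> t _; exact: heatQ_ge0.
- apply: filterS (ae_hslice au) => x hx nx; rewrite averageE.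
  rewrite (_ : \int[leb k]_t _ = 0) ?mulr0//.
  rewrite /Rintegral (ae_eq_integral (cst 0%E)) ?integral0//.
  + apply/measurable_EFinP; apply: measurable_funM => //; exact: measurable_hslice.
  + apply: filterS hx => t ht _ /=; rewrite ht ?mulr0// => cz; apply: nx.
    by have := closure_cylinder_lsubmx cz; rewrite row_mxKl.
Qed.

(** After Jensen's inequality, the slice of [u - uinf] is split into the loss [(h t - 1) * uinf] due
    to the cutoff and the error already estimated in [slice_defect_le]. *)
Lemma average_defect_le u (uinf : 'rV[R]_n -> R) (h : 'rV[R]_k -> R) :
  L12 u -> measurable_fun setT uinf -> measurable_fun setT h ->
  (heatQ s (fun x => (average D u x - uinf x)%R) <= (m^-1)%:E *
   (2%:E * heatQ s uinf * \int[leb k]_(t in D) ((1 - h t) ^+ 2)%:E +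
    2%:E * \int[leb k]_t heatQ s (fun x : 'rV[R]_n =>
      - 1 * (uinf (lsubmx (row_mx x t)) * h (rsubmx (row_mx x t))) + u (row_mx x t))%R))%E.
Proof.
move=> Lu muinf mh; have mu' := L12_measurable Lu.
apply: (le_trans (average_heatQ_le Lu muinf)).
rewrite lee_wpmul2l ?lee_fin ?invr_ge0 ?(ltW m0)//.
pose w t (x : 'rV[R]_n) :=
  - 1 * (uinf (lsubmx (row_mx x t)) * h (rsubmx (row_mx x t))) + u (row_mx x t).
have mw : measurable_fun setT (fun p : 'rV[R]_k * 'rV[R]_n => w p.1 p.2).
  have mT := measurable_tensor muinf mh.
  apply: (@measurable_row2' R n k
    (fun z => - 1 * (uinf (lsubmx z) * h (rsubmx z)) + u z)).
  by apply: measurable_funD => //; exact: measurable_funM.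
have mQ : measurable_fun setT (fun t => heatQ s (w t)) by exact: (measurable_heatQ_family (v := w) mw).
have m1h : measurable_fun setT (fun t => ((1 - h t) ^+ 2)%:E : \bar R).
  by apply/measurable_EFinP; apply: measurable_funX; exact: measurable_funB.
have h0 t : (0 <= ((1 - h t) ^+ 2)%:E :> \bar R)%E by rewrite lee_fin sqr_ge0.
have q0 : (0 <= 2%:E * heatQ s uinf)%E by rewrite mule_ge0 ?heatQ_ge0.
apply: (@le_trans _ _ (\int[leb k]_(t in D)
   (2%:E * heatQ s uinf * ((1 - h t) ^+ 2)%:E + 2%:E * heatQ s (w t)))%E).
  have mb : measurable_fun setT (fun p : 'rV[R]_k * 'rV[R]_n => u (row_mx p.2 p.1) - uinf p.2).
    apply: measurable_funB; first exact: measurable_row2'.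
    exact: (measurableT_comp muinf measurable_snd).
  apply: ge0_le_integral => //.
  - by move=> t _; exact: heatQ_ge0.
  - apply: measurable_funTS.
    exact: (measurable_heatQ_family (v := fun t x => u (row_mx x t) - uinf x) mb).
  - apply: measurable_funTS; apply: emeasurable_funD; exact: measurable_funeM.
  - move=> t _.
    have -> : (fun x : 'rV[R]_n => u (row_mx x t) - uinf x) = (fun x => (h t - 1) * uinf x + w t x).
      by apply/funext => x; rewrite /w row_mxKl row_mxKr; ring.
    have mwt : measurable_fun setT (w t).
      exact: (measurableT_comp mw (@pair1_measurable _ _ _ _ t)).
    apply: (le_trans (heatQ_lincomb_le (h t - 1) s muinf mwt)).
    rewrite leeD2r// EFinM -!muleA [(_%:E * heatQ s uinf)%E]muleC.
    by rewrite -[h t - 1]opprB sqrrN.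
rewrite ge0_integralD//; last 4 first.
- by move=> t _; rewrite mule_ge0.
- by apply: measurable_funTS; exact: measurable_funeM.
- by move=> t _; rewrite mule_ge0 ?heatQ_ge0.
- by apply: measurable_funTS; exact: measurable_funeM.
rewrite ge0_integralZl//; last exact: measurable_funTS.
rewrite leeD2l// ge0_integralZl_EFin//; last 2 first.
- by move=> t _; exact: heatQ_ge0.
- exact: measurable_funTS.
rewrite lee_wpmul2l//; apply: ge0_subset_integral => //.
by move=> t _; exact: heatQ_ge0.
Qed.

End averages.

(** * The limit *)

Section dilations.
Variable R : realType.
Notation leb := (leb R).
Variables (k : nat) (B : set 'rV[R]_k).
Implicit Types l : R.

Lemma dilateP l t : 0 < l -> dilate l B (l *: t) <-> B t.
Proof.
move=> l0; split; last by exists t.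
move=> [t' Bt' /(congr1 ( *:%R l^-1))].
by rewrite !scalerA mulVf ?gt_eqF// !scale1r => <-.
Qed.

Lemma dilateE l : 0 < l -> dilate l B = [set t | B (l^-1 *: t)].
Proof.
move=> l0; apply/seteqP; split => t /=.
  by move=> [t' Bt' <-]; rewrite scalerA mulVf ?gt_eqF// scale1r.
by move=> Bt; exists (l^-1 *: t) => //; rewrite scalerA mulfV ?gt_eqF// scale1r.
Qed.

Lemma measurable_dilate l : 0 < l -> measurable B -> measurable (dilate l B).
Proof.
move=> l0 mB; rewrite dilateE//.
have mZ : measurable_fun setT (fun t : 'rV[R]_k => l^-1 *: t) by exact: measurable_rVZ.
by rewrite -[X in measurable X]setTI; exact: mZ.
Qed.

Lemma integral_dilate l (F : 'rV[R]_k -> \bar R) : 0 < l -> measurable B ->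
  measurable_fun setT F -> (forall t, 0 <= F t)%E ->
  (\int[leb k]_(t in dilate l B) F (l^-1 *: t) =
   (l ^+ k)%:E * \int[leb k]_(t in B) F t)%E.
Proof.
move=> l0 mB mF F0.
have il0 : 0 < l^-1 by rewrite invr_gt0.
have mP : measurable_fun setT (F \_ B).
  by apply/(measurable_restrictT _ _).1 => //; exact: measurable_funTS.
have P0 t : (0 <= (F \_ B) t)%E by rewrite patchE; case: ifP.
rewrite integral_mkcond [in RHS]integral_mkcond.
rewrite -[X in (X ^+ k)%:E]invrK -(ge0_integral_leb_scale il0 mP P0).
by apply: eq_integral => t _; rewrite !patchE dilateE.
Qed.

Lemma leb_dilate l : 0 < l -> measurable B -> leb k (dilate l B) = ((l ^+ k)%:E * leb k B)%E.
Proof.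
move=> l0 mB; have := @integral_dilate l (fun=> 1%E) l0 mB (measurable_cst _) (fun=> lee01).
by rewrite !integral_cst ?mul1e//; exact: measurable_dilate.
Qed.

Lemma bounded_dilate l : 0 < l -> bounded_set B -> bounded_set (dilate l B).
Proof.
move=> l0 [M [rM HM]]; exists (l * (M + 1)); split; first exact: num_real.
move=> M' hM' _ [t Bt <-] /=.
have tM : `|t| <= M + 1 by apply: HM Bt; rewrite ltrDl.
apply: le_trans (ltW hM'); apply: le_trans (_ : l * `|t| <= _).
  by rewrite normrZ gtr0_norm.
by rewrite ler_wpM2l// ltW.
Qed.

Lemma leb_bounded_lty : bounded_set B -> measurable B -> (leb k B < +oo)%E.
Proof.
move=> bB mB; have [r [_ Br]] := closure_bounded bB.
apply: le_lt_trans (enorm_ball_lty k r).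
apply: le_measure; rewrite ?inE//; first exact: measurable_enorm_ball.
by move=> t /subset_closure; exact: Br.
Qed.

Lemma setC_bounded_neq0 : (0 < k)%N -> bounded_set B -> ~` B !=set0.
Proof.
move=> k0 bB; have [r [r0 Br]] := closure_bounded bB.
exists (const_mx r) => /subset_closure/Br; apply/negP; rewrite -leNgt.
by have := coord_le_enorm (const_mx r) (Ordinal k0); rewrite mxE ger0_norm// ltW.
Qed.

Lemma leb_open_gt0 : open B -> B 0 -> (0 < leb k B)%E.
Proof.
move=> oB B0; have /nbhs_ballP[e /= e0 eB] := open_nbhs_nbhs (conj oB B0).
apply: (@lt_le_trans _ _ (leb k (box (- (e / 2)) (e / 2)))).
  rewrite leb_box; last lra.
  by rewrite lte_fin exprn_gt0//; lra.
apply: le_measure; rewrite ?inE; [exact: measurable_box|exact: open_measurable_rV|].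
move=> t tb; apply: eB; split => // i j; rewrite (ord1 i) mxE -ball_normE /= sub0r normrN.
have := tb j; rewrite in_itv/= => /andP[h1 h2].
by rewrite ltr_norml; apply/andP; split; lra.
Qed.

End dilations.

Section limits.
Variable R : realType.

Lemma sqrt_lte (x : \bar R) (e : R) : (0 <= x)%E -> 0 < e ->
  ((x `^ 2^-1)%E < e%:E)%E = (x < (e ^+ 2)%:E)%E.
Proof.
case: x => [r| |]// r0 e0; last by rewrite /= invr_eq0 pnatr_eq0.
rewrite poweR_EFin !lte_fin powR12_sqrt//.
rewrite -[e in LHS]gtr0_norm// -sqrtr_sqr ltr_sqrt// exprn_gt0//.
Qed.

Lemma ge0_cvg0 T (F : set_system T) {FF : Filter F} (g : T -> \bar R) :
  (forall x, 0 <= g x)%E ->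
  (forall e, 0 < e -> \forall x \near F, (g x < e%:E)%E) <-> (g x @[x --> F] --> 0%E).
Proof.
move=> g0; split.
  move=> H; apply/fine_cvgP; split.
    by apply: filterS (H 1 ltr01) => x gx; rewrite ge0_fin_numE// (lt_le_trans gx)// leey.
  apply/cvgr0Pnorm_lt => e e0; apply: filterS (H e e0) => x gx /=.
  rewrite ger0_norm ?fine_ge0// -lte_fin fineK// ge0_fin_numE//.
  by rewrite (lt_le_trans gx)// leey.
move=> cv e e0; apply: (cv [set y | (y < e%:E)%E]); apply: open_nbhs_nbhs; split.
  exact: open_ereal_lt_ereal.
by rewrite /= lte_fin.
Qed.

End limits.

(** * The defect of the sources after rescaling *)

Section source_defect.
Variable R : realType.
Notation leb := (leb R).
Variables (n k : nat) (omega : set 'rV[R]_n) (B : set 'rV[R]_k) (l : R).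
Hypotheses (l0 : 0 < l) (mB : measurable B).
Variables (f : 'rV[R]_(n + k) -> R) (finf : 'rV[R]_n -> R) (eta : 'rV[R]_k -> R).
Hypotheses (Lf : L2 (cylinder omega (dilate l B)) f) (Lfinf : L2 omega finf).
Hypotheses (meta : measurable_fun setT eta) (etaB : forall t, ~ B t -> eta t = 0).

(** Only the last [k] variables are dilated, whence the Jacobian [l ^+ k]. *)
Lemma integral_leb_rscale (F : 'rV[R]_(n + k) -> \bar R) :
  measurable_fun setT F -> (forall z, 0 <= F z)%E ->
  (\int[leb (n + k)]_z F z =
   (l ^+ k)%:E * \int[leb (n + k)]_z F (row_mx (lsubmx z) (l *: rsubmx z)))%E.
Proof.
move=> mF F0.
have mS : measurable_fun setT (fun z : 'rV[R]_(n + k) =>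
    F (row_mx (lsubmx z) (l *: rsubmx z))).
  apply: (measurableT_comp mF); apply: measurable_row_mx; first exact: measurable_lsubmx.
  by apply: measurable_rVZ => //; exact: measurable_rsubmx.
have lk0 : 0 <= l ^+ k by rewrite exprn_ge0// ltW.
rewrite !ge0_integral_leb_row//.
have mI : measurable_fun setT (fun x : 'rV[R]_n => \int[leb k]_t
    F (row_mx (lsubmx (row_mx x t)) (l *: rsubmx (row_mx x t))))%E.
  apply: (@measurable_leb_integral2 _ _ _ k (fun x t =>
    F (row_mx (lsubmx (row_mx x t)) (l *: rsubmx (row_mx x t))))) => //.
  exact: (measurableT_comp mS (measurable_row_mx measurable_fst measurable_snd)).
rewrite -(ge0_integralZl_EFin (leb n) measurableT
  (fun x _ => integral_ge0 _ (fun t _ => F0 _)) mI lk0).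
apply: eq_integral => x _.
have mFx : measurable_fun setT (fun t : 'rV[R]_k => F (row_mx x t)).
  by apply: (measurableT_comp mF); exact: measurable_row_mx.
under [in RHS]eq_integral do rewrite row_mxKl row_mxKr.
rewrite (ge0_integral_leb_scale l0 mFx (fun t => F0 _)) muleA -EFinM.
by rewrite -exprMn mulfV ?gt_eqF// expr1n mul1e.
Qed.

Let F z := f (row_mx (lsubmx z) (l *: rsubmx z)) - finf (lsubmx z).
Let g z := (f \_ (cylinder omega (dilate l B))) z -
  (finf \_ omega) (lsubmx z) * eta (l^-1 *: rsubmx z).

Let mfinf0 : measurable_fun setT (finf \_ omega). Proof. exact: L2_measurable Lfinf. Qed.
Let mf0 : measurable_fun setT (f \_ (cylinder omega (dilate l B))).
Proof. exact: L2_measurable Lf. Qed.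

Let cylE (z : 'rV[R]_(n + k)) :
  (row_mx (lsubmx z) (l *: rsubmx z) \in cylinder omega (dilate l B)) =
  (z \in cylinder omega B).
Proof.
apply/idP/idP; rewrite !inE /cylinder /= row_mxKl row_mxKr => -[h1 h2]; split => //.
  exact: (dilateP B (rsubmx z) l0).1 h2.
exact: (dilateP B (rsubmx z) l0).2 h2.
Qed.

Let b (z : 'rV[R]_(n + k)) := (finf \_ omega) (lsubmx z) * (\1_B (rsubmx z) - eta (rsubmx z)).

(** By [cylE], rescaling maps the extension by zero from the long cylinder to that from the fixed
    one, and the indicator of a cylinder is the product of two indicators. *)
Let FE z : (F \_ (cylinder omega B)) z =
  (f \_ (cylinder omega (dilate l B))) (row_mx (lsubmx z) (l *: rsubmx z)) -
  (finf \_ omega) (lsubmx z) * \1_B (rsubmx z).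
Proof.
rewrite [in RHS]patchE cylE !patchE indicE; case: ifPn => [/set_mem[h1 h2]|].
  by rewrite !mem_set// mulr1.
rewrite notin_setE => nz; rewrite sub0r; case: ifPn => [/set_mem h1|_]; last first.
  by rewrite mul0r oppr0.
by rewrite memNset ?mulr0 ?oppr0// => h2; apply: nz; split.
Qed.

Let measurable_F : measurable_fun setT (F \_ (cylinder omega B)).
Proof.
have -> : F \_ (cylinder omega B) = (fun z =>
    (f \_ (cylinder omega (dilate l B))) (row_mx (lsubmx z) (l *: rsubmx z)) -
    (finf \_ omega) (lsubmx z) * \1_B (rsubmx z)).
  by apply/funext => z; exact: FE.
have ml : measurable_fun setT (fun z : 'rV[R]_(n + k) => lsubmx z) by exact: measurable_lsubmx.
have mr : measurable_fun setT (fun z : 'rV[R]_(n + k) => rsubmx z) by exact: measurable_rsubmx.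
apply: measurable_funB.
  by apply: (measurableT_comp mf0); apply: measurable_row_mx => //; exact: measurable_rVZ.
apply: measurable_funM; first exact: measurableT_comp.
have m1 : measurable_fun setT (\1_B : 'rV[R]_k -> R) by exact: measurable_indic.
exact: (measurableT_comp m1 mr).
Qed.

(** In rescaled variables [g] is the defect [F] of the data plus [b], the part of [finf] removed by
    the cutoff; the bound is [(p + q)^2 <= 2 p^2 + 2 q^2]. *)
Lemma source_defect_le :
  (\int[leb (n + k)]_z (g z ^+ 2)%:E <= (l ^+ k)%:E *
    (2%:E * \int[leb (n + k)]_z ((F \_ (cylinder omega B)) z ^+ 2)%:E +
     2%:E * (\int[leb n]_x ((finf \_ omega) x ^+ 2)%:E *
             \int[leb k]_(t in B) ((1 - eta t) ^+ 2)%:E)))%E.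
Proof.
have mdeta : measurable_fun setT (fun t => \1_B t - eta t).
  by apply: measurable_funB => //; exact: measurable_indic.
have mb : measurable_fun setT b by exact: (measurable_tensor mfinf0 mdeta).
have mg : measurable_fun setT g.
  apply: measurable_funB => //.
  apply: (measurable_tensor mfinf0 (h := fun t => eta (l^-1 *: t))).
  by apply: (measurableT_comp meta); exact: measurable_rVZ.
rewrite integral_leb_rscale; last 2 first.
- by apply/measurable_EFinP; exact: measurable_funX.
- by move=> z; rewrite lee_fin sqr_ge0.
rewrite lee_wpmul2l ?lee_fin ?exprn_ge0 ?(ltW l0)//.
have -> : (\int[leb k]_(t in B) ((1 - eta t) ^+ 2)%:E =
    \int[leb k]_t ((\1_B t - eta t) ^+ 2)%:E)%E.
  rewrite integral_mkcond; apply: eq_integral => t _.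
  rewrite patchE indicE; case: ifPn => //; rewrite notin_setE => /etaB ->.
  by rewrite subrr expr0n.
rewrite -(integral_tensor_sqr mfinf0 mdeta) -/b.
have m2 (a : 'rV[R]_(n + k) -> R) : measurable_fun setT a ->
    measurable_fun setT (fun z => (a z ^+ 2)%:E).
  by move=> ma; apply/measurable_EFinP; exact: measurable_funX.
have sq0 (a : 'rV[R]_(n + k) -> R) z : setT z -> (0 <= (a z ^+ 2)%:E)%E.
  by rewrite lee_fin sqr_ge0.
rewrite -(ge0_integralZl_EFin _ measurableT (sq0 _) (m2 _ measurable_F) (ler0n _ 2)).
rewrite -(ge0_integralZl_EFin _ measurableT (sq0 _) (m2 _ mb) (ler0n _ 2)).
rewrite -ge0_integralD//; first last.
- exact: measurable_funeM (m2 _ mb).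
- by move=> z zT; rewrite mule_ge0//; exact: sq0.
- exact: measurable_funeM (m2 _ measurable_F).
- by move=> z zT; rewrite mule_ge0//; exact: sq0.
apply: ge0_le_integral => //.
- by move=> z _; rewrite lee_fin sqr_ge0.
- apply/measurable_EFinP; apply: measurable_funX; apply: (measurableT_comp mg).
  apply: measurable_row_mx; first exact: measurable_lsubmx.
  by apply: measurable_rVZ => //; exact: measurable_rsubmx.
- by apply: emeasurable_funD; apply: measurable_funeM; [exact: m2 measurable_F|exact: m2].
- move=> z _; rewrite -!EFinM -EFinD lee_fin.
  have -> : g (row_mx (lsubmx z) (l *: rsubmx z)) = (F \_ (cylinder omega B)) z + b z.
    rewrite FE /g /b row_mxKl row_mxKr scalerA mulVf ?gt_eqF// scale1r; ring.
  have := sqr_ge0 ((F \_ (cylinder omega B)) z - b z).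
  by move: (_ z) (b z) => p q; nra.
Qed.

End source_defect.

Section main_bound.
Variable R : realType.
Notation leb := (leb R).
Variables (n k : nat) (s : R) (omega : set 'rV[R]_n) (B : set 'rV[R]_k).
Variables (f u : R -> 'rV[R]_(n + k) -> R) (finf uinf : 'rV[R]_n -> R).
Hypotheses (n0 : (0 < n)%N) (k0 : (0 < k)%N) (s01 : 0 < s < 1).
Hypothesis bomega : bounded_set omega.
Hypotheses (bB : bounded_set B) (oB : open B) (B0 : B 0).
Hypotheses (Lf : forall l, 0 < l -> L2 (cylinder omega (dilate l B)) (f l))
  (wu : forall l, 0 < l ->
    weak_solution s (cylinder omega (dilate l B)) (f l) (u l))
  (Lfinf : L2 omega finf) (wuinf : weak_solution s omega finf uinf).

Let mB : measurable B. Proof. exact: open_measurable_rV. Qed.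
Let nB : ~` B !=set0. Proof. exact: setC_bounded_neq0. Qed.
Let Bfin : (leb k B < +oo)%E. Proof. exact: leb_bounded_lty. Qed.
Let m := fine (leb k B).
Let m0 : 0 < m. Proof. by rewrite fine_gt0// Bfin leb_open_gt0. Qed.
Let mE : leb k B = m%:E. Proof. by rewrite fineK// ge0_fin_numE. Qed.
Let Dm l : 0 < l -> leb k (dilate l B) = (l ^+ k * m)%:E.
Proof. by move=> l0; rewrite leb_dilate// mE. Qed.
Let Dm0 l : 0 < l -> 0 < l ^+ k * m. Proof. by move=> l0; rewrite mulr_gt0// exprn_gt0. Qed.

Lemma Htilde_average_dilate l : 0 < l -> Htilde s omega (average (dilate l B) (u l)).
Proof.
move=> l0.
apply: (Htilde_average (measurable_dilate l0 mB) (Dm l0) (Dm0 l0) s01 bomega).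
  exact: bounded_dilate.
exact: (wu l0).1.
Qed.

Let e j := fine (\int[leb k]_(t in B) ((1 - cutoff B j t) ^+ 2)%:E).

Let e_fin j : (\int[leb k]_(t in B) ((1 - cutoff B j t) ^+ 2)%:E = (e j)%:E)%E.
Proof.
rewrite fineK// ge0_fin_numE; last by apply: integral_ge0 => t _; rewrite lee_fin sqr_ge0.
apply: le_lt_trans Bfin; rewrite -[leRHS]mul1e -integral_cst//.
apply: ge0_le_integral => //.
- by move=> t _; rewrite lee_fin sqr_ge0.
- apply/measurable_funTS/measurable_EFinP; apply: measurable_funX.
  by apply: measurable_funB => //; exact: measurable_cutoff.
- move=> t _; rewrite lee_fin; have := cutoff_itv nB j t.
  by move: (cutoff _ _ _) => p /andP[? ?]; nra.
Qed.

Let S l : \bar R := (\int[leb (n + k)]_z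
  (((fun z => f l (row_mx (lsubmx z) (l *: rsubmx z)) - finf (lsubmx z)) \_
    (cylinder omega B)) z ^+ 2)%:E)%E.

(** The quantifiers encode the order of the limits: [A] and [K] depend neither on the cutoff nor on
    [l], whereas [C] contains the energy of the cutoff and multiplies a negative power of [l]. The
    Jacobians [l ^+ k] cancel against the volume of the dilated set. *)
Lemma average_defect_bound : exists A K : R, [/\ 0 <= A, 0 <= K &
  forall j, exists2 C : R, 0 <= C & forall l sg, 0 < l -> (S l <= sg%:E)%E ->
    (heatQ s (fun x => (average (dilate l B) (u l) x - uinf x)%R) <=
     (A * e j + C * l `^ (- (2 * s)) + K * sg)%:E)%E].
Proof.
have [rho [rho0 omega_rho]] := closure_bounded bomega.
have [P [P0 poinc]] := poincare n0 s01 (ltW rho0).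
have Huinf := wuinf.1.
have [muinf uinf2 Quinf _] := (HtildeP _ _ s01).1 Huinf.
pose I2 := fine (\int[leb n]_x (uinf x ^+ 2)%:E)%E.
pose F2 := fine (\int[leb n]_x ((finf \_ omega) x ^+ 2)%:E)%E.
have F2E : (\int[leb n]_x ((finf \_ omega) x ^+ 2)%:E = F2%:E)%E.
  by rewrite fineK// integrable_fin_num//; exact: L2_integrable_sqr.
have I20 : 0 <= I2 by rewrite fine_ge0// integral_ge0// => x _; rewrite lee_fin sqr_ge0.
have F20 : 0 <= F2 by rewrite fine_ge0// integral_ge0// => x _; rewrite lee_fin sqr_ge0.
pose q := fine (heatQ s uinf); have q0 : 0 <= q by rewrite fine_ge0 ?heatQ_ge0.
pose c := 8 * kappa s ^+ 2 * P.
have c0 : 0 <= c by rewrite /c -mulrA mulr_ge0// mulr_ge0 ?sqr_ge0// ltW.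
(* [2 q] is the loss [(h - 1) * uinf] in [average_defect_le]; each [4 c] combines the factor two of
   that lemma, the constant [c] of [slice_defect_le] and the factor two of [source_defect_le]. *)
exists (m^-1 * (2 * q + 4 * c * F2)), (m^-1 * (4 * c)); split.
- apply: mulr_ge0; first by rewrite invr_ge0 ltW.
  exact: addr_ge0 (mulr_ge0 (ler0n _ 2) q0) (mulr_ge0 (mulr_ge0 (ler0n _ 4) c0) F20).
- by apply: mulr_ge0; [rewrite invr_ge0 ltW|exact: mulr_ge0 (ler0n _ 4) c0].
move=> j; pose eta := cutoff B j.
have meta : measurable_fun setT eta by exact: measurable_cutoff.
have eta01 t : 0 <= eta t <= 1 by exact: cutoff_itv.
have etaB t : ~ B t -> eta t = 0 by exact: cutoff_out.
have Qeta : (heatQ s eta < +oo)%E.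
  exact: (heatQ_lipschitz_lty meta eta01 (cutoff_lipschitz nB j) mB Bfin etaB s01).
exists (m^-1 * (2 * I2 * fine (heatQ s eta))).
  apply: mulr_ge0; first by rewrite invr_ge0 ltW.
  by apply: mulr_ge0 (mulr_ge0 (ler0n _ 2) I20) _; rewrite fine_ge0 ?heatQ_ge0.
move=> l sg l0 Ssg.
have il0 : 0 < l^-1 by rewrite invr_gt0.
have lk0 : 0 < l ^+ k by rewrite exprn_gt0.
pose h t := eta (l^-1 *: t).
have mh : measurable_fun setT h.
  by apply: (measurableT_comp meta); exact: measurable_rVZ.
have hD t : ~ dilate l B t -> h t = 0 by rewrite dilateE//; exact: etaB.
have mD := measurable_dilate l0 mB; have bD := bounded_dilate l0 bB.
have Dfin : (leb k (dilate l B) < +oo)%E by rewrite Dm// ltry.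
have h2 : (\int[leb k]_t (h t ^+ 2)%:E < +oo)%E.
  apply: le_lt_trans Dfin; rewrite (integral_indicT mD).
  apply: ge0_le_integral => //.
  - by move=> t _; rewrite lee_fin sqr_ge0.
  - by apply/measurable_EFinP; exact: measurable_funX.
  - by apply/measurable_EFinP; exact: measurable_indic.
  - move=> t _; rewrite lee_fin indicE; case: (boolP (t \in _)) => [_|].
      by have /andP[? ?] := eta01 (l^-1 *: t); rewrite exprn_ile1.
    by rewrite notin_setE => /hD ->; rewrite expr0n.
(* [h] is [eta] dilated by [l^-1], so [heatQ_scale] gives the order [l^(k - 2s)], smaller than the
   volume by the factor [l^(-2s)]. *)
have QhE : heatQ s h = (l ^+ k * l `^ (- (2 * s)) * fine (heatQ s eta))%:E.
  rewrite /h (heatQ_scale s il0 meta) invrK [in RHS]EFinM fineK ?heatQ_fin//.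
  by rewrite powR_invl// powRN.
have Qh : (heatQ s h < +oo)%E by rewrite QhE ltry.
have X := slice_defect_le s01 bomega bD (Lf l0) Lfinf
  (wu l0) wuinf mh h2 Qh hD P0 omega_rho poinc.
have Lu : L12 (u l) by exact: (Htilde_L12 (bounded_cylinder bomega bD) (wu l0).1).1.
have := average_defect_le s mD (Dm l0) (Dm0 l0) Lu muinf mh.
move=> /le_trans; apply.
set G := \int[leb (n + k)]_z _ in X.
have GE : G <= l ^+ k * (2 * sg + 2 * (F2 * e j)).
  have := source_defect_le l0 mB (Lf l0) Lfinf meta etaB.
  rewrite F2E e_fin => H.
  have {}H := le_trans H (lee_wpmul2l _ (leeD2r _ (lee_wpmul2l _ Ssg))).
  rewrite -lee_fin /G /Rintegral fineK; last first.
    rewrite ge0_fin_numE; last by apply: integral_ge0 => z _; rewrite lee_fin sqr_ge0.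
    apply: le_lt_trans (H _ _) _; rewrite ?lee_fin ?(ltW lk0)//.
    exact: (ltry (l ^+ k * (2 * sg + 2 * (F2 * e j)))).
  by apply: le_trans (H _ _) _; rewrite ?lee_fin ?(ltW lk0).
have ehD : (\int[leb k]_(t in dilate l B) ((1 - h t) ^+ 2)%:E = (l ^+ k * e j)%:E)%E.
  rewrite (integral_dilate (F := fun t => ((1 - eta t) ^+ 2)%:E) l0 mB).
  - by rewrite e_fin.
  - by apply/measurable_EFinP; apply: measurable_funX; exact: measurable_funB.
  - by move=> t; rewrite lee_fin sqr_ge0.
rewrite ehD -(fineK (heatQ_fin Quinf)) -/q.
set XX := (\int[leb k]_t _)%E; rewrite -/XX in X.
rewrite QhE /= -/I2 -/c in X.
have im0 : 0 <= (l ^+ k * m)^-1 by rewrite invr_ge0 ltW// Dm0.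
apply: le_trans (lee_wpmul2l _ (leeD2l _ (lee_wpmul2l _ X))) _; rewrite ?lee_fin//.
have GE' := ler_wpM2l c0 GE.
rewrite ler_pdivrMl; last exact: Dm0.
set L := l `^ _ in GE' *; set Qe := fine (heatQ s eta).
have -> : l ^+ k * m * (m^-1 * (2 * q + 4 * c * F2) * e j + m^-1 * (2 * I2 * Qe) * L +
    m^-1 * (4 * c) * sg) =
  2 * q * (l ^+ k * e j) + 2 * (I2 * (l ^+ k * L * Qe) +
    c * (l ^+ k * (2 * sg + 2 * (F2 * e j)))).
  by field; exact: lt0r_neq0.
by rewrite lerD2l ler_wpM2l// lerD2l.
Qed.

End main_bound.

Lemma L2norm_sqrt (R : realType) d U (v : 'rV[R]_d -> R) :
  L2norm U v = ((\int[leb R d]_z ((v \_ U) z ^+ 2)%:E) `^ 2^-1)%E.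
Proof.
rewrite /L2norm unlock; congr poweR; apply: eq_integral => z _.
by rewrite /= powR_mulrn// real_normK ?num_real.
Qed.

Theorem theorem3p1 (R : realType) (n k : nat) (s : R)
  (omega : set 'rV[R]_n) (B : set 'rV[R]_k)
  (f u : R -> 'rV[R]_(n + k) -> R) (finf uinf : 'rV[R]_n -> R) :
  (0 < n)%N -> (0 < k)%N -> 0 < s < 1 ->
  lipschitz_domain omega -> bounded_set omega ->
  bounded_set B -> open B -> convex_set B -> B 0 ->
  (forall l, 0 < l -> L2 (cylinder omega (dilate l B)) (f l)) ->
  (forall l, 0 < l ->
    weak_solution s (cylinder omega (dilate l B)) (f l) (u l)) ->
  L2 omega finf ->
  L2norm (cylinder omega B)
    (fun z => f l (row_mx (lsubmx z) (l *: rsubmx z)) - finf (lsubmx z))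
    @[l --> +oo%R] --> 0%E ->
  weak_solution s omega finf uinf ->
  (forall l, 0 < l -> Htilde s omega (average (dilate l B) (u l))) /\
  Htilde_norm s (fun x => average (dilate l B) (u l) x - uinf x)
    @[l --> +oo%R] --> 0%E.
Proof.
move=> n0 k0 s01 _ bomega bB oB _ B0 Lf wu Lfinf cvf wuinf.
have Hav := Htilde_average_dilate s01 bomega bB oB B0 wu.
split=> //.
have [A [K [A0 K0 bound]]] :=
  average_defect_bound n0 k0 s01 bomega bB oB B0 Lf wu Lfinf wuinf.
have [c [c0 cE]] := energyE n s01.
have int0 (v : 'rV[R]_(n + k) -> R) : (0 <= \int[leb R (n + k)]_z (v z ^+ 2)%:E)%E.
  by apply: integral_ge0 => z _; rewrite lee_fin sqr_ge0.
have nbhs_gt0 : \forall l \near +oo%R, 0 < (l : R) by exact: nbhs_pinfty_gt.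
apply/ge0_cvg0; first by move=> l; exact: poweR_ge0.
move=> eps eps0; have e0 : 0 < eps ^+ 2 / c by rewrite divr_gt0// exprn_gt0.
set e := eps ^+ 2 / c in e0.
(* The constants may vanish; [A + 1], [K + 1] and [C + 1] are safe denominators, and
   [x / (x + 1) <= 1] still leaves each term below a quarter of [e]. *)
have A1 : 0 < A + 1 by rewrite ltr_wpDl.
have K1 : 0 < K + 1 by rewrite ltr_wpDl.
have Bfin := leb_bounded_lty bB (open_measurable_rV oB).
have d0 : 0 < e / (4 * (A + 1)) by rewrite divr_gt0// mulr_gt0.
(* The cutoff is fixed here, before [l] grows: the constant [C] extracted next depends on [j]. *)
have [j ej] := cutoff_approx oB (setC_bounded_neq0 k0 bB) Bfin d0.
have [C C0 HC] := bound j.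
have C1 : 0 < C + 1 by rewrite ltr_wpDl.
pose sg := e / (4 * (K + 1)); have sg0 : 0 < sg by rewrite divr_gt0// mulr_gt0.
have near1 : \forall l \near +oo%R, ((L2norm (cylinder omega B)
    (fun z => f l (row_mx (lsubmx z) (l *: rsubmx z)) - finf (lsubmx z))%R)
    < (Num.sqrt sg)%:E)%E.
  have L20 l : (0 <= L2norm (cylinder omega B)
      (fun z => f l (row_mx (lsubmx z) (l *: rsubmx z)) - finf (lsubmx z))%R)%E.
    by rewrite L2norm_sqrt; exact: poweR_ge0.
  have sg1 : 0 < Num.sqrt sg by rewrite sqrtr_gt0.
  by have [_ H] := ge0_cvg0 (F := +oo%R) L20; exact: (H cvf _ sg1).
have near2 : \forall l \near +oo%R, l `^ (- (2 * s)) < e / (4 * (C + 1)).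
  have t0 : 0 < e / (4 * (C + 1)) by rewrite divr_gt0// mulr_gt0.
  have /andP[s0 _] := s01.
  set t := e / _ in t0 *; have p0 : 0 < 2 * s by rewrite mulr_gt0.
  (* [t^-1] to the power [1 / (2 s)] is the length beyond which [l^(-2s) < t]. *)
  have tE : (t^-1 `^ (2 * s)^-1) `^ (2 * s) = t^-1.
    by rewrite -powRrM mulVf ?gt_eqF// powRr1// invr_ge0 ltW.
  near=> l.
  have l0 : 0 < l by near: l.
  rewrite powRN -[ltRHS]invrK ltf_pV2 ?posrE ?powR_gt0 ?invr_gt0// -tE.
  have hl : t^-1 `^ (2 * s)^-1 < l by near: l; exact: nbhs_pinfty_gt.
  by rewrite gt0_ltr_powR ?nnegrE ?powR_ge0 ?(ltW l0).
near=> l.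
have l0 : 0 < l by near: l.
have : (L2norm (cylinder omega B)
    (fun z => f l (row_mx (lsubmx z) (l *: rsubmx z)) - finf (lsubmx z))%R
    < (Num.sqrt sg)%:E)%E by near: l.
rewrite L2norm_sqrt sqrt_lte ?sqrtr_gt0// sqr_sqrtr ?(ltW sg0)// => Sl.
have {}HC := HC l sg l0 (ltW Sl).
have Lt : l `^ (- (2 * s)) < e / (4 * (C + 1)) by near: l.
have [mav _ _ _] := (HtildeP _ _ s01).1 (Hav l l0).
have [muinf _ _ _] := (HtildeP _ _ s01).1 wuinf.1.
rewrite /Htilde_norm cE; last exact: measurable_funB.
rewrite sqrt_lte// ?mule_ge0 ?heatQ_ge0 ?lee_fin ?(ltW c0)//.
apply: le_lt_trans (lee_wpmul2l _ HC) _; first by rewrite lee_fin ltW.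
rewrite -EFinM lte_fin.
have -> : eps ^+ 2 = c * e by rewrite /e mulrC divfK ?gt_eqF.
rewrite ltr_pM2l//.
set ej' := fine _.
have quarter (x : R) : 0 <= x -> x * (e / (4 * (x + 1))) <= e / 4.
  move=> x0; have x1 : 0 < 4 * (x + 1) by rewrite mulr_gt0// ltr_wpDl.
  by rewrite mulrA ler_pdivrMr// -subr_ge0 (_ : _ - _ = e) ?(ltW e0)//; field.
have b1 : A * ej' <= e / 4.
  have h : ej' <= e / (4 * (A + 1)).
    have I0 : (0 <= \int[leb R k]_(t in B) ((1 - cutoff B j t) ^+ 2)%:E)%E.
      by apply: integral_ge0 => t _; rewrite lee_fin sqr_ge0.
    rewrite -lee_fin fineK; first exact: ltW.
    by rewrite ge0_fin_numE// (lt_le_trans ej)// leey.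
  apply: (le_trans (ler_wpM2l A0 h)).
  exact: quarter.
have b2 : C * l `^ (- (2 * s)) <= e / 4.
  apply: (le_trans (ler_wpM2l C0 (ltW Lt))).
  exact: quarter.
have b3 : K * sg <= e / 4 by exact: quarter.
apply: (@le_lt_trans _ _ (e / 4 + e / 4 + e / 4)); first by rewrite !lerD.
by lra.
Unshelve. all: by end_near.
Qed.
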